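(* Let $(X_i)_{i\in\mathbb{Z}}$ be a strictly stationary sequence of real-valued random variables, let $f:\mathbb{R}\to\mathbb{R}$ be a monotonic function, and let $Y_j=f(X_j)$. Assume that $$\sum_{k=1}^\infty\beta_{2,\mathbf{X}}(k)<\infty .$$ Let $(m_n)$ be a sequence of positive integers such that $\lim_{n\to\infty} n/m_n=c$ for some $c\in[0,\infty)$, and, with $m=m_n$, let $$U_n=\frac{1}{nm}\sum_{i=1}^n\sum_{j=n+1}^{n+m}\mathbf{1}_{X_i<Y_j}.$$ Then $\sqrt n\,(U_n-\pi)$ converges in distribution, as $n\to\infty$, to $\mathcal{N}(0,V)$, where $$V=\mathrm{Var}(H_Y(X_0))+2\sum_{k=1}^\infty\mathrm{Cov}(H_Y(X_0),H_Y(X_k))+c\left(\mathrm{Var}(G_X(f(X_0)))+2\sum_{k=1}^\infty\mathrm{Cov}(G_X(f(X_0)),G_X(f(X_k)))\right).$$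
   Context: Notation. $\pi=\mathbb{P}(X_1<f(X_1^* ))$, where $X_1^*$ is an independent copy of $X_1$; $H_Y(t)=\mathbb{P}(f(X_1)>t)$ and $G_X(t)=\mathbb{P}(X_1<t)$ for $t\in\mathbb{R}$. $\mathcal{N}(0,V)$ is the normal distribution with mean $0$ and variance $V$ (the Dirac mass at $0$ if $V=0$). Dependence coefficients. For a strictly stationary sequence $(X_i)_{i\in\mathbb{Z}}$ of real-valued random variables, let $\mathcal{F}_0=\sigma(X_k,k\le0)$, let $F$ be the cumulative distribution function of $X_0$, and let $f_x(z)=\mathbf{1}_{z\le x}-F(x)$. Let $P_{(X_i,X_j)}$ be the law of $(X_i,X_j)$, let $P_{X_k|\mathcal{F}_0}$ be the conditional distribution of $X_k$ given $\mathcal{F}_0$, and let $P_{(X_i,X_j)|\mathcal{F}_0}$ be the conditional distribution of $(X_i,X_j)$ given $\mathcal{F}_0$. For a measure $P$ and a function $g$, write $P(g)=\int g\,dP$, and let $(f_x\otimes f_y)(u,v)=f_x(u)f_y(v)$. Define the random variables $$b(k)=\sup_{x\in\mathbb{R}}\left|P_{X_k|\mathcal{F}_0}(f_x)\right|,\qquad b(i,j)=\sup_{(x,y)\in\mathbb{R}^2}\left|P_{(X_i,X_j)|\mathcal{F}_0}(f_x\otimes f_y)-P_{(X_i,X_j)}(f_x\otimes f_y)\right|,$$ and the coefficients $$\beta_{1,\mathbf{X}}(k)=\mathbb{E}(b(k)),\qquad \beta_{2,\mathbf{X}}(k)=\max\left\{\beta_{1,\mathbf{X}}(k),\ \sup_{i>j\ge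 k}\mathbb{E}(b(i,j))\right\}.$$ *)

(* Defs.v *)
From HB Require Import structures.
From mathcomp Require Import all_boot all_order all_algebra.
From mathcomp Require Import all_classical all_reals all_analysis.

Set Implicit Arguments.
Unset Strict Implicit.
Unset Printing Implicit Defensive.

Import Order.TTheory GRing.Theory Num.Theory.
Import numFieldNormedType.Exports.

Local Open Scope classical_set_scope.
Local Open Scope ring_scope.

Section pair_random_variable.
Context d (T : measurableType d) (R : realType).
Variables X Y : {mfun T >-> R}.

Definition pairRV (w : T) : R * R := (X w, Y w).

Lemma measurable_pairRV : measurable_fun setT pairRV.
Proof. exact: measurable_fun_pair. Qed.

HB.instance Definition _ :=
  @isMeasurableFun.Build _ _ T (R * R)%type pairRV measurable_pairRV.

End pair_random_variable.

Section processes.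
Context d (T : measurableType d) (R : realType) (P : probability T R).
Variable X : int -> {RV P >-> R}.

Definition strictly_stationary : Prop :=
  forall (n : nat) (t : n.-tuple int) (h : int) (A : set (n.-tuple R)),
    measurable A ->
    P [set w | A [tuple X (tnth t i + h) w | i < n]] =
    P [set w | A [tuple X (tnth t i) w | i < n]].

(* A generating family of F_0; the sigma-algebra itself is <<s past_events >>,
   carried by the measurable type g_sigma_algebraType past_events. *)
Definition past_events : set (set T) :=
  \bigcup_(k in [set k : int | k <= 0])
    preimage_set_system setT (X k) measurable.

End processes.

(* k is a regular conditional distribution of Z given <<s G >>: the
   <<s G >>-measurability of w |-> k w B is part of the type of k. *)
Definition is_cond_distribution d d' (T : measurableType d)
    (T' : measurableType d') (R : realType) (P : probability T R)
    (G : set (set T)) (Z : {RV P >-> T'})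
    (k : R.-pker (g_sigma_algebraType G) ~> T') : Prop :=
  forall (A : set T) (B : set T'), <<s G >> A -> measurable B ->
    (\int[P]_(w in A) k w B = P (A `&` Z @^-1` B))%E.

Section dependence_coefficients.
Context d (T : measurableType d) (R : realType) (P : probability T R).
Variable X : int -> {RV P >-> R}.
(* Versions of the conditional distributions, given F_0, of X_k and of
   (X_i, X_j). *)
Variable Q1 : int -> R.-pker (g_sigma_algebraType (past_events X)) ~> R.
Variable Q2 :
  int -> int -> R.-pker (g_sigma_algebraType (past_events X)) ~> (R * R)%type.

Definition centered_indic (x z : R) : R :=
  \1_(`]-oo, x]) z - fine (cdf (X 0) x).

Definition centered_indic2 (xy z : R * R) : R :=
  centered_indic xy.1 z.1 * centered_indic xy.2 z.2.

Local Open Scope ereal_scope.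

Definition b1 (k : int) (w : T) : \bar R :=
  ereal_sup [set `| \int[Q1 k w]_z (centered_indic x z)%:E | | x in [set: R]].

Definition b2 (i j : int) (w : T) : \bar R :=
  ereal_sup [set `| \int[Q2 i j w]_z (centered_indic2 xy z)%:E -
      \int[distribution P (pairRV (X i) (X j))]_z (centered_indic2 xy z)%:E |
    | xy in [set: R * R]].

Definition beta1 (k : nat) : \bar R := \int[P]_w b1 k%:Z w.

Definition beta2 (k : nat) : \bar R :=
  maxe (beta1 k)
    (ereal_sup [set \int[P]_w b2 ij.1 ij.2 w
               | ij in [set ij : int * int | (k%:Z <= ij.2 < ij.1)%R]]).

End dependence_coefficients.

Section mann_whitney.
Context d (T : measurableType d) (R : realType) (P : probability T R).
Variables (X : int -> {RV P >-> R}) (f : R -> R).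

(* The two coordinates of (T * T, P \x P) realize the independent copy. *)
Definition MW_pi : R := fine ((P \x P)%E [set w | X 1 w.1 < f (X 1 w.2)]).

Definition H_Y (t : R) : R := fine (P [set w | t < f (X 1 w)]).

Definition G_X (t : R) : R := fine (P [set w | X 1 w < t]).

Definition MW_U (n m : nat) (w : T) : R :=
  (n%:R * m%:R)^-1 *
  \sum_(1 <= i < n.+1) \sum_(n.+1 <= j < (n + m).+1)
    (X i%:Z w < f (X j%:Z w))%R%:R.

Definition autocov (g : R -> R) (k : int) : R :=
  fine (covariance P (g \o X 0) (g \o X k)).

Definition autocov_sums (g : R -> R) : R^nat :=
  fun n => \sum_(1 <= k < n) autocov g k%:Z.

Definition long_run_variance (g : R -> R) : R :=
  fine 'V_P[g \o X 0] + 2 * limn (autocov_sums g).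

Definition MW_variance (c : R) : R :=
  long_run_variance H_Y + c * long_run_variance (G_X \o f).

End mann_whitney.

(* The second parameter of normal_prob is a standard deviation, and
   normal_prob m 0 is not the Dirac mass, hence the case distinction.
   Only meaningful for 0 <= V. *)
Definition normal_law (R : realType) (V : R) :
    probability (measurableTypeR R) R :=
  if V == 0
  then (\d_(0 : measurableTypeR R) : probability (measurableTypeR R) R)
  else (normal_prob 0 (Num.sqrt V) : probability (measurableTypeR R) R).

Definition cvg_in_distribution d (T : measurableType d) (R : realType)
    (P : probability T R) (Z : nat -> T -> R)
    (mu : probability (measurableTypeR R) R) : Prop :=
  (forall n, measurable_fun setT (Z n)) /\
  forall g : R -> R, continuous g -> bounded_fun g ->
    (\int[P]_w (g (Z n w))%:E @[n --> \oo] --> \int[mu]_x (g x)%:E)%E.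

(* Main.v *)
(* Write pi + xi(x) + eta(y) + R(x, y) for the Hoeffding decomposition of the
   kernel 1_{x < f(y)}, with xi = H_Y - pi and eta = G_X o f - pi. Since f is
   monotonic, xi, eta and R in each of its variables are centred averages of the
   generators f_x of the dependence coefficients; hence conditioning on the past
   controls their covariances, and products of two of them, by beta_2.

   The degenerate part is negligible: away from a fixed gap between the two
   samples, the two samples decouple at a cost beta_2(gap), and for independent
   samples E R(X_i, Y_j) R(X_i', Y_j') is at most a multiple of both
   beta_2(|i - i'|) and beta_2(|j - j'|), so that n E(remainder^2) tends to 0.

   For the linear part S_k = a_1 zeta_1 + ... + a_k zeta_k, expanding
   cos(t S_k + alpha) around S_(k-1), and each resulting sine around S_(i-1) for
   i < k, shows that exp(V_k / 2) E cos(t S_k + alpha) is almost constant in k,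
   where V_k accumulates the variances and the covariances. The limits of
   E cos(t Z_n + alpha) are those of the normal law, and Gaussian smoothing turns
   this into convergence in distribution. *)

From HB Require Import structures.
Require Import Defs.
From mathcomp Require Import all_boot all_order all_algebra.
From mathcomp Require Import all_classical all_reals all_analysis.
From mathcomp Require Import finmap measurable_realfun.
From mathcomp Require Import ring lra zify.

Set Implicit Arguments.
Unset Strict Implicit.
Unset Printing Implicit Defensive.

Import Order.TTheory GRing.Theory Num.Theory.
Import numFieldNormedType.Exports.

Local Open Scope classical_set_scope.
Local Open Scope ring_scope.

(** * Integrals of bounded measurable functions *)

(** The coefficients [beta2] see at most two future times, and those only through half-lines; the
    joint law of a long block given the past is out of reach. The expansion is therefore arranged so
    that a function of the past never meets more than two later variables. Two lags govern it.
    Covariances at lags beyond [p] cost a tail of the series of [beta2]; at lags up to [p], the pair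
    is decoupled from a partial sum [q] steps earlier, at cost [beta2 q.+1]. Since [p.+1] such costs
    add up, [p] is fixed before [q], and both before [n] grows. A real cosine with a free phase
    [alpha] does the work of the complex exponential, since its derivatives stay in the family. For
    the degenerate part, using the distance inside one sample only would bound n times the second
    moment by a constant; taking the smaller of the two bounds is what makes it vanish. [b1] and
    [b2] are suprema over uncountable families whose measurability is never established, so their
    integrals serve only as lower integrals, to bound measurable functions from above. *)

Lemma cvg_norm_le (R : realType) (u : nat -> R) (l b : R) :
  u n @[n --> \oo] --> l -> (forall n, `|u n| <= b) -> `|l| <= b.
Proof.
move=> ul ub; have ul' : `|u n| @[n --> \oo] --> `|l| by exact: cvg_norm.
rewrite -(cvg_lim (@Rhausdorff R) ul'); apply: limr_le; last exact: nearW.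
by apply/cvg_ex; eexists; exact: ul'.
Qed.

(** Such functions are integrable for every probability and stable under products, compositions and
    parameter integrals, so the calculus of [Rintegral] below carries no other integrability
    condition. *)
Definition bmeas d (T : measurableType d) (R : realType) (f : T -> R) :=
  measurable_fun setT f /\ exists M : R, forall x, `|f x| <= M.

Section bounded_measurable.
Context d (T : measurableType d) (R : realType).
Implicit Types f g : T -> R.

Lemma bmeas_le f M : measurable_fun setT f -> (forall x, `|f x| <= M) -> bmeas f.
Proof. by move=> mf fM; split => //; exists M. Qed.

Lemma bmeas_cst (r : R) : bmeas (fun _ : T => r).
Proof. by apply: (@bmeas_le _ `|r|) => //; exact: measurable_cst. Qed.

Lemma bmeasD f g : bmeas f -> bmeas g -> bmeas (fun x => f x + g x).
Proof.
move=> [mf [M fM]] [mg [N gN]]; apply: (@bmeas_le _ (M + N)).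
  exact: measurable_funD.
by move=> x; apply: (le_trans (ler_normD _ _)); exact: lerD.
Qed.

Lemma bmeasN f : bmeas f -> bmeas (fun x => - f x).
Proof.
move=> [mf [M fM]]; apply: (@bmeas_le _ M) => [|x]; last by rewrite normrN.
exact: measurableT_comp.
Qed.

Lemma bmeasB f g : bmeas f -> bmeas g -> bmeas (fun x => f x - g x).
Proof. by move=> bf bg; apply: bmeasD => //; exact: bmeasN. Qed.

Lemma bmeasM f g : bmeas f -> bmeas g -> bmeas (fun x => f x * g x).
Proof.
move=> [mf [M fM]] [mg [N gN]]; apply: (@bmeas_le _ (M * N)).
  exact: measurable_funM.
by move=> x; rewrite normrM ler_pM.
Qed.

Lemma bmeas_sum I (s : seq I) (F : I -> T -> R) :
  (forall i, bmeas (F i)) -> bmeas (fun x => \sum_(i <- s) F i x).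
Proof.
move=> bF; elim: s => [|i s IH].
  by under eq_fun do rewrite big_nil; exact: bmeas_cst.
by under eq_fun do rewrite big_cons; exact: bmeasD.
Qed.

Lemma bmeas_comp d' (T' : measurableType d') (h : T' -> R) (p : T -> T') :
  measurable_fun setT p -> bmeas h -> bmeas (fun x => h (p x)).
Proof.
move=> mp [mh [M hM]]; apply: (@bmeas_le _ M) => //.
exact: (measurableT_comp mh mp).
Qed.

Lemma bmeas_indic (A : set T) : measurable A -> bmeas (\1_A : T -> R).
Proof.
move=> mA; apply: (@bmeas_le _ 1); first exact: measurable_indic.
by move=> x; rewrite indicE; case: (_ \in _); rewrite ?normr1 ?normr0.
Qed.

Lemma bmeas_bool (b : T -> bool) :
  measurable_fun setT b -> bmeas (fun x => (b x)%:R : R).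
Proof.
move=> mb; have -> : (fun x => (b x)%:R : R) = \1_[set x | b x].
  by apply/funext => x; rewrite indicE mem_setE.
by apply: bmeas_indic; rewrite -[X in measurable X]setTI; exact: mb.
Qed.

Variable mu : probability T R.

Lemma bmeas_integrable f : bmeas f -> mu.-integrable setT (EFin \o f).
Proof.
move=> [mf [M fM]]; apply: measurable_bounded_integrable => //.
  by have /= -> := probability_setT mu; rewrite ltry.
by exists M; split; [rewrite num_real|move=> x Mx y _; exact: (le_trans _ (ltW Mx))].
Qed.

Lemma EFin_RintegralE f : bmeas f ->
  (\int[mu]_x f x)%:E = (\int[mu]_x (f x)%:E)%E.
Proof.
move=> bf; rewrite /Rintegral fineK//; apply: integrable_fin_num => //.
exact: bmeas_integrable.
Qed.

Lemma ExD f g : bmeas f -> bmeas g ->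
  \int[mu]_x (f x + g x) = \int[mu]_x f x + \int[mu]_x g x.
Proof. by move=> bf bg; rewrite RintegralD//; exact: bmeas_integrable. Qed.

Lemma ExB f g : bmeas f -> bmeas g ->
  \int[mu]_x (f x - g x) = \int[mu]_x f x - \int[mu]_x g x.
Proof. by move=> bf bg; rewrite RintegralB//; exact: bmeas_integrable. Qed.

Lemma ExZl r f : bmeas f -> \int[mu]_x (r * f x) = r * \int[mu]_x f x.
Proof. by move=> bf; rewrite RintegralZl//; exact: bmeas_integrable. Qed.

Lemma ExZr r f : bmeas f -> \int[mu]_x (f x * r) = \int[mu]_x f x * r.
Proof. by move=> bf; rewrite RintegralZr//; exact: bmeas_integrable. Qed.

Lemma ExN f : bmeas f -> \int[mu]_x (- f x) = - \int[mu]_x f x.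
Proof.
move=> bf; rewrite -mulN1r -ExZl//.
by apply: eq_Rintegral => x _; rewrite mulN1r.
Qed.

Lemma Ex_cst r : \int[mu]_x r = r.
Proof.
by rewrite Rintegral_cst//; have /= -> := probability_setT mu; rewrite mulr1.
Qed.

Lemma Ex_sum I (s : seq I) (F : I -> T -> R) : (forall i, bmeas (F i)) ->
  \int[mu]_x (\sum_(i <- s) F i x) = \sum_(i <- s) \int[mu]_x F i x.
Proof.
move=> bF; elim: s => [|i s IH].
  by under eq_Rintegral do rewrite big_nil; rewrite Ex_cst big_nil.
under eq_Rintegral do rewrite big_cons.
by rewrite ExD ?IH ?big_cons//; exact: bmeas_sum.
Qed.

Lemma Ex_le f g : bmeas f -> bmeas g -> (forall x, f x <= g x) ->
  \int[mu]_x f x <= \int[mu]_x g x.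
Proof. by move=> bf bg fg; apply: le_Rintegral => //; exact: bmeas_integrable. Qed.

Lemma bmeas_norm f : bmeas f -> bmeas (fun x => `|f x|).
Proof.
move=> [mf [M fM]]; apply: (@bmeas_le _ M) => [|x]; last by rewrite normr_id.
exact: measurableT_comp.
Qed.

Lemma Ex_norm f : bmeas f -> `|\int[mu]_x f x| <= \int[mu]_x `|f x|.
Proof. by move=> bf; apply: le_normr_Rintegral => //; exact: bmeas_integrable. Qed.

Lemma Ex_norm_le f g : bmeas f -> bmeas g -> (forall x, `|f x| <= g x) ->
  `|\int[mu]_x f x| <= \int[mu]_x g x.
Proof.
move=> bf bg fg; apply: (le_trans (Ex_norm bf)).
by apply: Ex_le => //; exact: bmeas_norm.
Qed.

Lemma Ex_bound f M : measurable_fun setT f -> (forall x, `|f x| <= M) ->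
  `|\int[mu]_x f x| <= M.
Proof.
move=> mf fM; rewrite -[leRHS]Ex_cst; apply: Ex_norm_le => //.
  exact: (bmeas_le mf fM).
exact: bmeas_cst.
Qed.

Lemma Ex_cvg (F : nat -> T -> R) f M : (forall n, measurable_fun setT (F n)) ->
  measurable_fun setT f -> (forall n x, `|F n x| <= M) ->
  (forall x, F n x @[n --> \oo] --> f x) ->
  \int[mu]_x F n x @[n --> \oo] --> \int[mu]_x f x.
Proof.
move=> mF mf FM Ff.
have [|||||_ _] := @dominated_convergence _ T R mu setT measurableT
  (fun n => EFin \o F n) (EFin \o f) (EFin \o cst M).
- by move=> n; exact/measurable_EFinP.
- exact/measurable_EFinP.
- by apply: aeW => x _; apply: cvg_EFin; [exact: nearW|exact: Ff].
- by apply: bmeas_integrable; exact: bmeas_cst.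
- by apply: aeW => x n _; rewrite lee_fin.
move=> h.
have bf : bmeas f.
  apply: (bmeas_le mf (M := M)) => x.
  exact: cvg_norm_le (Ff x) _.
have bF n : bmeas (F n) by exact: (bmeas_le (mF n) (FM n)).
apply: fine_cvg; rewrite EFin_RintegralE//.
Qed.

Lemma Ex_indic (A : set T) : measurable A -> \int[mu]_x \1_A x = fine (mu A).
Proof. by move=> mA; rewrite /Rintegral integral_indic// setIT. Qed.

Lemma Ex_ge0 f : (forall x, 0 <= f x) -> 0 <= \int[mu]_x f x.
Proof. by move=> f0; exact: Rintegral_ge0. Qed.

End bounded_measurable.

Lemma Ex_distribution d d' (T : measurableType d) (T' : measurableType d')
    (R : realType) (P : probability T R) (X : {RV P >-> T'}) (h : T' -> R) :
  bmeas h -> \int[distribution P X]_y h y = \int[P]_x h (X x).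
Proof.
move=> bh; rewrite /Rintegral integral_distribution//.
  by case: bh => mh _; exact/measurable_EFinP.
by apply: bmeas_integrable; exact: (bmeas_comp (p := X)).
Qed.

Lemma bmeas_pair1 d1 d2 (T1 : measurableType d1) (T2 : measurableType d2)
  (R : realType) (f : T1 * T2 -> R) x : bmeas f -> bmeas (fun y => f (x, y)).
Proof. by apply: bmeas_comp; exact: pair1_measurable. Qed.

Lemma bmeas_pair2 d1 d2 (T1 : measurableType d1) (T2 : measurableType d2)
  (R : realType) (f : T1 * T2 -> R) y : bmeas f -> bmeas (fun x => f (x, y)).
Proof. by apply: bmeas_comp; exact: pair2_measurable. Qed.

Lemma bmeas_Ex2 d1 d2 (T1 : measurableType d1) (T2 : measurableType d2)
    (R : realType) (m2 : probability T2 R) (f : T1 * T2 -> R) : bmeas f ->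
  bmeas (fun x => \int[m2]_y f (x, y)).
Proof.
move=> bf; have [mf [M fM]] := bf.
apply: (@bmeas_le _ _ _ _ M) => [|x]; last first.
  by apply: Ex_bound => //; exact: (bmeas_pair1 x bf).1.
(* Adding [M] makes the integrand nonnegative, as Tonelli requires; [M] is subtracted afterwards. *)
have -> : (fun x => \int[m2]_y f (x, y)) =
    (fun x => fine (\int[m2]_y (f (x, y) + M)%:E) - M).
  apply/funext => x; rewrite -/(Rintegral m2 setT (fun y => f (x, y) + M)).
  by rewrite ExD ?Ex_cst ?addrK//; [exact: bmeas_pair1|exact: bmeas_cst].
apply: measurable_funB; last exact: measurable_cst.
apply: measurableT_comp => //.
apply: (@measurable_fun_fubini_tonelli_F _ _ _ _ _ m2
  (fun z => (f z + M)%:E)) => [|z].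
  by apply/measurable_EFinP/measurable_funD => //; exact: measurable_cst.
by rewrite lee_fin -lerBlDr sub0r; have := fM z; rewrite ler_norml => /andP[].
Qed.

Lemma bmeas_Ex1 d1 d2 (T1 : measurableType d1) (T2 : measurableType d2)
    (R : realType) (m1 : probability T1 R) (f : T1 * T2 -> R) : bmeas f ->
  bmeas (fun y => \int[m1]_x f (x, y)).
Proof.
move=> bf; apply: (bmeas_Ex2 m1 (f := fun z => f (z.2, z.1))).
apply: (bmeas_comp (p := fun z => (z.2, z.1))) => //.
exact: measurable_swap.
Qed.

Section fubini_bounded.
Context d1 d2 (T1 : measurableType d1) (T2 : measurableType d2) (R : realType).
Variables (m1 : probability T1 R) (m2 : probability T2 R).

Lemma Ex_fubini (f : T1 * T2 -> R) : bmeas f ->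
  \int[m1]_x \int[m2]_y f (x, y) = \int[m2]_y \int[m1]_x f (x, y).
Proof.
move=> bf; apply: EFin_inj; rewrite !EFin_RintegralE//; last 2 first.
- exact: bmeas_Ex1.
- exact: bmeas_Ex2.
under eq_integral => x _ do rewrite (EFin_RintegralE m2 (bmeas_pair1 x bf)).
under [RHS]eq_integral => y _ do rewrite (EFin_RintegralE m1 (bmeas_pair2 y bf)).
apply: (@Fubini _ _ _ _ _ m1 m2 (EFin \o f)).
exact: bmeas_integrable.
Qed.

Lemma Ex_prod (f : T1 * T2 -> R) : bmeas f ->
  \int[(m1 \x m2)%E]_z f z = \int[m1]_x \int[m2]_y f (x, y).
Proof.
move=> bf; apply: EFin_inj; rewrite !EFin_RintegralE//; last exact: bmeas_Ex2.
under [RHS]eq_integral => x _ do rewrite (EFin_RintegralE m2 (bmeas_pair1 x bf)).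
rewrite -(@integral12_prod_meas1 _ _ _ _ _ m1 m2 (EFin \o f))//.
exact: bmeas_integrable.
Qed.

End fubini_bounded.

(** * Averages of centred indicators of half-lines *)

(* [ray_average X M g]: [g] belongs to the closure of the functions [f_x] under
   signed combinations, averages and pointwise limits, [M] being the total
   weight. *)
Inductive ray_average d (T : measurableType d) (R : realType)
    (P : probability T R) (X : int -> {RV P >-> R}) : R -> (R -> R) -> Prop :=
| ray_average_indic x : ray_average X 1 (centered_indic X x)
| ray_average_lim M (g_ : nat -> R -> R) g :
    (forall n, ray_average X M (g_ n)) ->
    (forall z, g_ n z @[n --> \oo] --> g z) -> ray_average X M g
| ray_averageN M g : ray_average X M g -> ray_average X M (fun z => - g z)
| ray_averageB M N g h : ray_average X M g -> ray_average X N h ->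
    ray_average X (M + N) (fun z => g z - h z)
| ray_average_Ex (nu : probability R R) M (G : R * R -> R) : bmeas G ->
    (forall y, ray_average X M (fun z => G (y, z))) ->
    ray_average X M (fun z => \int[nu]_y G (y, z)).

Section ray_averages.
Context d (T : measurableType d) (R : realType) (P : probability T R).
Variable X : int -> {RV P >-> R}.
Local Notation mu0 := (distribution P (X 0)).

Lemma cdf_Ex x : fine (cdf (X 0) x) = \int[mu0]_z \1_(`]-oo, x]) z.
Proof. by rewrite Ex_indic. Qed.

Lemma centered_indic_le1 x z : `|centered_indic X x z| <= 1.
Proof.
rewrite /centered_indic indicE cdf_Ex.
have : 0 <= \int[mu0]_z (\1_(`]-oo, x]%classic) z : R) by exact: Ex_ge0.
have : \int[mu0]_z (\1_(`]-oo, x]%classic) z : R) <= 1.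
  rewrite -[leRHS](Ex_cst mu0); apply: Ex_le => //.
  - exact: bmeas_indic.
  - exact: bmeas_cst.
move: (Rintegral _ _ _) => I; case: (_ \in _) => ? ?;
  by rewrite ler_norml; apply/andP; split; rewrite /=; lra.
Qed.

Lemma measurable_centered_indic x : measurable_fun setT (centered_indic X x).
Proof.
by apply: measurable_funB; [exact: measurable_indic|exact: measurable_cst].
Qed.

Lemma ray_average_measurable M g : ray_average X M g -> measurable_fun setT g.
Proof.
elim=> [x|{}M g_ {}g _ mg cvg|{}M {}g _ mg|{}M N {}g h _ mg _ mh|nu {}M G bG _ _].
- exact: measurable_centered_indic.
- by apply: (measurable_fun_cvg (h := g_)) => // z _; exact: cvg.
- exact: measurableT_comp.
- exact: measurable_funB.
- by have [] := bmeas_Ex1 nu bG.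
Qed.

Lemma ray_average_le M g : ray_average X M g -> forall z, `|g z| <= M.
Proof.
elim=> [x z|{}M g_ {}g _ gM cvg z|{}M {}g _ gM z|{}M N {}g h _ gM _ hN z|
  nu {}M G bG _ GM z].
- exact: centered_indic_le1.
- by apply: (cvg_norm_le (cvg z)) => n; exact: gM.
- by rewrite normrN.
- by apply: (le_trans (ler_normB _ _)); exact: lerD.
- by apply: Ex_bound => [|y]; [apply: (bmeas_pair2 z bG).1|exact: GM].
Qed.

Lemma ray_average_bmeas M g : ray_average X M g -> bmeas g.
Proof.
move=> gM; apply: (bmeas_le (M := M)); first exact: ray_average_measurable gM.
exact: ray_average_le.
Qed.

(** The difference of the two integrals is linear in [g], continuous under bounded pointwise limits,
    and commutes with averages by Fubini, so a bound on the generators passes to the closure with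
    the total weight as factor. The weights [c1], [c2] hold whatever multiplies [g], and the two
    measures will be a conditional law and the unconditional one. *)
Lemma ray_average_functional d1 d2 (T1 : measurableType d1)
    (T2 : measurableType d2) (nu1 : probability T1 R) (nu2 : probability T2 R)
    (p1 : T1 -> R) (p2 : T2 -> R) (c1 : T1 -> R) (c2 : T2 -> R) (b M : R) g :
  measurable_fun setT p1 -> measurable_fun setT p2 -> bmeas c1 -> bmeas c2 ->
  (forall x, `|\int[nu1]_w (centered_indic X x (p1 w) * c1 w) -
               \int[nu2]_w (centered_indic X x (p2 w) * c2 w)| <= b) ->
  ray_average X M g ->
  `|\int[nu1]_w (g (p1 w) * c1 w) - \int[nu2]_w (g (p2 w) * c2 w)| <= M * b.
Proof.
move=> mp1 mp2 bc1 bc2 hb.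
have bp (h : R -> R) : bmeas h ->
    bmeas (fun w => h (p1 w) * c1 w) /\ bmeas (fun w => h (p2 w) * c2 w).
  by move=> bh; split; apply: bmeasM => //; exact: bmeas_comp.
elim=> [x|{}M g_ {}g gM IH cvg|{}M {}g gM IH|{}M N {}g h gM IHg hN IHh|
  nu {}M G bG GM IH].
- by rewrite mul1r.
- have gM' : ray_average X M g by exact: ray_average_lim gM cvg.
  have [[m1 [C1 h1]] [m2 [C2 h2]]] := (bc1, bc2).
  have c1' : \int[nu1]_w (g_ n (p1 w) * c1 w) @[n --> \oo] -->
      \int[nu1]_w (g (p1 w) * c1 w).
    apply: (Ex_cvg (M := M * C1)) => [n|||].
    + exact: (bp _ (ray_average_bmeas (gM n))).1.1.
    + exact: (bp _ (ray_average_bmeas gM')).1.1.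
    + by move=> n w; rewrite normrM ler_pM//; exact: ray_average_le (gM n) _.
    + by move=> w; apply: cvgM; [exact: cvg|exact: cvg_cst].
  have c2' : \int[nu2]_w (g_ n (p2 w) * c2 w) @[n --> \oo] -->
      \int[nu2]_w (g (p2 w) * c2 w).
    apply: (Ex_cvg (M := M * C2)) => [n|||].
    + exact: (bp _ (ray_average_bmeas (gM n))).2.1.
    + exact: (bp _ (ray_average_bmeas gM')).2.1.
    + by move=> n w; rewrite normrM ler_pM//; exact: ray_average_le (gM n) _.
    + by move=> w; apply: cvgM; [exact: cvg|exact: cvg_cst].
  exact: cvg_norm_le (cvgB c1' c2') IH.
- have [b1 b2] := bp _ (ray_average_bmeas gM).
  under eq_Rintegral do rewrite mulNr.
  under [X in _ - X]eq_Rintegral do rewrite mulNr.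
  by rewrite !ExN// -opprD normrN.
- have [b1 b2] := bp _ (ray_average_bmeas gM).
  have [b3 b4] := bp _ (ray_average_bmeas hN).
  under eq_Rintegral do rewrite mulrBl.
  under [X in _ - X]eq_Rintegral do rewrite mulrBl.
  rewrite !ExB// mulrDl.
  set a1 := Rintegral _ _ _; set a2 := Rintegral _ _ _.
  set a3 := Rintegral _ _ _; set a4 := Rintegral _ _ _.
  rewrite (_ : _ - _ = (a1 - a3) - (a2 - a4)); last by ring.
  by apply: (le_trans (ler_normB _ _)); exact: lerD.
(* Fubini presents the functional of the average as the average over [y] of functionals that the
   induction hypothesis bounds uniformly. *)
- have swap d3 (T3 : measurableType d3) (nu3 : probability T3 R) p c :
      measurable_fun setT p -> bmeas c ->
      \int[nu3]_w ((\int[nu]_y G (y, p w)) * c w) =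
      \int[nu]_y \int[nu3]_w (G (y, p w) * c w) /\
      bmeas (fun y => \int[nu3]_w (G (y, p w) * c w)).
    move=> mp bc.
    pose K (z : R * T3) := G (z.1, p z.2) * c z.2.
    have bK : bmeas K.
      apply: bmeasM; last exact: (bmeas_comp (p := snd)).
      apply: (bmeas_comp (p := fun z : R * T3 => (z.1, p z.2))) => //.
      by apply: measurable_fun_pair => //; exact: measurableT_comp.
    split; last exact: (bmeas_Ex2 nu3 bK).
    rewrite (Ex_fubini nu nu3 bK); apply: eq_Rintegral => w _.
    by rewrite -ExZr//; exact: bmeas_pair2.
  have [-> b1] := swap _ _ nu1 p1 c1 mp1 bc1.
  have [-> b2] := swap _ _ nu2 p2 c2 mp2 bc2.
  rewrite -ExB//; apply: Ex_bound => //.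
  by apply: (bmeasB b1 b2).1.
Qed.

(** The bound for two measures, with the second weight equal to 0. *)
Lemma ray_average_functional1 d1 (T1 : measurableType d1)
    (nu1 : probability T1 R) (p1 : T1 -> R) (c1 : T1 -> R) (b M : R) g :
  measurable_fun setT p1 -> bmeas c1 ->
  (forall x, `|\int[nu1]_w (centered_indic X x (p1 w) * c1 w)| <= b) ->
  ray_average X M g -> `|\int[nu1]_w (g (p1 w) * c1 w)| <= M * b.
Proof.
move=> mp bc hb gM.
have h0 (h : R -> R) : \int[nu1]_w (h (p1 w) * (cst 0 w : R)) = 0.
  by under eq_Rintegral do rewrite mulr0; rewrite Ex_cst.
rewrite -[X in `|X|]subr0 -{1}(h0 g).
apply: ray_average_functional gM => //; first exact: bmeas_cst.
by move=> x; rewrite h0 subr0.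
Qed.

Lemma Ex_centered_indic x : \int[mu0]_z centered_indic X x z = 0.
Proof.
rewrite ExB; last 2 first.
- exact: bmeas_indic.
- exact: bmeas_cst.
by rewrite Ex_cst cdf_Ex subrr.
Qed.

(** The generators are centred, so the functional bound holds with [b = 0]. *)
Lemma Ex_ray_average M g : ray_average X M g -> \int[mu0]_z g z = 0.
Proof.
move=> gM; apply/eqP; rewrite -normr_le0 -(mulr0 M).
under eq_Rintegral do rewrite -[g _]mulr1.
apply: (ray_average_functional1 (p1 := id)) gM => //; first exact: bmeas_cst.
by move=> x; under eq_Rintegral do rewrite mulr1;
  rewrite Ex_centered_indic normr0.
Qed.

Lemma measurable_lower (r : R -> bool) : (forall x y, x <= y -> r y -> r x) ->
  measurable_fun setT r.
Proof.
move=> rle; apply: (measurable_fun_bool true); rewrite setTI.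
apply: is_interval_measurable => x y /= _ ry z /andP[_ zy].
exact: rle zy ry.
Qed.

(** A lower set is the line, the empty set, a closed half-line or an open one; in each case its
    indicator is pointwise the eventual value of indicators of closed half-lines, and dominated
    convergence carries the centring along. This admits strict inequalities, and any monotone [f],
    without continuity of the law. *)
Lemma ray_average_lower (r : R -> bool) : (forall x y, x <= y -> r y -> r x) ->
  ray_average X 1 (fun z => (r z)%:R - \int[mu0]_y (r y)%:R).
Proof.
move=> rle.
have [x_ x_r] : exists x_ : nat -> R, forall z,
    \forall n \near \oo, (z <= x_ n) = r z.
  have [rT|/existsNP[a /negP ra]] := pselect (forall z, r z).
    exists (fun n => n%:R) => z; near=> n; rewrite rT; near: n.
    exact: nbhs_infty_ger.
  have [rF|/existsNP[b /contrapT rb]] := pselect (forall z, ~ r z).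
    exists (fun n => - n%:R) => z; near=> n.
    rewrite (negbTE (introN idP (rF z))); apply/negbTE; rewrite -ltNge ltrNl.
    by near: n; exact: nbhs_infty_gtr.
  pose S := [set z | r z].
  have supS : has_sup S.
    split; first by exists b.
    exists a => z rz; rewrite leNgt; apply/negP => /ltW/rle/(_ rz) ra'.
    by rewrite ra' in ra.
  have ltS z : z < sup S -> r z.
    by move=> /(sup_gt supS.1)[t rt zt]; exact: rle (ltW zt) rt.
  have [rS|rS] := boolP (r (sup S)).
    exists (cst (sup S)) => z; apply: nearW => n /=; apply/idP/idP.
      by move=> /rle; apply.
    by move=> rz; exact: (sup_ubound supS.2).
  (* The supremum is not attained: the half-line is open, and closed ones increase to it. *)
  exists (fun n => sup S - n.+1%:R^-1) => z.
  have [zS|Sz] := ltP z (sup S).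
    have e0 : 0 < sup S - z by rewrite subr_gt0.
    near=> n; rewrite ltS// lerBrDr -lerBrDl; apply/ltW; near: n.
    exact: (near_infty_natSinv_lt (PosNum e0)).
  apply: nearW => n; have -> : r z = false by apply/negbTE/(contra _ rS)/rle.
  by apply/negbTE; rewrite -ltNge (lt_le_trans _ Sz)// ltrBlDr ltrDl invr_gt0.
have mr := measurable_lower rle.
pose g_ n z : R := (z <= x_ n)%R%:R.
have cvg_r z : g_ n z @[n --> \oo] --> ((r z)%:R : R).
  by apply: cvg_near_cst; near=> n; rewrite /g_ (_ : _ <= _ = r z)//; near: n.
have gE n z : centered_indic X (x_ n) z = g_ n z - \int[mu0]_y g_ n y.
  rewrite /centered_indic cdf_Ex; congr (_ - _).
    by rewrite indicE mem_setE in_itv.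
  by apply: eq_Rintegral => y _; rewrite indicE mem_setE in_itv.
apply: (@ray_average_lim _ _ _ _ _ _ (fun n => centered_indic X (x_ n))) => [n|z].
  exact: ray_average_indic.
under eq_fun do rewrite gE.
apply: cvgB => //; apply: (Ex_cvg (M := 1)) => //.
- move=> n; have mn : measurable_fun setT (fun y : R => y <= x_ n).
    by apply: measurable_fun_ler => //; exact: measurable_cst.
  by have [] := @bmeas_bool _ _ R _ mn.
- by have [] := @bmeas_bool _ _ R _ mr.
- by move=> n y; rewrite /g_ normr_nat lern1 leq_b1.
Unshelve. all: end_near.
Qed.

(** Complementation turns an upper set into a lower one, and after centring it only changes the
    sign. *)
Lemma ray_average_upper (r : R -> bool) : (forall x y, x <= y -> r x -> r y) ->
  ray_average X 1 (fun z => (r z)%:R - \int[mu0]_y (r y)%:R).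
Proof.
move=> rle; have rle' x y : x <= y -> ~~ r y -> ~~ r x.
  by move=> /rle xy; apply: contra.
have := ray_averageN (ray_average_lower rle').
have E y : (~~ r y)%:R = 1 - (r y)%:R :> R by case: (r y); rewrite /= ?subr0 ?subrr.
congr (ray_average X 1 _); apply/funext => z.
under eq_Rintegral do rewrite E.
have mr : measurable_fun setT r.
  have -> : r = negb \o (negb \o r) by apply/funext => y /=; rewrite negbK.
  by apply: measurable_neg; exact: measurable_lower.
rewrite ExB; last 2 first.
- exact: bmeas_cst.
- exact: bmeas_bool.
by rewrite Ex_cst E; ring.
Qed.

Variable f : R -> R.
Hypothesis f_mono : {homo f : x y / x <= y} \/ {homo f : x y /~ x <= y}.

Lemma measurable_monotonic : measurable_fun setT f.
Proof.
case: f_mono => fm; first exact: nondecreasing_measurable.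
by apply: nonincreasing_measurable => // x y; exact: fm.
Qed.

Lemma ray_average_lt_f x :
  ray_average X 1 (fun z => (x < f z)%R%:R - \int[mu0]_y (x < f y)%R%:R).
Proof.
case: f_mono => fm.
- by apply: ray_average_upper => y z /fm yz xy; exact: lt_le_trans yz.
- by apply: ray_average_lower => y z /fm yz xy; exact: lt_le_trans yz.
Qed.

Lemma ray_average_lt t :
  ray_average X 1 (fun z => (z < t)%R%:R - \int[mu0]_y (y < t)%R%:R).
Proof. by apply: ray_average_lower => y z; exact: le_lt_trans. Qed.

End ray_averages.

(** * Functional monotone class arguments *)

Import HBNNSimple.

Section functional_monotone_class.
Context d (T : measurableType d) (R : realType) (S : (T -> R) -> Prop).
Hypothesis SD : forall g h, bmeas g -> bmeas h -> S g -> S h ->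
  S (fun x => g x + h x).
Hypothesis SZ : forall r g, bmeas g -> S g -> S (fun x => r * g x).
Hypothesis Slim : forall (g_ : nat -> T -> R) g (M : R),
  (forall n, bmeas (g_ n)) -> (forall n x, `|g_ n x| <= M) -> bmeas g ->
  (forall x, g_ n x @[n --> \oo] --> g x) -> (forall n, S (g_ n)) -> S g.

(** A bounded function becomes nonnegative after adding a constant, and is then a uniformly bounded
    increasing limit of simple functions. *)
Lemma bmeas_induction : (forall A, measurable A -> S \1_A) ->
  forall g, bmeas g -> S g.
Proof.
move=> S1.
have S1r r : S (fun=> r).
  have := SZ r (bmeas_indic _ measurableT) (S1 _ measurableT).
  by congr S; apply/funext => x; rewrite indicT mulr1.
have Ssum I (s : seq I) (F : I -> T -> R) : (forall i, bmeas (F i)) ->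
    (forall i, S (F i)) -> S (fun x => \sum_(i <- s) F i x).
  move=> bF SF; elim: s => [|i s IH].
    by under eq_fun do rewrite big_nil; exact: S1r.
  by under eq_fun do rewrite big_cons; apply: SD => //; exact: bmeas_sum.
suff ge0 g : bmeas g -> (forall x, 0 <= g x) -> S g.
  move=> g bg; have [mg [M gM]] := bg.
  have bgM : bmeas (fun x => g x + M) by apply: bmeasD => //; exact: bmeas_cst.
  have -> : g = (fun x => g x + M + - M) by apply/funext => x; rewrite addrK.
  apply: SD => //; first exact: bmeas_cst.
  apply: ge0 => // x; rewrite -lerBlDr sub0r.
  by have := gM x; rewrite ler_norml => /andP[].
move=> bg g0; have [mg [M gM]] := bg.
have mg' : measurable_fun setT (EFin \o g) by exact/measurable_EFinP.
pose g_ := nnsfun_approx measurableT mg'.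
have cvg_g (x : T) : (g_ n x)%:E @[n --> \oo] --> (EFin \o g) x.
  by apply: cvg_nnsfun_approx => // y _; rewrite lee_fin.
have cvg_g' x : g_ n x @[n --> \oo] --> g x by exact: (fine_cvg (cvg_g x)).
have nd : nondecreasing_seq (g_ : (T -> R)^nat) by exact: nd_nnsfun_approx.
have leg n x : `|g_ n x| <= M.
  rewrite ger0_norm//; apply: (le_trans _ (ler_normlW (gM x))).
  rewrite -(cvg_lim (@Rhausdorff R) (cvg_g' x)).
  apply: nondecreasing_cvgn_le; last by apply/cvg_ex; exists (g x).
  by move=> a b ab; exact/lefP/nd.
apply: (Slim (g_ := g_) (M := M)) => // n.
  by apply: (bmeas_le (M := M)) => //; exact: leg.
have -> : (g_ n : T -> R) = fun x =>
    \sum_(y <- fset_set (range (g_ n))) y * \1_(g_ n @^-1` [set y]) x.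
  by apply/funext => x; rewrite [LHS]fimfunE fsbig_finite.
have m1 y : measurable (g_ n @^-1` [set y]) by [].
apply: Ssum => y; last by apply: SZ; [exact: bmeas_indic|exact: S1].
by apply: bmeasM; [exact: bmeas_cst|exact: bmeas_indic].
Qed.

End functional_monotone_class.

Section product_monotone_class.
Context d1 d2 (T1 : measurableType d1) (T2 : measurableType d2) (R : realType).
Variable S : (T1 * T2 -> R) -> Prop.
Hypothesis SD : forall g h, bmeas g -> bmeas h -> S g -> S h ->
  S (fun x => g x + h x).
Hypothesis SZ : forall r g, bmeas g -> S g -> S (fun x => r * g x).
Hypothesis Slim : forall (g_ : nat -> T1 * T2 -> R) g (M : R),
  (forall n, bmeas (g_ n)) -> (forall n x, `|g_ n x| <= M) -> bmeas g ->
  (forall x, g_ n x @[n --> \oo] --> g x) -> (forall n, S (g_ n)) -> S g.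

(** Dynkin's argument: rectangles are stable under intersection, and the sets with indicator in [S]
    form a lambda-system, by [SD] and [SZ] for differences and [Slim] for increasing unions. *)
Lemma bmeas_product_induction :
  (forall A B, measurable A -> measurable B ->
     S (fun z => \1_A z.1 * \1_B z.2)) ->
  forall g, bmeas g -> S g.
Proof.
move=> SX; apply: (bmeas_induction SD SZ Slim) => A.
rewrite measurable_prod_measurableType => mA.
suff : (measurable A /\ S \1_A) by case.
move: A mA; set C := [set A1 `*` A2 | A1 in measurable & A2 in measurable].
have CI : setI_closed C.
  move=> Y Z [Y1 mY1 [Y2 mY2 <-{Y}]] [Z1 mZ1 [Z2 mZ2 <-{Z}]].
  exists (Y1 `&` Z1); first exact: measurableI.
  by exists (Y2 `&` Z2); [exact: measurableI|rewrite setXI].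
have XE (A : set T1) (B : set T2) :
    (\1_(A `*` B) : _ -> R) = (fun z => \1_A z.1 * \1_B z.2).
  by apply/funext => z; rewrite !indicE in_setX; case: (_ \in A); case: (_ \in B);
    rewrite ?mulr1 ?mulr0 ?mul0r.
have CS : C `<=` [set A | measurable A /\ S \1_A].
  move=> _ [A1 mA1 [A2 mA2 <-]]; split; first exact: measurableX.
  by rewrite XE; exact: SX.
apply: (@lambda_system_subset _ _ CI setT); [|exact: CS|by []].
split => //.
- by split => //; have /CS[] : C setT by exists setT => //; exists setT => //; rewrite setXTT.
- move=> A B BA [mA SA] [mB SB]; split; first exact: measurableD.
  have -> : (\1_(A `\` B) : _ -> R) = (fun z => \1_A z + (- 1) * \1_B z).
    apply/funext => z; rewrite !indicE in_setD mulN1r.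
    have [zB|zB] := boolP (z \in B); rewrite ?andbT ?andbF/= ?subr0//.
    by rewrite (mem_set (BA _ (set_mem zB))) subrr.
  apply: SD => //.
  + exact: bmeas_indic.
  + by apply: bmeasM; [exact: bmeas_cst|exact: bmeas_indic].
  + by apply: SZ => //; exact: bmeas_indic.
- move=> F ndF FS.
  have mU : measurable (\bigcup_i F i).
    by apply: bigcup_measurable => i _; case: (FS i).
  split => //; apply: (Slim (g_ := fun n => \1_(F n)) (M := 1)) => //.
  + by move=> n; apply: bmeas_indic; case: (FS n).
  + by move=> n x; rewrite indicE normr_nat lern1 leq_b1.
  + exact: bmeas_indic.
  + move=> x; apply: cvg_near_cst.
    have [[i _ Fix]|nF] := pselect ((\bigcup_i F i) x).
      near=> n; rewrite !indicE !mem_set//; first by exists i.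
      have /subsetPset/(_ x) : (F i <= F n)%O.
        by apply: ndF; near: n; exact: nbhs_infty_ge.
      exact.
    near=> n; rewrite !indicE !memNset// => Fnx; apply: nF.
    by exists n.
  + by move=> n; case: (FS n).
Unshelve. all: end_near.
Qed.

End product_monotone_class.

(** * Conditional distributions and conditioning on the past *)

Section kernel_probability.
Context d d' (U : measurableType d) (V : measurableType d') (R : realType).
Variables (k : R.-pker U ~> V) (u : U).

(** A name for the measure [k u], to which the structure of probability can be attached. *)
Definition pker_at : set V -> \bar R := k u.

HB.instance Definition _ := Measure.on pker_at.
HB.instance Definition _ :=
  Measure_isProbability.Build _ _ _ pker_at (prob_kernel u).

End kernel_probability.

Section freezing.
Context d d' (T : measurableType d) (T' : measurableType d') (R : realType).
Variables (P : probability T R) (G : set (set T)) (Z : {RV P >-> T'}).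
Variable k : R.-pker (g_sigma_algebraType G) ~> T'.
Hypothesis Gm : forall A : set T, <<s G >> A -> measurable A.
Hypothesis kZ : is_cond_distribution Z k.
Local Notation TG := (g_sigma_algebraType G).

(** [TG] has the points of [T] with a smaller sigma-algebra. A measurable function on [TG] is one on
    [T], where [P] can integrate it. *)
Lemma measurable_coarse d3 (T3 : measurableType d3) (h : TG -> T3) :
  measurable_fun setT h -> measurable_fun setT (h : T -> T3).
Proof. by move=> mh _ B mB; rewrite setTI; apply: Gm; rewrite -[_ @^-1` _]setTI; exact: mh. Qed.

Lemma bmeas_coarse (h : TG -> R) : bmeas h -> bmeas (h : T -> R).
Proof. by move=> [mh [M hM]]; apply: (bmeas_le (M := M)) => //; exact: measurable_coarse. Qed.

Lemma bmeas_coarse_pair (phi : TG * T' -> R) : bmeas phi ->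
  bmeas (fun w : T => phi (w, Z w)).
Proof.
move=> bphi.
have mp : measurable_fun setT (fun w : T => ((w : TG), Z w)).
  apply: measurable_fun_pair => //.
  by apply: (@measurable_coarse _ TG id); exact: measurable_id.
exact: (bmeas_comp mp bphi).
Qed.

(** The past argument of [phi] may be frozen while the other is integrated against the conditional
    law. On rectangles this is the defining identity of the conditional distribution; measurability
    of the inner integral is proved along with it because each step of the induction integrates that
    function. *)
Lemma freezing (phi : TG * T' -> R) : bmeas phi ->
  bmeas (fun w : TG => \int[pker_at k w]_z phi (w, z)) /\
  \int[P]_w phi (w, Z w) = \int[P]_w \int[pker_at k w]_z phi (w, z).
Proof.
move: phi; apply: bmeas_product_induction => //.
- move=> g h bg bh [mg gE] [mh hE].
  have E : (fun w : TG => \int[pker_at k w]_z (g (w, z) + h (w, z))) =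
      fun w => \int[pker_at k w]_z g (w, z) + \int[pker_at k w]_z h (w, z).
    by apply/funext => w; rewrite ExD//; exact: bmeas_pair1.
  split; first by rewrite E; exact: bmeasD.
  rewrite [X in _ = Rintegral P setT X]E !ExD ?gE ?hE//; first exact: bmeas_coarse.
  - exact: bmeas_coarse.
  - exact: bmeas_coarse_pair.
  - exact: bmeas_coarse_pair.
- move=> r g bg [mg gE].
  have E : (fun w : TG => \int[pker_at k w]_z (r * g (w, z))) =
      fun w => r * \int[pker_at k w]_z g (w, z).
    by apply/funext => w; rewrite ExZl//; exact: bmeas_pair1.
  split; first by rewrite E; apply: bmeasM => //; exact: bmeas_cst.
  rewrite [X in _ = Rintegral P setT X]E !ExZl ?gE//; first exact: bmeas_coarse.
  exact: bmeas_coarse_pair.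
- move=> g_ g M bg_ g_M bg g_g Sg.
  have cvgk w : \int[pker_at k w]_z g_ n (w, z) @[n --> \oo] -->
      \int[pker_at k w]_z g (w, z).
    apply: (Ex_cvg (M := M)) => //.
    + by move=> n; apply: (bmeas_pair1 w (bg_ n)).1.
    + exact: (bmeas_pair1 w bg).1.
  have mk : bmeas (fun w : TG => \int[pker_at k w]_z g (w, z)).
    apply: (bmeas_le (M := M)) => [|w].
      apply: (measurable_fun_cvg
        (h := fun n (w : TG) => \int[pker_at k w]_z g_ n (w, z))) => //.
      by move=> n; case: (Sg n) => -[].
    apply: (cvg_norm_le (cvgk w)) => n; apply: Ex_bound => //.
    exact: (bmeas_pair1 w (bg_ n)).1.
  split => //.
  have c1 : \int[P]_w g_ n (w, Z w) @[n --> \oo] --> \int[P]_w g (w, Z w).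
    apply: (Ex_cvg (M := M)) => //.
    + by move=> n; apply: (bmeas_coarse_pair (bg_ n)).1.
    + exact: (bmeas_coarse_pair bg).1.
  have c2 : \int[P]_w (\int[pker_at k w]_z g_ n (w, z)) @[n --> \oo] -->
      \int[P]_w \int[pker_at k w]_z g (w, z).
    apply: (Ex_cvg (M := M)) => //.
    + by move=> n; apply: (bmeas_coarse (Sg n).1).1.
    + exact: (bmeas_coarse mk).1.
    + move=> n w; apply: Ex_bound => //; exact: (bmeas_pair1 (w : TG) (bg_ n)).1.
  rewrite -(cvg_lim (@Rhausdorff R) c1) -(cvg_lim (@Rhausdorff R) c2).
  by congr (lim (_ @ \oo)); apply/funext => n; case: (Sg n).
- move=> A B mA mB.
  have E : (fun w : TG => \int[pker_at k w]_z (\1_A w * \1_B z)) =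
      (fun w => \1_A w * fine (k w B)).
    by apply/funext => w; rewrite ExZl ?Ex_indic//; exact: bmeas_indic.
  have bk : bmeas (fun w : TG => fine (k w B)).
    apply: (bmeas_le (M := 1)) => [|w].
      by apply: measurableT_comp => //; exact: measurable_kernel.
    rewrite -(Ex_indic (pker_at k w) mB); apply: Ex_bound => [|z].
      exact: measurable_indic.
    by rewrite indicE normr_nat lern1 leq_b1.
  have bA : bmeas (\1_A : TG -> R) by exact: bmeas_indic.
  split; first by rewrite E; exact: bmeasM.
  rewrite [X in _ = Rintegral P setT X]E.
  have mA' : measurable (A : set T) by exact: Gm.
  have mZB : measurable (Z @^-1` B) by rewrite -[_ @^-1` _]setTI; exact: measurable_funPT.
  rewrite (_ : (fun w => _) = \1_(A `&` Z @^-1` B)); last first.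
    by apply/funext => w; rewrite !indicE in_setI -natrM mulnb.
  rewrite Ex_indic; last exact: measurableI.
  rewrite -(kZ mA mB) /Rintegral; congr fine.
  rewrite [LHS]integral_mkcond; apply: eq_integral => w _.
  transitivity (((\1_A : T -> R) w * fine (k w B))%:E); last by [].
  rewrite patchE indicE; case: ifPn => wA; last by rewrite mul0r.
  by rewrite mul1r fineK//; exact: (fin_num_measure (pker_at k w) _ mB).
Qed.

End freezing.

(** * Covariance inequalities for mixing sequences *)

Section lower_integral.
Context d (T : measurableType d) (R : realType) (P : probability T R).

(* [g] need not be measurable: its integral is then a lower integral. *)
Lemma ge0_le_lower_integral (f g : T -> \bar R) : (forall x, 0 <= f x)%E ->
  (forall x, f x <= g x)%E -> (\int[P]_x f x <= \int[P]_x g x)%E.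
Proof.
move=> f0 fg; rewrite !ge0_integralTE//; last by move=> x; exact: le_trans (fg x).
apply: ereal_sup_le => _ [h /= hf <-]; exists h => //= x.
exact: le_trans (fg x).
Qed.

(** [b] need not be measurable: [f / C] is a measurable function below it, so monotonicity of the
    lower integral is enough. *)
Lemma Ex_le_lower (f : T -> R) (C B : R) (b : T -> \bar R) : bmeas f ->
  (forall w, 0 <= f w) -> 0 < C -> (forall w, b w \is a fin_num) ->
  (forall w, f w <= C * fine (b w)) ->
  (\int[P]_w b w <= B%:E)%E -> \int[P]_w f w <= C * B.
Proof.
move=> bf f0 C0 b_fin fb bB; rewrite -ler_pdivrMl//.
rewrite -ExZl// -lee_fin EFin_RintegralE; last first.
  by apply: bmeasM => //; exact: bmeas_cst.
apply: le_trans bB; apply: ge0_le_lower_integral => w.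
  by rewrite lee_fin mulr_ge0// invr_ge0 ltW.
by rewrite -[b w]fineK// lee_fin ler_pdivrMl.
Qed.

End lower_integral.

Section mixing.
Context d (T : measurableType d) (R : realType) (P : probability T R).
Variable X : int -> {RV P >-> R}.
Local Notation TG := (g_sigma_algebraType (past_events X)).
Variable Q1 : int -> R.-pker TG ~> R.
Variable Q2 : int -> int -> R.-pker TG ~> (R * R)%type.
Hypothesis Q1X : forall k : int, is_cond_distribution (P := P) (X k) (Q1 k).
Hypothesis Q2X : forall i j : int,
  is_cond_distribution (P := P) (pairRV (X i) (X j)) (Q2 i j).
Hypothesis X_law : forall (k : int) (h : R -> R), bmeas h ->
  \int[P]_w h (X k w) = \int[P]_w h (X 0 w).
Local Notation ci := (centered_indic X).
Local Notation mu0 := (distribution P (X 0)).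

Lemma past_measurable (A : set T) : <<s past_events X >> A -> measurable A.
Proof.
apply: smallest_sub; first exact: sigma_algebra_measurable.
by move=> _ [k _ [B mB <-]]; exact: measurable_funPT.
Qed.

Lemma measurable_past (k : int) : k <= 0 ->
  measurable_fun setT (X k : TG -> R).
Proof.
move=> k0 _ B mB; apply: sub_sigma_algebra.
by exists k => //; exists B.
Qed.

Lemma bmeas_centered_indic x : bmeas (ci x).
Proof. exact: (ray_average_bmeas (ray_average_indic X x)). Qed.

Lemma b1_fin_num k w : b1 Q1 k w \is a fin_num.
Proof.
have b1E x : (`| \int[Q1 k w]_z (ci x z)%:E | =
    `| \int[pker_at (Q1 k) w]_z ci x z |%:E)%E.
  by rewrite EFin_normr_Rintegral//; exact/bmeas_integrable/bmeas_centered_indic.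
rewrite ge0_fin_numE; last first.
  apply: (le_trans (abse_ge0 (\int[Q1 k w]_z (ci 0 z)%:E)%E)).
  by apply: ereal_sup_ubound; exists 0.
apply: (@le_lt_trans _ _ 1%E); last by rewrite ltry.
apply: ge_ereal_sup => _ [x _ <-]; rewrite b1E lee_fin.
by apply: Ex_bound; [exact: measurable_centered_indic|exact: centered_indic_le1].
Qed.

Lemma b1_ub k w x :
  `| \int[pker_at (Q1 k) w]_z ci x z | <= fine (b1 Q1 k w).
Proof.
rewrite -lee_fin fineK ?b1_fin_num// EFin_normr_Rintegral//; last first.
  exact/bmeas_integrable/bmeas_centered_indic.
by apply: ereal_sup_ubound; exists x.
Qed.

Lemma bmeas_centered_indic2 xy : bmeas (centered_indic2 X xy).
Proof.
apply: bmeasM.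
- by apply: (bmeas_comp (p := fst)) => //; exact: bmeas_centered_indic.
- by apply: (bmeas_comp (p := snd)) => //; exact: bmeas_centered_indic.
Qed.

Lemma centered_indic2_le1 xy z : `|centered_indic2 X xy z| <= 1.
Proof.
rewrite normrM -[leRHS]mulr1 ler_pM//; exact: centered_indic_le1.
Qed.

Lemma b2E i j w xy :
  (`| \int[Q2 i j w]_z (centered_indic2 X xy z)%:E -
      \int[distribution P (pairRV (X i) (X j))]_z (centered_indic2 X xy z)%:E | =
   `| \int[pker_at (Q2 i j) w]_z centered_indic2 X xy z -
     \int[distribution P (pairRV (X i) (X j))]_z centered_indic2 X xy z |%:E)%E.
Proof.
rewrite -(EFin_RintegralE (pker_at (Q2 i j) w)); last exact: bmeas_centered_indic2.
by rewrite -(EFin_RintegralE (distribution P _)); last exact: bmeas_centered_indic2.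
Qed.

Lemma b2_fin_num i j w : b2 Q2 i j w \is a fin_num.
Proof.
rewrite ge0_fin_numE; last first.
  apply: (@le_trans _ _ (`| \int[Q2 i j w]_z (centered_indic2 X (0, 0) z)%:E -
      \int[distribution P (pairRV (X i) (X j))]_z
        (centered_indic2 X (0, 0) z)%:E |)%E); first exact: abse_ge0.
  by apply: ereal_sup_ubound; exists (0, 0).
apply: (@le_lt_trans _ _ 2%:E%E); last by rewrite ltry.
apply: ge_ereal_sup => _ [x _ <-]; rewrite b2E lee_fin.
apply: (le_trans (ler_normB _ _)); rewrite (_ : 2 = 1 + 1)//.
apply: lerD; apply: Ex_bound => [|z].
- exact: (bmeas_centered_indic2 x).1.
- exact: centered_indic2_le1.
- exact: (bmeas_centered_indic2 x).1.
- exact: centered_indic2_le1.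
Qed.

Lemma b2_ub i j w xy :
  `| \int[pker_at (Q2 i j) w]_z centered_indic2 X xy z -
     \int[distribution P (pairRV (X i) (X j))]_z centered_indic2 X xy z |
  <= fine (b2 Q2 i j w).
Proof.
rewrite -lee_fin fineK ?b2_fin_num// -b2E.
by apply: ereal_sup_ubound; exists xy.
Qed.

Lemma b1_ray_average k w M g : ray_average X M g ->
  `| \int[pker_at (Q1 k) w]_z g z | <= M * fine (b1 Q1 k w).
Proof.
move=> gM; under eq_Rintegral do rewrite -[g _]mulr1.
apply: (ray_average_functional1 (p1 := id)) gM => //; first exact: bmeas_cst.
by move=> x; under eq_Rintegral do rewrite mulr1; exact: b1_ub.
Qed.

(** Bilinearity: the functional bound is used in the first coordinate with weight [h z.2], then in
    the second with weight [ci x z.1], which leaves the products of generators in the definition of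
    [b2]. *)
Lemma b2_ray_average i j w M N g h : ray_average X M g -> ray_average X N h ->
  `| \int[pker_at (Q2 i j) w]_z (g z.1 * h z.2) -
     \int[distribution P (pairRV (X i) (X j))]_z (g z.1 * h z.2) |
  <= M * (N * fine (b2 Q2 i j w)).
Proof.
move=> gM hN; have bh := ray_average_bmeas hN.
apply: (ray_average_functional (p1 := fst) (p2 := fst)) gM => //.
- exact: (bmeas_comp (p := snd)).
- exact: (bmeas_comp (p := snd)).
move=> x; under eq_Rintegral do rewrite mulrC.
under [X in _ - X]eq_Rintegral do rewrite mulrC.
apply: (ray_average_functional (p1 := snd) (p2 := snd)
  (c1 := fun z => ci x z.1) (c2 := fun z => ci x z.1)) hN => //.
- by apply: (bmeas_comp (p := fst)) => //; exact: bmeas_centered_indic.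
- by apply: (bmeas_comp (p := fst)) => //; exact: bmeas_centered_indic.
move=> y; under eq_Rintegral do rewrite mulrC.
under [X in _ - X]eq_Rintegral do rewrite mulrC.
exact: (b2_ub i j w (x, y)).
Qed.

(* [1_(z <= x) 1_(z <= y) = 1_(z <= min x y)] reduces products at a single time
   to the coefficient of one variable. *)
Lemma b1_ray_average_mul k w M N g h : ray_average X M g -> ray_average X N h ->
  `| \int[pker_at (Q1 k) w]_z (g z * h z) - \int[mu0]_z (g z * h z) |
  <= M * (N * (3 * fine (b1 Q1 k w))).
Proof.
move=> gM hN; have bh := ray_average_bmeas hN.
apply: (ray_average_functional (p1 := id) (p2 := id)) gM => // x.
under eq_Rintegral do rewrite mulrC.
under [X in _ - X]eq_Rintegral do rewrite mulrC.
have bci := bmeas_centered_indic.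
apply: (ray_average_functional (p1 := id) (p2 := id)) hN => // y.
pose F t := fine (cdf (X 0) t).
have F01 t : `|F t| <= 1.
  rewrite /F cdf_Ex; apply: Ex_bound => [|z]; first exact: measurable_indic.
  by rewrite indicE normr_nat lern1 leq_b1.
pose c0 := F (Num.min y x) - F y * F x.
have E z : ci y z * ci x z =
    ci (Num.min y x) z - F x * ci y z - F y * ci x z + c0.
  rewrite /centered_indic -/(F _) -/(F _) -/(F _) /c0.
  rewrite (_ : \1_(`]-oo, Num.min y x]) z =
    \1_(`]-oo, y]) z * \1_(`]-oo, x]) z :> R); first by ring.
  rewrite !indicE -natrM mulnb; congr (nat_of_bool _)%:R.
  by rewrite !mem_setE !in_itv/= le_min.
have L (nu : probability R R) : \int[nu]_z (ci y z * ci x z) =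
    \int[nu]_z ci (Num.min y x) z - F x * \int[nu]_z ci y z -
    F y * \int[nu]_z ci x z + c0.
  under eq_Rintegral do rewrite E.
  have bF r t : bmeas (fun z => F r * ci t z).
    by apply: bmeasM => //; exact: bmeas_cst.
  rewrite ExD ?Ex_cst; last 2 first.
  - exact: (bmeasB (bmeasB (bci _) (bF x y)) (bF y x)).
  - exact: bmeas_cst.
  rewrite ExB; [|exact: (bmeasB (bci _) (bF x y))|exact: bF].
  by rewrite ExB// !ExZl.
(* The constant [c0] cancels between the two laws and [ci] has mean 0 under [mu0]. Three terms with
   coefficients of modulus at most 1 remain, whence the factor 3. *)
rewrite !L !Ex_centered_indic !mulr0 !subr0 add0r addrK.
apply: (le_trans (ler_normB _ _)).
rewrite (_ : 3 * _ = fine (b1 Q1 k w) + fine (b1 Q1 k w) + fine (b1 Q1 k w)); last by ring.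
have FM r t : `|F r * \int[pker_at (Q1 k) w]_z ci t z| <= fine (b1 Q1 k w).
  rewrite normrM -[leRHS]mul1r ler_pM//; exact: b1_ub.
apply: lerD => //; apply: (le_trans (ler_normB _ _)); apply: lerD => //.
exact: b1_ub.
Qed.


(** With the past frozen, [phi] is a bounded multiple of a ray average, whose conditional mean is
    controlled by [b1]. The multiplier may depend on the past in any measurable way. *)
Lemma mixing1 (k : int) (phi : TG * R -> R) (K M B : R) : bmeas phi ->
  (forall w, exists c g, [/\ `|c| <= K, ray_average X M g &
     forall y, phi (w, y) = c * g y]) ->
  0 < K -> 0 < M -> (\int[P]_w b1 Q1 k w <= B%:E)%E ->
  `|\int[P]_w phi (w, X k w)| <= K * M * B.
Proof.
move=> bphi phiE K0 M0 bB.
have [bk ->] := freezing past_measurable (Q1X k) bphi.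
have {}bk := bmeas_coarse past_measurable bk.
apply: (le_trans (Ex_norm P bk)).
apply: (Ex_le_lower (b := b1 Q1 k)) => //.
- exact: bmeas_norm.
- exact: mulr_gt0.
- by move=> w; exact: b1_fin_num.
move=> w; have [c [g [cK gM E]]] := phiE w.
under eq_Rintegral do rewrite E.
rewrite ExZl; last exact: ray_average_bmeas gM.
rewrite normrM -mulrA ler_pM//; exact: b1_ray_average.
Qed.

(** The second integral redraws the pair independently of the past; the two differ by the integral
    of a conditional discrepancy that [b2] dominates. *)
Lemma mixing2 (i j : int) (phi : TG * (R * R) -> R) (K M N B : R) : bmeas phi ->
  (forall w, exists c g h, [/\ `|c| <= K, ray_average X M g, ray_average X N h &
     forall z, phi (w, z) = c * (g z.1 * h z.2)]) ->
  0 < K -> 0 < M -> 0 < N -> (\int[P]_w b2 Q2 i j w <= B%:E)%E ->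
  `|\int[P]_w phi (w, (X i w, X j w)) -
    \int[P]_w \int[P]_w' phi (w, (X i w', X j w'))| <= K * M * N * B.
Proof.
move=> bphi phiE K0 M0 N0 bB.
have [bk E1] := freezing past_measurable (Q2X i j) bphi.
have {}bk := bmeas_coarse past_measurable bk.
rewrite [X in X - _]E1.
pose nu := distribution P (pairRV (X i) (X j)).
have nuE w : \int[P]_w' phi (w, (X i w', X j w')) = \int[nu]_z phi (w, z).
  by rewrite Ex_distribution//; exact: bmeas_pair1.
under [X in _ - X]eq_Rintegral do rewrite nuE.
have bk' : bmeas (fun w : T => \int[nu]_z phi ((w : TG), z)).
  by apply: (bmeas_coarse past_measurable); exact: bmeas_Ex2.
rewrite -ExB//.
apply: (le_trans (Ex_norm P (bmeasB bk bk'))).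
apply: (Ex_le_lower (b := b2 Q2 i j)) => //.
- by apply: bmeas_norm; exact: bmeasB.
- by rewrite !mulr_gt0.
- by move=> w; exact: b2_fin_num.
move=> w; have [c [g [h [cK gM hN E]]]] := phiE w.
under eq_Rintegral do rewrite E.
under [X in _ - X]eq_Rintegral do rewrite E.
have bgh : bmeas (fun z : R * R => g z.1 * h z.2).
  by apply: bmeasM; [apply: (bmeas_comp (p := fst))|apply: (bmeas_comp (p := snd))];
    rewrite //; [exact: ray_average_bmeas gM|exact: ray_average_bmeas hN].
rewrite !ExZl// -mulrBr normrM -!mulrA ler_pM//; exact: b2_ray_average.
Qed.

(** The case of two equal times, which the supremum over [i > j] in [beta2] leaves out; the product
    is reduced to [b1]. *)
Lemma mixing_diag (k : int) (phi : TG * R -> R) (K M N B : R) : bmeas phi ->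
  (forall w, exists c g h, [/\ `|c| <= K, ray_average X M g, ray_average X N h &
     forall y, phi (w, y) = c * (g y * h y)]) ->
  0 < K -> 0 < M -> 0 < N -> (\int[P]_w b1 Q1 k w <= B%:E)%E ->
  `|\int[P]_w phi (w, X k w) - \int[P]_w \int[P]_w' phi (w, X k w')|
  <= 3 * K * M * N * B.
Proof.
move=> bphi phiE K0 M0 N0 bB.
have [bk E1] := freezing past_measurable (Q1X k) bphi.
have {}bk := bmeas_coarse past_measurable bk.
rewrite [X in X - _]E1.
have nuE w : \int[P]_w' phi (w, X k w') = \int[mu0]_z phi (w, z).
  rewrite Ex_distribution; last exact: bmeas_pair1.
  by apply: (X_law k (h := fun y => phi (w, y))); exact: bmeas_pair1.
under [X in _ - X]eq_Rintegral do rewrite nuE.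
have bk' : bmeas (fun w : T => \int[mu0]_z phi ((w : TG), z)).
  by apply: (bmeas_coarse past_measurable); exact: bmeas_Ex2.
rewrite -ExB//.
apply: (le_trans (Ex_norm P (bmeasB bk bk'))).
apply: (Ex_le_lower (b := b1 Q1 k)) => //.
- by apply: bmeas_norm; exact: bmeasB.
- by rewrite !mulr_gt0.
- by move=> w; exact: b1_fin_num.
move=> w; have [c [g [h [cK gM hN E]]]] := phiE w.
under eq_Rintegral do rewrite E.
under [X in _ - X]eq_Rintegral do rewrite E.
have bgh : bmeas (fun z : R => g z * h z).
  by apply: bmeasM; [exact: ray_average_bmeas gM|exact: ray_average_bmeas hN].
rewrite !ExZl// -mulrBr normrM.
rewrite (_ : 3 * K * M * N * _ = K * (M * (N * (3 * fine (b1 Q1 k w))))); last by ring.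
by rewrite ler_pM//; exact: b1_ray_average_mul.
Qed.

End mixing.

(** * Stationarity for integrals of bounded functions *)

Section stationarity.
Context d (T : measurableType d) (R : realType) (P : probability T R).
Variable X : int -> {RV P >-> R}.
Hypothesis X_stationary : strictly_stationary X.

Lemma measurable_process_tuple n (t : 'I_n -> int) :
  measurable_fun setT (fun w => [tuple X (t i) w | i < n]).
Proof.
apply/measurable_fun_tnthP => i.
rewrite (_ : _ \o _ = X (t i)); first exact: measurable_funPT.
by apply/funext => w /=; rewrite tnth_mktuple.
Qed.

Lemma stationary_Ex n (t : n.-tuple int) (h : int) (psi : n.-tuple R -> R) :
  bmeas psi ->
  \int[P]_w psi [tuple X (tnth t i + h) w | i < n] =
  \int[P]_w psi [tuple X (tnth t i) w | i < n].
Proof.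
have m1 := measurable_process_tuple (fun i => tnth t i + h).
have m2 := measurable_process_tuple (tnth t).
move: psi; apply: bmeas_induction.
- move=> g g' bg bg' E E'.
  rewrite (ExD P (bmeas_comp m1 bg) (bmeas_comp m1 bg')) E E'.
  by rewrite (ExD P (bmeas_comp m2 bg) (bmeas_comp m2 bg')).
- move=> r g bg E.
  by rewrite (ExZl P r (bmeas_comp m1 bg)) E (ExZl P r (bmeas_comp m2 bg)).
- move=> g_ g M bg_ g_M bg g_g E.
  have c1 : \int[P]_w g_ n [tuple X (tnth t i + h) w | i < _] @[n --> \oo] -->
      \int[P]_w g [tuple X (tnth t i + h) w | i < n].
    apply: (Ex_cvg (M := M)) => //; last exact: (bmeas_comp m1 bg).1.
    by move=> k; apply: (bmeas_comp m1 (bg_ k)).1.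
  have c2 : \int[P]_w g_ n [tuple X (tnth t i) w | i < _] @[n --> \oo] -->
      \int[P]_w g [tuple X (tnth t i) w | i < n].
    apply: (Ex_cvg (M := M)) => //; last exact: (bmeas_comp m2 bg).1.
    by move=> k; apply: (bmeas_comp m2 (bg_ k)).1.
  rewrite -(cvg_lim (@Rhausdorff R) c1) -(cvg_lim (@Rhausdorff R) c2).
  by congr (lim (_ @ \oo)); apply/funext.
- move=> A mA.
  have E (u : T -> n.-tuple R) : measurable_fun setT u ->
      \int[P]_w (\1_A (u w) : R) = fine (P [set w | A (u w)]).
    move=> mu; rewrite -Ex_indic//.
    by rewrite -[X in measurable X]setTI; exact: mu.
  by rewrite !E// X_stationary.
Qed.

Lemma stationary_law (k : int) (h : R -> R) : bmeas h ->
  \int[P]_w h (X k w) = \int[P]_w h (X 0 w).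
Proof.
move=> bh; pose psi (x : 1.-tuple R) := h (tnth x ord0).
have bpsi : bmeas psi by apply: bmeas_comp => //; exact: measurable_tnth.
have := stationary_Ex [tuple 0] k bpsi.
rewrite /psi; under eq_Rintegral do rewrite tnth_mktuple (tnth_nth 0)/= add0r.
by under [RHS]eq_Rintegral do rewrite tnth_mktuple (tnth_nth 0)/=.
Qed.

End stationarity.

Section stationary_mixing.
Context d (T : measurableType d) (R : realType) (P : probability T R).
Variable X : int -> {RV P >-> R}.
Local Notation TG := (g_sigma_algebraType (past_events X)).
Variable Q1 : int -> R.-pker TG ~> R.
Variable Q2 : int -> int -> R.-pker TG ~> (R * R)%type.
Hypothesis X_stationary : strictly_stationary X.
Hypothesis Q1X : forall k : int, is_cond_distribution (P := P) (X k) (Q1 k).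
Hypothesis Q2X : forall i j : int,
  is_cond_distribution (P := P) (pairRV (X i) (X j)) (Q2 i j).
Hypothesis beta2_summable : (\sum_(1 <= k <oo) beta2 Q1 Q2 k < +oo)%E.

Definition betaR k : R := fine (beta2 Q1 Q2 k).

Lemma beta2_ge0 k : (0 <= beta2 Q1 Q2 k)%E.
Proof.
rewrite /beta2 le_max; apply/orP; left; apply: integral_ge0 => w _.
apply: (le_trans (abse_ge0 (\int[Q1 k w]_z (centered_indic X 0 z)%:E)%E)).
by apply: ereal_sup_ubound; exists 0.
Qed.

Lemma betaR_ge0 k : 0 <= betaR k.
Proof. by apply: fine_ge0; exact: beta2_ge0. Qed.

Lemma sum_beta2_le n : (\sum_(1 <= k < n) beta2 Q1 Q2 k <=
  \sum_(1 <= k <oo) beta2 Q1 Q2 k)%E.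
Proof. by apply: nneseries_lim_ge => k _ _; exact: beta2_ge0. Qed.

(** A term of a convergent series of nonnegative terms is finite. *)
Lemma beta2E k : (0 < k)%N -> beta2 Q1 Q2 k = (betaR k)%:E.
Proof.
move=> k0; rewrite fineK// ge0_fin_numE ?beta2_ge0//.
apply: le_lt_trans beta2_summable; apply: le_trans (sum_beta2_le k.+1).
rewrite big_nat_recr//=; apply: leeDr; apply: sume_ge0 => i _.
exact: beta2_ge0.
Qed.

Lemma sum_betaR_bounded :
  exists S, 0 <= S /\ forall n, \sum_(1 <= k < n) betaR k <= S.
Proof.
exists (fine (\sum_(1 <= k <oo) beta2 Q1 Q2 k)).
have s0 : (0 <= \sum_(1 <= k <oo) beta2 Q1 Q2 k)%E.
  by apply: nneseries_ge0 => k _ _; exact: beta2_ge0.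
split=> [|n]; first exact: fine_ge0.
rewrite -lee_fin fineK ?ge0_fin_numE// -sumEFin.
apply: le_trans (sum_beta2_le n).
rewrite le_eqVlt; apply/orP; left; apply/eqP.
by apply: eq_big_nat => k /andP[k0 _]; rewrite beta2E.
Qed.

Lemma sum_betaR_tail e : 0 < e ->
  exists2 L, (0 < L)%N & forall n, \sum_(L <= k < n) betaR k <= e.
Proof.
move=> e0; have [S [_ SS]] := sum_betaR_bounded.
pose u n := \sum_(1 <= k < n) betaR k.
have nd : nondecreasing_seq u.
  move=> a b ab; rewrite /u; have [b0|b0] := posnP b.
    by move: ab; rewrite b0 leqn0 => /eqP ->.
  have [a0|a0] := posnP a.
    by rewrite a0 big_geq// sumr_ge0// => i _; exact: betaR_ge0.
  by rewrite (big_cat_nat a0 ab)/= lerDl sumr_ge0// => i _; exact: betaR_ge0.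
have cu : cvgn u.
  by apply: nondecreasing_is_cvgn => //; exists S => _ [n _ <-]; exact: SS.
have [L _ LL] : \forall n \near \oo, limn u - e < u n.
  by apply: (cvgr_gt (limn u)) => //; rewrite gtrDl oppr_lt0.
exists L.+1 => // n; have [nL|Ln] := leqP n L.+1.
  by rewrite big_geq// ltW.
have := nondecreasing_cvgn_le nd cu n.
have /= := LL L.+1 (leqnSn L).
rewrite /u (@big_cat_nat _ _ _ L.+1 1 n)//=; last exact: ltnW.
move: (\sum_(1 <= i < L.+1) _) (\sum_(L.+1 <= i < n) _) (limn _) => a b l.
lra.
Qed.

Lemma b1_le_betaR k : (0 < k)%N -> (\int[P]_w b1 Q1 k%:Z w <= (betaR k)%:E)%E.
Proof. by move=> k0; rewrite -beta2E// /beta2 le_max lexx. Qed.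

Lemma b2_le_betaR (i j k : nat) : (0 < k <= j)%N -> (j < i)%N ->
  (\int[P]_w b2 Q2 i%:Z j%:Z w <= (betaR k)%:E)%E.
Proof.
move=> /andP[k0 kj] ji; rewrite -beta2E// /beta2 le_max; apply/orP; right.
apply: ereal_sup_ubound; exists (i%:Z, j%:Z) => //=.
by rewrite lez_nat kj ltz_nat.
Qed.

(** The times [k] and [l] are put in front of the tuple [t], so that one tuple of length [n.+2] is
    shifted as a whole. *)
Lemma stationary_Ex_pair n (t : n.-tuple int) (k l h : int)
    (Phi : n.-tuple R * (R * R) -> R) : bmeas Phi ->
  \int[P]_w Phi ([tuple X (tnth t i + h) w | i < n], (X (k + h) w, X (l + h) w))
  = \int[P]_w Phi ([tuple X (tnth t i) w | i < n], (X k w, X l w)).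
Proof.
move=> bPhi.
pose psi (x : n.+2.-tuple R) :=
  Phi ([tuple tnth x (lift ord0 (lift ord0 i)) | i < n],
       (tnth x ord0, tnth x (lift ord0 ord0))).
have bpsi : bmeas psi.
  apply: bmeas_comp bPhi; apply: measurable_fun_pair; last first.
    by apply: measurable_fun_pair; exact: measurable_tnth.
  apply/measurable_fun_tnthP => i.
  rewrite (_ : _ \o _ = fun x => tnth x (lift ord0 (lift ord0 i))); last first.
    by apply/funext => x /=; rewrite tnth_mktuple.
  exact: measurable_tnth.
have E (g : int -> int) w :
    psi [tuple X (g (tnth [tuple of k :: l :: t] i)) w | i < n.+2] =
    Phi ([tuple X (g (tnth t i)) w | i < n], (X (g k) w, X (g l) w)).
  rewrite /psi !tnth_mktuple; congr Phi; congr (_, _).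
  by apply: eq_from_tnth => i; rewrite !tnth_mktuple !tnthS.
have := stationary_Ex X_stationary [tuple of k :: l :: t] h bpsi.
under eq_Rintegral do rewrite (E (fun a => a + h)).
by under [X in _ = X -> _]eq_Rintegral do rewrite (E id).
Qed.

(** * Decoupling after an arbitrary time *)

Section shifted.
Variables (n : nat) (t : n.-tuple int) (s : int).
Hypothesis ts : forall i, tnth t i <= s.
Let past w := [tuple X (tnth t i - s) w | i < n].
Let now w := [tuple X (tnth t i) w | i < n].

Let mpast : measurable_fun setT (past : TG -> n.-tuple R).
Proof.
apply/measurable_fun_tnthP => i.
rewrite (_ : _ \o _ = X (tnth t i - s)); last first.
  by apply/funext => w /=; rewrite tnth_mktuple.
by apply: measurable_past; rewrite subr_le0.
Qed.

Let mpair d1 (T1 : measurableType d1) :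
  measurable_fun setT (fun z : TG * T1 => (past z.1, z.2)).
Proof.
apply: measurable_fun_pair => //.
exact: (measurableT_comp mpast measurable_fst).
Qed.

(** A shift by [- s] brings the times of [t] to nonpositive ones, that is, into the conditioning
    sigma-algebra, and leaves the pair at times [k] and [l]. The smaller lag [l] gives the rate; the
    factor 3 is the one of the case [k = l]. *)
Lemma mixing_time2 (k l : nat) (Phi : n.-tuple R * (R * R) -> R) K M N :
  (0 < l <= k)%N -> bmeas Phi ->
  (forall x, exists c g h, [/\ `|c| <= K, ray_average X M g,
     ray_average X N h & forall y, Phi (x, y) = c * (g y.1 * h y.2)]) ->
  0 < K -> 0 < M -> 0 < N ->
  `|\int[P]_w Phi (now w, (X (s + k%:Z) w, X (s + l%:Z) w)) -
    \int[P]_w \int[P]_w' Phi (now w, (X (s + k%:Z) w', X (s + l%:Z) w'))|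
  <= 3 * K * M * N * betaR l.
Proof.
move=> /andP[l0 lk] bPhi PhiE K0 M0 N0.
have -> : \int[P]_w Phi (now w, (X (s + k%:Z) w, X (s + l%:Z) w)) =
    \int[P]_w Phi (past w, (X k%:Z w, X l%:Z w)).
  have := stationary_Ex_pair [tuple tnth t i - s | i < n] k%:Z l%:Z s bPhi.
  rewrite ![_%:Z + s]addrC.
  under eq_Rintegral do under eq_mktuple do rewrite tnth_mktuple subrK.
  by under [in RHS]eq_Rintegral do under eq_mktuple do rewrite tnth_mktuple.
have -> : \int[P]_w \int[P]_w' Phi (now w, (X (s + k%:Z) w', X (s + l%:Z) w')) =
    \int[P]_w \int[P]_w' Phi (past w, (X k%:Z w', X l%:Z w')).
  pose Psi (z : n.-tuple R * (R * R)) := \int[P]_w' Phi (z.1, (X k%:Z w', X l%:Z w')).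
  have bPsi : bmeas Psi.
    apply: (bmeas_comp (p := fst)
      (h := fun x => \int[P]_w' Phi (x, (X k%:Z w', X l%:Z w')))) => //.
    apply: (bmeas_Ex2 P (f := fun z => Phi (z.1, (X k%:Z z.2, X l%:Z z.2)))).
    apply: (bmeas_comp (p := fun z => (z.1, (X k%:Z z.2, X l%:Z z.2)))) => //.
    apply: measurable_fun_pair => //; apply: measurable_fun_pair.
    - exact: measurableT_comp.
    - exact: measurableT_comp.
  have inner x : \int[P]_w' Phi (x, (X (s + k%:Z) w', X (s + l%:Z) w')) =
      \int[P]_w' Phi (x, (X k%:Z w', X l%:Z w')).
    have bPhix : bmeas (fun z : n.-tuple R * (R * R) => Phi (x, z.2)).
      apply: (bmeas_comp (p := snd) (h := fun z => Phi (x, z))) => //.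
      exact: bmeas_pair1.
    have := stationary_Ex_pair [tuple 0 | i < n] k%:Z l%:Z s bPhix.
    by rewrite /= ![_%:Z + s]addrC.
  under eq_Rintegral do rewrite inner.
  have := stationary_Ex_pair [tuple tnth t i - s | i < n] k%:Z l%:Z s bPsi.
  rewrite /Psi/=.
  under eq_Rintegral do under eq_mktuple do rewrite tnth_mktuple subrK.
  by under [in RHS]eq_Rintegral do under eq_mktuple do rewrite tnth_mktuple.
have X_law (i : int) (h : R -> R) : bmeas h ->
    \int[P]_w h (X i w) = \int[P]_w h (X 0 w) by exact: stationary_law.
(* [b2] only controls distinct times, so equal lags go through [mixing_diag]. *)
have [kl|kl] := eqVneq k l.
  rewrite kl.
  pose phi (z : TG * R) := Phi (past z.1, (z.2, z.2)).
  have bphi : bmeas phi.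
    apply: (bmeas_comp (p := fun z : TG * R => (past z.1, (z.2, z.2)))) => //.
    apply: (measurable_fun_pair (f := fun z : TG * R => past z.1)).
      exact: (measurableT_comp mpast measurable_fst).
    by apply: measurable_fun_pair.
  apply: (mixing_diag Q1X X_law (phi := phi)) => // [w|].
    have [c [g [h [cK gM hN E]]]] := PhiE (past w).
    by exists c, g, h; split => // y; rewrite /phi E.
  exact: b1_le_betaR.
pose phi (z : TG * (R * R)) := Phi (past z.1, z.2).
have bphi : bmeas phi by exact: (bmeas_comp (@mpair _ _) bPhi).
have := mixing2 Q2X (i := k%:Z) (j := l%:Z) (phi := phi) (K := K) (M := M) (N := N).
move=> /(_ (betaR l) bphi) h.
apply: (le_trans (h _ _ _ _ _)) => //.
- move=> w; have [c [g [h' [cK gM hN E]]]] := PhiE (past w).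
  by exists c, g, h'; split => // y; rewrite /phi E.
- by apply: b2_le_betaR; rewrite ?l0 ?leqnn// ltn_neqAle eq_sym kl.
- rewrite -!mulrA ler_peMl ?ler1n// !mulr_ge0 ?betaR_ge0//; exact: ltW.
Qed.

Lemma mixing_time1 (k : nat) (Phi : n.-tuple R * R -> R) K M :
  (0 < k)%N -> bmeas Phi ->
  (forall x, exists c g, [/\ `|c| <= K, ray_average X M g &
     forall y, Phi (x, y) = c * g y]) ->
  0 < K -> 0 < M ->
  `|\int[P]_w Phi (now w, X (s + k%:Z) w)| <= K * M * betaR k.
Proof.
move=> k0 bPhi PhiE K0 M0.
have -> : \int[P]_w Phi (now w, X (s + k%:Z) w) =
    \int[P]_w Phi (past w, X k%:Z w).
  have bPhi' : bmeas (fun z : n.-tuple R * (R * R) => Phi (z.1, z.2.1)).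
    apply: (bmeas_comp (p := fun z : n.-tuple R * (R * R) => (z.1, z.2.1))) => //.
    by apply: measurable_fun_pair => //; exact: measurableT_comp.
  have := stationary_Ex_pair [tuple tnth t i - s | i < n] k%:Z k%:Z s bPhi'.
  rewrite ![_%:Z + s]addrC/=.
  under eq_Rintegral do under eq_mktuple do rewrite tnth_mktuple subrK.
  by under [in RHS]eq_Rintegral do under eq_mktuple do rewrite tnth_mktuple.
pose phi (z : TG * R) := Phi (past z.1, z.2).
have bphi : bmeas phi by exact: (bmeas_comp (@mpair _ _) bPhi).
apply: (mixing1 Q1X (phi := phi)) => // [w|].
  have [c [g [cK gM E]]] := PhiE (past w).
  by exists c, g; split => // y; rewrite /phi E.
exact: b1_le_betaR.
Qed.

End shifted.

End stationary_mixing.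

(** * Trigonometric Taylor estimates *)

Section taylor.
Context (R : realType).
Implicit Types u h x y : R.

Lemma derive_bound (f df : R -> R) M h : (forall x, is_derive x 1 f (df x)) ->
  (forall x, `|x| <= `|h| -> `|df x| <= M) -> `|f h - f 0| <= M * `|h|.
Proof.
move=> fd dM.
have fc : continuous f.
  by move=> x; apply: differentiable_continuous; apply/derivable1_diffP; case: (fd x).
have [h0|h0] := leP 0 h.
  have [c + ->] := MVT_segment h0 (fun x _ => fd x) (continuous_subspaceT fc).
  rewrite in_itv/= => /andP[c0 ch]; rewrite subr0 normrM ler_wpM2r//.
  by apply: dM; rewrite !ger0_norm.
have [c + E] := MVT_segment (ltW h0) (fun x _ => fd x) (continuous_subspaceT fc).
rewrite in_itv/= => /andP[hc c0]; rewrite distrC E sub0r normrM normrN.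
rewrite ler_wpM2r//; apply: dM.
by rewrite !ler0_norm ?lerN2// ltW.
Qed.

Lemma norm_sin_le x : `|sin x| <= `|x|.
Proof.
rewrite -[X in `|X|]subr0 -(sin0 R) -[leRHS]mul1r.
by apply: (derive_bound (df := cos)) => y _; exact: cos_max.
Qed.

Lemma onem_cos_le x : `|1 - cos x| <= x ^+ 2 / 2.
Proof.
have -> : 1 - cos x = 2 * sin (x / 2) ^+ 2.
  rewrite {1}(_ : x = (x / 2) *+ 2); last by rewrite -mulr_natr divfK.
  by rewrite cos_mulr2n sin2cos2 -mulr_natl; ring.
rewrite normrM normrX ger0_norm// (_ : x ^+ 2 / 2 = 2 * `|x / 2| ^+ 2); last first.
  by rewrite real_normK ?num_real// expr_div_n; field.
by rewrite ler_pM2l// lerXn2r ?nnegrE// norm_sin_le.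
Qed.

Lemma sin_sub_id_le x : `|sin x - x| <= `|x| ^+ 3 / 2.
Proof.
have := @derive_bound (fun y => sin y - y) (fun y => cos y - 1) (x ^+ 2 / 2) x.
rewrite /= sin0 !subr0 => h.
rewrite (_ : _ ^+ 3 / 2 = x ^+ 2 / 2 * `|x|); last first.
  by rewrite -(real_normK (num_real x)); ring.
apply: h => y yx; rewrite distrC; apply: (le_trans (onem_cos_le y)).
by rewrite ler_pM2r// -(real_normK (num_real y)) -(real_normK (num_real x)) lerXn2r ?nnegrE.
Qed.

Lemma cos_taylor2_le x : `|x| <= 1 -> `|cos x - 1 + x ^+ 2 / 2| <= `|x| ^+ 3 / 2.
Proof.
move=> x1; set y := x / 2.
(* With [1 - cos x = 2 sin^2 y] this is a difference of squares; one factor is cubic in [y] and the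
   other at most [|x| <= 1]. *)
have -> : cos x - 1 + x ^+ 2 / 2 = 2 * ((y - sin y) * (y + sin y)).
  rewrite {1}(_ : x = y *+ 2); last by rewrite -mulr_natr divfK.
  by rewrite cos_mulr2n cos2sin2 -mulr_natl /y; field.
have yE : `|x| = 2 * `|y| by rewrite normrM [X in _ * (_ * X)]ger0_norm//; field.
have y1 : `|y - sin y| <= `|y| ^+ 3 / 2 by rewrite distrC sin_sub_id_le.
have y2 : `|y + sin y| <= 1.
  apply: (le_trans (ler_normD _ _)); have := norm_sin_le y.
  by move: x1; rewrite yE; lra.
rewrite !normrM ger0_norm// yE exprMn.
apply: (@le_trans _ _ (2 * (`|y| ^+ 3 / 2 * 1))); first by rewrite ler_pM2l// ler_pM.
have := exprn_ge0 3 (normr_ge0 y); set z := `|y| ^+ 3; lra.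
Qed.

Lemma sin_lip u h : `|sin (u + h) - sin u| <= `|h|.
Proof.
have -> : sin (u + h) - sin u = 2 * (cos (u + h / 2) * sin (h / 2)).
  rewrite {1}(_ : u + h = (u + h / 2) + h / 2); last by field.
  rewrite {2}(_ : u = (u + h / 2) - h / 2); last by field.
  by rewrite sinB sinD; ring.
rewrite !normrM (_ : `|h| = `|2| * (1 * `|h / 2|)); last first.
  by rewrite mul1r -normrM mulrC divfK.
by rewrite ler_pM2l ?normr_gt0// ler_pM// ?cos_max// norm_sin_le.
Qed.

Lemma cos_lip u h : `|cos (u + h) - cos u| <= `|h|.
Proof.
have := sin_lip (u + pi / 2) h.
by rewrite addrAC !sinDpihalf.
Qed.

Lemma sin_taylor1 u h : `|h| <= 1 ->
  `|sin (u + h) - sin u - h * cos u| <= `|h| ^+ 2.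
Proof.
move=> h1; rewrite sinD.
rewrite (_ : _ - _ = cos u * (sin h - h) - sin u * (1 - cos h)); last by ring.
apply: (le_trans (ler_normB _ _)); rewrite !normrM.
have c1 := cos_max u; have s1 := sin_max u.
have a1 := sin_sub_id_le h; have a2 := onem_cos_le h.
have -> : `|h| ^+ 2 = 1 * (`|h| ^+ 2 / 2) + 1 * (h ^+ 2 / 2).
  by rewrite real_normK ?num_real//; field.
apply: lerD; apply: ler_pM => //; apply: (le_trans a1).
by rewrite ler_pM2r// exprS ler_piMl// exprn_ge0.
Qed.

Lemma cos_taylor2 u h : `|h| <= 1 ->
  `|cos (u + h) - cos u + h * sin u + h ^+ 2 / 2 * cos u| <= `|h| ^+ 3.
Proof.
move=> h1; rewrite cosD.
rewrite [X in `|X| <= _](_ : _ =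
  cos u * (cos h - 1 + h ^+ 2 / 2) - sin u * (sin h - h)); last by field.
apply: (le_trans (ler_normB _ _)); rewrite !normrM.
have c1 := cos_max u; have s1 := sin_max u.
have a1 := sin_sub_id_le h; have a2 := cos_taylor2_le h1.
have -> : `|h| ^+ 3 = 1 * (`|h| ^+ 3 / 2) + 1 * (`|h| ^+ 3 / 2) by field.
by apply: lerD; apply: ler_pM.
Qed.

(** From [expR y >= 1 + y], the error is at most [(1 + y)^-1 - 1 + y = y^2 / (1 + y)], and
    [1 + y >= 1/2]. *)
Lemma expR_taylor1 y : `|y| <= 2^-1 -> `|expR (- y) - 1 + y| <= 2 * y ^+ 2.
Proof.
rewrite ler_norml => /andP[y1 y2].
have e1 := expR_ge1Dx (- y); have e2 := expR_ge1Dx y.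
rewrite ger0_norm; last lra.
have e0 := expR_gt0 y.
have h : (expR y)^-1 <= (1 + y)^-1 by rewrite lef_pV2 ?posrE//; lra.
rewrite expRN; apply: (@le_trans _ _ ((1 + y)^-1 - 1 + y)).
  by rewrite !lerD2r.
rewrite -subr_ge0 (_ : _ - _ = y ^+ 2 * (1 + 2 * y) / (1 + y)); last by field; lra.
by apply: divr_ge0; [apply: mulr_ge0; [exact: sqr_ge0|lra]|lra].
Qed.

Lemma measurable_cos : measurable_fun setT (@cos R).
Proof. by apply: continuous_measurable_fun; exact: continuous_cos. Qed.

Lemma measurable_sin : measurable_fun setT (@sin R).
Proof. by apply: continuous_measurable_fun; exact: continuous_sin. Qed.

Lemma bmeas_cos d (T : measurableType d) (g : T -> R) :
  measurable_fun setT g -> bmeas (fun w => cos (g w)).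
Proof.
move=> mg; apply: (bmeas_le (M := 1)) => [|w]; last exact: cos_max.
exact: (measurableT_comp measurable_cos mg).
Qed.

Lemma bmeas_sin d (T : measurableType d) (g : T -> R) :
  measurable_fun setT g -> bmeas (fun w => sin (g w)).
Proof.
move=> mg; apply: (bmeas_le (M := 1)) => [|w]; last exact: sin_max.
exact: (measurableT_comp measurable_sin mg).
Qed.

End taylor.

(** * A quantitative central limit theorem for mixing sequences *)

(** Schur's test: [2 a_k a_i <= a_k^2 + a_i^2], and every row or column sum of [b (k - i)] is at
    most the sum of [b] below [N]. *)
Lemma sum_conv_le (R : realFieldType) (a b : nat -> R) N :
  (forall l, 0 <= b l) ->
  \sum_(k < N) \sum_(i < k.+1) a k * a i * b (k - i)%N <=
  (\sum_(l < N) b l) * \sum_(k < N) a k ^+ 2.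
Proof.
move=> b0; pose F k i := (a k ^+ 2 + a i ^+ 2) / 2 * b (k - i)%N.
apply: (@le_trans _ _ (\sum_(k < N) \sum_(i < k.+1) F k i)).
  apply: ler_sum => k _; apply: ler_sum => i _; rewrite /F ler_wpM2r//.
  by have := sqr_ge0 (a k - a i); rewrite sqrrB; lra.
have leB k : (k <= N)%N -> \sum_(l < k) b l <= \sum_(l < N) b l.
  move=> kN; rewrite -!(big_mkord xpredT b) (big_cat_nat (leq0n k) kN)/= lerDl.
  exact: sumr_ge0.
have row : \sum_(k < N) \sum_(i < k.+1) a k ^+ 2 * b (k - i)%N <=
    (\sum_(l < N) b l) * \sum_(k < N) a k ^+ 2.
  rewrite [leRHS]mulrC mulr_suml; apply: ler_sum => k _; rewrite -mulr_sumr.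
  rewrite ler_wpM2l ?sqr_ge0//; apply: le_trans (leB k.+1 (ltn_ord k)).
  rewrite (reindex_inj rev_ord_inj)/=; apply: ler_sum => i _.
  by rewrite subSS subKn// -ltnS.
have col : \sum_(k < N) \sum_(i < k.+1) a i ^+ 2 * b (k - i)%N <=
    (\sum_(l < N) b l) * \sum_(k < N) a k ^+ 2.
  under eq_bigr => k _ do
    rewrite (big_ord_widen _ (fun i => a i ^+ 2 * b (k - i)%N) (ltn_ord k)).
  rewrite (exchange_big_dep xpredT)//= [leRHS]mulrC mulr_suml.
  apply: ler_sum => i _; rewrite -mulr_sumr ler_wpM2l ?sqr_ge0//.
  rewrite -(big_mkord (fun k => (i < k.+1)%N) (fun k => b (k - i)%N)).
  rewrite (big_cat_nat (leq0n i) (ltnW (ltn_ord i)))/=.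
  rewrite big_nat_cond big1 ?add0r; last by move=> k; lia.
  rewrite -{1}[i : nat]add0n big_addn.
  apply: le_trans (leB (N - i)%N (leq_subr _ _)).
  rewrite big_mkord big_mkcond/=; apply: ler_sum => l _.
  by rewrite addnK; case: ifP.
have -> : \sum_(k < N) \sum_(i < k.+1) F k i =
    (\sum_(k < N) \sum_(i < k.+1) a k ^+ 2 * b (k - i)%N +
     \sum_(k < N) \sum_(i < k.+1) a i ^+ 2 * b (k - i)%N) / 2.
  rewrite -big_split mulr_suml; apply: eq_bigr => k _ /=.
  rewrite -big_split mulr_suml; apply: eq_bigr => i _ /=.
  by rewrite /F; field.
lra.
Qed.

Section clt_bound.
Context d (T : measurableType d) (R : realType) (P : probability T R).
Variables (zeta : nat -> T -> R) (a : nat -> R) (beta : nat -> R).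
Variables (delta : R) (p q : nat) (alpha : R).

Let W k w := \sum_(i < k) zeta i w.

Hypothesis zeta_meas : forall k, measurable_fun setT (zeta k).
Hypothesis zeta_le : forall k w, `|zeta k w| <= a k.
Hypothesis a_le : forall k, a k <= delta.
Hypothesis delta_le1 : delta <= 1.
Hypothesis beta_ge0 : forall k, 0 <= beta k.
Hypothesis zeta_mean0 : forall k, \int[P]_w zeta k w = 0.
Hypothesis zeta_mixing1 : forall k i (g : R * R -> R) K, (i < k)%N ->
  0 < K -> bmeas g -> (forall u z, `|z| <= a i -> `|g (u, z)| <= K) ->
  `|\int[P]_w (zeta k w * g (W i w, zeta i w))| <= a k * K * beta (k - i).
Hypothesis zeta_mixing2 : forall k i j (g : R -> R), (j <= i <= k)%N ->
  bmeas g -> (forall u, `|g u| <= 1) ->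
  `|\int[P]_w (zeta k w * zeta i w * g (W j w)) -
    (\int[P]_w (zeta k w * zeta i w)) * \int[P]_w g (W j w)| <=
  3 * a k * a i * beta (i - j).+1.

Let S k w := sin (W k w + alpha).
Let C k w := cos (W k w + alpha).
Let x k := \int[P]_w C k w.
Let r k i := \int[P]_w (zeta k w * zeta i w).
(** [b l] is the error per pair at lag [l]. Up to lag [p] a covariance term is extracted at cost
    [D]: [q] Lipschitz steps back, decoupling over the gap [q.+1], at most [p + q] steps forward,
    and one more [delta] for linearizing the sine. Beyond [p] the pair is bounded by mixing
    alone. *)
Let D := (p + q + q).+1%:R * delta + 3 * beta q.+1.
Let b l := if (l <= p)%N then D else beta l.
Let c k := r k k + 2 * \sum_(i < k | (k - i <= p)%N) r k i.

Let a_ge0 k : 0 <= a k.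
Proof. exact: le_trans (zeta_le k point). Qed.

Let delta_ge0 : 0 <= delta.
Proof. exact: le_trans (a_le 0%N). Qed.

Let bz k : bmeas (zeta k).
Proof. exact: bmeas_le (zeta_le k). Qed.

Let bW k : bmeas (W k).
Proof. by apply: bmeas_sum. Qed.

Let bC k : bmeas (C k).
Proof. by apply: bmeas_cos; apply: (bmeasD (bW k) (bmeas_cst _ alpha)).1. Qed.

Let bS k : bmeas (S k).
Proof. by apply: bmeas_sin; apply: (bmeasD (bW k) (bmeas_cst _ alpha)).1. Qed.

Let WS k w : W k.+1 w = W k w + zeta k w.
Proof. by rewrite /W big_ord_recr. Qed.

Let W_lip j k w : (j <= k)%N -> `|W k w - W j w| <= (k - j)%:R * delta.
Proof.
elim: k => [|k IH].
  by rewrite leqn0 => /eqP ->; rewrite subrr normr0 mul0r.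
rewrite leq_eqVlt => /predU1P[->|]; first by rewrite subrr normr0 subnn mul0r.
rewrite ltnS => jk; rewrite WS addrAC subSn//.
apply: (le_trans (ler_normD _ _)); rewrite mulrSr mulrDl mul1r.
by apply: lerD; [exact: IH|exact: le_trans (zeta_le k w) (a_le k)].
Qed.

Let C_lip j k w : (j <= k)%N -> `|C k w - C j w| <= (k - j)%:R * delta.
Proof.
move=> jk; rewrite /C; have := cos_lip (W j w + alpha) (W k w - W j w).
rewrite (_ : W j w + alpha + (W k w - W j w) = W k w + alpha); last by ring.
by move=> /le_trans; apply; exact: W_lip.
Qed.

Let x_lip j k : (j <= k)%N -> `|x k - x j| <= (k - j)%:R * delta.
Proof.
move=> jk; rewrite -ExB//; apply: Ex_bound; first exact: (bmeasB (bC k) (bC j)).1.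
by move=> w; exact: C_lip.
Qed.

Let r_le k i : `|r k i| <= a k * a i.
Proof.
apply: Ex_bound; first exact: (bmeasM (bz k) (bz i)).1.
by move=> w; rewrite normrM ler_pM.
Qed.

(** [W i] is too close to [zeta i] to be decoupled from it. It is replaced by [W j], [q] steps
    earlier, where mixing splits off the covariance; then [x j] is moved to [x k]. *)
Let pair_step k i : (i <= k)%N -> (k - i <= p)%N ->
  `|\int[P]_w (zeta k w * zeta i w * C i w) - r k i * x k| <=
  a k * a i * ((p + q + q)%:R * delta + 3 * beta q.+1).
Proof.
move=> ik kip; pose j := (i - q)%N.
have ji : (j <= i)%N by exact: leq_subr.
have bzz := bmeasM (bz k) (bz i).
have aa := mulr_ge0 (a_ge0 k) (a_ge0 i).
have s1 : `|\int[P]_w (zeta k w * zeta i w * C i w) -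
            \int[P]_w (zeta k w * zeta i w * C j w)| <= a k * a i * (q%:R * delta).
  rewrite -ExB; [|exact: bmeasM|exact: bmeasM].
  apply: Ex_bound => [|w].
    by apply: (bmeasB _ _).1; exact: bmeasM.
  rewrite -mulrBr normrM ler_pM//; first by rewrite normrM ler_pM.
  apply: (le_trans (C_lip w ji)); rewrite ler_wpM2r// ler_nat /j.
  by rewrite leq_subCl.
have s2 : `|\int[P]_w (zeta k w * zeta i w * C j w) - r k i * x j| <=
    a k * a i * (3 * beta q.+1).
  (* Here truncated subtraction gives [j = 0], where [C j] is the constant [cos alpha] and the
     splitting is exact. *)
  have [iq|qi] := leqP i q.
    have j0 : j = 0%N by apply/eqP; rewrite subn_eq0.
    have CE w : C j w = cos alpha by rewrite /C j0 /W big_ord0 add0r.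
    rewrite /x; under eq_Rintegral do rewrite CE.
    under [X in _ - r k i * X]eq_Rintegral do rewrite CE.
    by rewrite Ex_cst ExZr// subrr normr0 mulr_ge0// mulr_ge0.
  have := zeta_mixing2 (k := k) (i := i) (j := j) (g := fun u => cos (u + alpha)).
  rewrite ji ik /j subKn//; last exact: ltnW.
  rewrite (_ : 3 * a k * a i * beta q.+1 = a k * a i * (3 * beta q.+1)); last by ring.
  apply => // [|u]; last exact: cos_max.
  by apply: bmeas_cos; apply: measurable_funD => //; exact: measurable_cst.
have s3 : `|r k i * x j - r k i * x k| <= a k * a i * ((p + q)%:R * delta).
  rewrite -mulrBr normrM ler_pM// distrC.
  apply: (le_trans (x_lip (leq_trans ji ik))); rewrite ler_wpM2r// ler_nat /j.
  by lia.
set A := Rintegral _ _ _ in s1 *; set B := Rintegral _ _ _ in s1 s2.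
rewrite (_ : A - r k i * x k =
  (A - B) + (B - r k i * x j) + (r k i * x j - r k i * x k)); last by ring.
apply: (le_trans (ler_normD _ _)).
apply: (le_trans (lerD (le_trans (ler_normD _ _) (lerD s1 s2)) s3)).
by rewrite -!mulrDr ler_wpM2l// !natrD; lra.
Qed.

(** At short lags the increment of the sine is [zeta i * C i] to first order, and [pair_step]
    applies. At long lags the increment is only used as a function of the past bounded by [a i]. *)
Let sin_step k i : (i < k)%N ->
  `|\int[P]_w (zeta k w * (S i.+1 w - S i w)) - (k - i <= p)%N%:R * (r k i * x k)|
  <= a k * a i * b (k - i).
Proof.
move=> ik; have aa := mulr_ge0 (a_ge0 k) (a_ge0 i).
rewrite /b; case: ifPn => kip; last first.
  rewrite mul0r subr0.
  (* [zeta_mixing1] is applied with [K = a i] and requires [0 < K]. *)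
  have [ai0|ai0] := eqVneq (a i) 0.
    have E w : zeta k w * (S i.+1 w - S i w) = 0.
      rewrite /S WS (_ : zeta i w = 0) ?addr0 ?subrr ?mulr0//.
      by apply/eqP; rewrite -normr_le0 -ai0.
    by under eq_Rintegral do rewrite E; rewrite Ex_cst normr0 mulr_ge0.
  have := zeta_mixing1 (k := k) (i := i) (K := a i)
    (g := fun z => sin (z.1 + z.2 + alpha) - sin (z.1 + alpha)) ik.
  rewrite /S/=; under eq_Rintegral do rewrite -WS.
  apply.
  - by rewrite lt_neqAle eq_sym ai0 a_ge0.
  - have mD (e : R * R -> R) : measurable_fun setT e ->
        measurable_fun setT (fun z => e z + alpha).
      by move=> me; apply: measurable_funD => //; exact: measurable_cst.
    apply: bmeasB; apply: bmeas_sin; apply: mD => //.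
    exact: measurable_funD.
  - move=> u z zi; rewrite -addrA [z + _]addrC addrA.
    exact: (le_trans (sin_lip _ _)).
rewrite mul1r.
have s1 : `|\int[P]_w (zeta k w * (S i.+1 w - S i w)) -
    \int[P]_w (zeta k w * zeta i w * C i w)| <= a k * a i * delta.
  rewrite -ExB; last 2 first.
  - by apply: bmeasM => //; exact: bmeasB.
  - by apply: bmeasM => //; exact: bmeasM.
  apply: Ex_bound => [|w].
    apply: (bmeasB _ _).1; first by apply: bmeasM => //; exact: bmeasB.
    by apply: bmeasM => //; exact: bmeasM.
  rewrite -mulrA -mulrBr normrM -mulrA ler_pM//.
  rewrite /S /C WS (addrAC (W i w) (zeta i w) alpha).
  have z1 : `|zeta i w| <= 1.
    by apply: (le_trans (zeta_le i w)); exact: le_trans (a_le i) _.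
  apply: (le_trans (sin_taylor1 _ z1)); rewrite expr2 ler_pM//.
  exact: le_trans (zeta_le i w) (a_le i).
have s2 := pair_step (ltnW ik) kip.
set A := Rintegral _ _ _ in s1 *; set B := Rintegral _ _ _ in s1 s2.
rewrite (_ : A - _ = (A - B) + (B - r k i * x k)); last by ring.
apply: (le_trans (ler_normD _ _)); apply: (le_trans (lerD s1 s2)).
by rewrite -!mulrDr ler_wpM2l// /D -natr1; lra.
Qed.

(** A discrete form of [x' = - c x / 2]. In the second-order expansion of the cosine, the quadratic
    term gives the variance; the linear term, telescoped into earlier increments, gives the
    covariances at lags up to [p]. *)
Lemma clt_step k : `|x k.+1 - x k + 2^-1 * c k * x k| <=
  delta * a k ^+ 2 + \sum_(i < k.+1) a k * a i * b (k - i).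
Proof.
have z1 w : `|zeta k w| <= 1.
  by apply: (le_trans (zeta_le k w)); exact: le_trans (a_le k) _.
pose t0 := \int[P]_w (C k.+1 w - C k w + zeta k w * S k w +
   zeta k w * zeta k w * C k w * 2^-1).
pose t1 := \int[P]_w (zeta k w * S k w).
pose t2 := \int[P]_w (zeta k w * zeta k w * C k w).
have bzS : bmeas (fun w => zeta k w * S k w) by exact: bmeasM.
have bzzC : bmeas (fun w => zeta k w * zeta k w * C k w).
  by apply: bmeasM => //; exact: bmeasM.
have bCC := bmeasB (bC k.+1) (bC k).
have bzzC2 : bmeas (fun w => zeta k w * zeta k w * C k w * 2^-1).
  by apply: bmeasM => //; exact: bmeas_cst.
have t0E : t0 = x k.+1 - x k + t1 + 2^-1 * t2.
  rewrite /t0 ExD//; last exact: bmeasD.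
  by rewrite ExD// ExB// ExZr// [_ * t2]mulrC.
have t0_le : `|t0| <= delta * a k ^+ 2.
  apply: Ex_bound => [|w]; first exact: (bmeasD (bmeasD bCC bzS) bzzC2).1.
  have := cos_taylor2 (W k w + alpha) (z1 w).
  rewrite expr2 (mulrAC (zeta k w * zeta k w)) (addrAC (W k w) alpha) -WS.
  move=> /le_trans; apply; rewrite exprS ler_pM// ?exprn_ge0//.
    exact: le_trans (zeta_le k w) (a_le k).
  by rewrite lerXn2r ?nnegrE.
have t1E : t1 = \sum_(i < k) \int[P]_w (zeta k w * (S i.+1 w - S i w)).
  rewrite -Ex_sum; last first.
    by move=> i; apply: bmeasM => //; exact: bmeasB.
  (* Telescoping down to time 0 leaves the constant [sin alpha], which the mean 0 of [zeta k]
     removes. *)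
  have SE w : S k w = sin alpha + \sum_(i < k) (S i.+1 w - S i w).
    rewrite -(big_mkord xpredT (fun i => S i.+1 w - S i w)) telescope_sumr//.
    by rewrite addrC (_ : sin alpha = S 0 w) ?subrK// /S /W big_ord0 add0r.
  rewrite /t1; under eq_Rintegral do rewrite SE mulrDr mulr_sumr.
  rewrite ExD; last 2 first.
  - by apply: bmeasM => //; exact: bmeas_cst.
  - by apply: bmeas_sum => i; apply: bmeasM => //; exact: bmeasB.
  by rewrite ExZr// zeta_mean0 mul0r add0r.
have t1_le : `|t1 - \sum_(i < k) (k - i <= p)%N%:R * (r k i * x k)| <=
    \sum_(i < k) a k * a i * b (k - i).
  rewrite t1E -sumrB; apply: (le_trans (ler_norm_sum _ _ _)).
  by apply: ler_sum => i _; exact: sin_step.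
have t2_le : `|t2 - r k k * x k| <= 2 * (a k * a k * b (k - k)).
  have := @pair_step k k (leqnn k); rewrite subnn => /(_ isT) /le_trans; apply.
  rewrite /b /= mulrCA ler_wpM2l ?mulr_ge0// /D -natr1.
  have := beta_ge0 q.+1; have := mulr_ge0 (ler0n R (p + q + q)) delta_ge0.
  have := delta_ge0; lra.
have cE : c k * x k = r k k * x k +
    2 * \sum_(i < k) (k - i <= p)%N%:R * (r k i * x k).
  rewrite /c mulrDl; congr (_ + _); rewrite -mulrA; congr (_ * _).
  rewrite big_mkcond mulr_suml; apply: eq_bigr => i _.
  by case: ifP => _; rewrite ?mul1r ?mul0r.
rewrite big_ord_recr/= -mulrA cE.
move: t1_le t2_le t0_le; rewrite t0E.
move: (\sum_(i < k) _) (\sum_(i < k) _) (a k * a k * b (k - k)) (r k k * x k)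
  (delta * a k ^+ 2) => u1 u2 u3 u4 u5.
rewrite !ler_norml => /andP[? ?] /andP[? ?] /andP[? ?].
apply/andP; split; lra.
Qed.

(** The integrating factor [expR (v k / 2)] compensates the decay found in [clt_step], so [z] stays
    near its initial value [cos alpha]. [Delta] stands for a variance increment with a known sum, in
    place of the truncated [c]. As [Delta] may be negative, [Vm] has to bound all its partial
    sums. *)
Lemma clt_bound (N : nat) (Delta : nat -> R) (Vm : R) :
  (forall k, (k < N)%N -> `|Delta k| <= 1) ->
  (forall k, (k <= N)%N -> \sum_(i < k) Delta i <= Vm) ->
  `|expR ((\sum_(i < N) Delta i) / 2) * x N - cos alpha| <=
  expR (Vm / 2) * ((\sum_(k < N) a k ^+ 2) * (delta + \sum_(l < N) b l) +
    \sum_(k < N) `|c k - Delta k| + \sum_(k < N) Delta k ^+ 2).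
Proof.
move=> Delta1 Vm_ub.
pose v k := \sum_(i < k) Delta i.
pose z k := expR (v k / 2) * x k.
have x1 k : `|x k| <= 1.
  by apply: Ex_bound; [exact: (bC k).1|move=> w; exact: cos_max].
have b0 l : 0 <= b l.
  by rewrite /b; case: ifP => // _; rewrite addr_ge0 ?mulr_ge0.
have z0 : z 0%N = cos alpha.
  rewrite /z /v big_ord0 mul0r expR0 mul1r /x.
  under eq_Rintegral do rewrite /C /W big_ord0 add0r.
  by rewrite Ex_cst.
pose e k := delta * a k ^+ 2 + \sum_(i < k.+1) a k * a i * b (k - i) +
  `|c k - Delta k| + Delta k ^+ 2.
have step k : (k < N)%N -> `|z k.+1 - z k| <= expR (Vm / 2) * e k.
  move=> kN.
  have -> : z k.+1 - z k = expR (v k.+1 / 2) *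
      ((x k.+1 - x k + 2^-1 * c k * x k) - 2^-1 * (c k - Delta k) * x k -
       (expR (- (Delta k / 2)) - 1 + Delta k / 2) * x k).
    rewrite [X in _ = _ * X](_ : _ = x k.+1 - expR (- (Delta k / 2)) * x k); last by field.
    rewrite mulrBr mulrA -expRD /z; congr (_ - expR _ * _).
    by rewrite /v big_ord_recr/=; field.
  rewrite normrM ger0_norm ?expR_ge0// ler_pM ?expR_ge0//.
    by rewrite ler_expR ler_pM2r//; exact: Vm_ub.
  have D2 : `|Delta k / 2| <= 2^-1.
    by rewrite normrM [X in _ * X]ger0_norm// ler_piMl//; exact: Delta1.
  have h1 := clt_step k.
  have h2 : `|2^-1 * (c k - Delta k) * x k| <= `|c k - Delta k|.
    rewrite -mulrA normrM [X in X * _]ger0_norm// normrM.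
    have := ler_piMr (normr_ge0 (c k - Delta k)) (x1 k).
    have := mulr_ge0 (normr_ge0 (c k - Delta k)) (normr_ge0 (x k)); lra.
  have h3 : `|(expR (- (Delta k / 2)) - 1 + Delta k / 2) * x k| <= Delta k ^+ 2.
    rewrite normrM; apply: (le_trans (ler_piMr _ (x1 k))) => //.
    apply: (le_trans (expR_taylor1 D2)); rewrite expr_div_n.
    have := sqr_ge0 (Delta k); rewrite (_ : 2 ^+ 2 = 4 :> R); first lra.
    by ring.
  rewrite /e; apply: (le_trans (ler_normB _ _)); apply: lerD => //.
  by apply: (le_trans (ler_normB _ _)); exact: lerD.
rewrite -z0 -/(v N) -/(z N).
rewrite -(telescope_sumr z (leq0n N)) big_mkord.
apply: (le_trans (ler_norm_sum _ _ _)).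
apply: (@le_trans _ _ (\sum_(k < N) expR (Vm / 2) * e k)).
  by apply: ler_sum => k _; exact: step.
rewrite -mulr_sumr ler_wpM2l ?expR_ge0// /e !big_split/= !lerD2r.
rewrite -mulr_sumr mulrDr [_ * delta]mulrC lerD2l [leRHS]mulrC.
exact: sum_conv_le.
Qed.

End clt_bound.

(** * The Gaussian characteristic function *)

Section gaussian.
Context (R : realType) (s : R).
Hypothesis s0 : 0 < s.
Notation mu := (@lebesgue_measure R).
Local Notation p := (normal_pdf 0 s).

Let sN0 : s != 0. Proof. exact: lt0r_neq0. Qed.

Lemma normal_pdf0E x : p x = normal_peak s * expR (- (2 * s ^+ 2)^-1 * (x * x)).
Proof.
rewrite normal_pdfE// /normal_fun subr0; congr (_ * expR _).
by rewrite mulrC expr2 mulrN mulNr; congr (- (_^-1 * _)); rewrite -mulr_natl.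
Qed.

Lemma is_derive_normal_pdf x : is_derive x (1 : R) p (- (x / s ^+ 2) * p x).
Proof.
rewrite (_ : p = fun x => normal_peak s * expR (- (2 * s ^+ 2)^-1 * (x * x))); last first.
  by apply/funext => y; exact: normal_pdf0E.
pose c := - (2 * s ^+ 2)^-1.
have h1 := is_deriveM (is_derive_id x (1 : R)) (is_derive_id x (1 : R)).
have h2 := is_deriveM (is_derive_cst c x (1 : R)) h1.
have h3 := is_derive1_comp (is_derive_expR _) h2.
have h4 := is_deriveM (is_derive_cst (normal_peak s) x (1 : R)) h3.
apply: (is_derive_eq h4).
rewrite !scaler0 !addr0 /GRing.scale/= /cst /c !fctE/=.
by field.
Qed.

Lemma normal_pdfE' m x :
  normal_pdf m s x = normal_peak s * expR (- ((x - m) ^+ 2 / (2 * s ^+ 2))).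
Proof.
rewrite normal_pdfE// /normal_fun; congr (_ * expR _).
by rewrite mulNr -(mulr_natl (s ^+ 2)).
Qed.

Lemma normal_peak_double : normal_peak s = 2 * normal_peak (2 * s).
Proof.
rewrite /normal_peak (_ : (2 * s) ^+ 2 * pi *+ 2 = 2 ^+ 2 * (s ^+ 2 * pi *+ 2)).
  by rewrite sqrtrM ?sqr_ge0// sqrtr_sqr ger0_norm// invfM mulrA divff// mul1r.
by rewrite exprMn -mulrA mulrnAr.
Qed.

(* From [y exp (- y) <= 1]; it gives both the integrability of [x ^+ 2] and the
   concentration of the normal law around its mean as [s] tends to [0]. *)
Lemma sqr_normal_pdf_le m x :
  (x - m) ^+ 2 * normal_pdf m s x <= 6 * s ^+ 2 * normal_pdf m (2 * s) x.
Proof.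
have s20 : 2 * s != 0 by rewrite mulf_neq0.
rewrite normal_pdfE' normal_pdfE// /normal_fun normal_peak_double.
set y := (x - m) ^+ 2.
rewrite (_ : - y / ((2 * s) ^+ 2 *+ 2) = - (y / (8 * s ^+ 2))); last first.
  by rewrite mulNr; congr (- (_ / _)); rewrite -(mulr_natl ((2 * s) ^+ 2)); ring.
(* One quarter of the exponent is the density of deviation [2 s]; the other three absorb [y],
   leaving [8/3 s^2]. The ratio 2 of the peaks gives [16/3 <= 6]. *)
rewrite (_ : y / (2 * s ^+ 2) = y / (8 * s ^+ 2) + 3 * y / (8 * s ^+ 2)); last by field.
rewrite opprD expRD.
have : y * expR (- (3 * y / (8 * s ^+ 2))) <= 8 / 3 * s ^+ 2.
  have := expR_ge1Dx (3 * y / (8 * s ^+ 2)) => h.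
  rewrite expRN ler_pdivrMr ?expR_gt0//.
  apply: (@le_trans _ _ (8 / 3 * s ^+ 2 * (3 * y / (8 * s ^+ 2)))); last first.
    by rewrite ler_pM2l ?mulr_gt0 ?exprn_gt0//; lra.
  by rewrite le_eqVlt; apply/orP; left; apply/eqP; field.
have := normal_peak_ge0 (2 * s); have := expR_ge0 (- (y / (8 * s ^+ 2))).
set u := expR _; set v := expR _; set k := normal_peak _ => u0 k0 h.
rewrite [leLHS](_ : _ = 2 * (k * u) * (y * v)); last by ring.
apply: (@le_trans _ _ (2 * (k * u) * (8 / 3 * s ^+ 2))).
  by rewrite ler_wpM2l// !mulr_ge0.
have ku : 0 <= k * u by rewrite mulr_ge0.
have := mulr_ge0 ku (sqr_ge0 s); lra.
Qed.

End gaussian.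

Section normal_expectation.
Context (R : realType).
Notation mu := (@lebesgue_measure R).

Lemma bmeas_normal_integrable m s (g : R -> R) : bmeas g ->
  mu.-integrable setT (fun x => (g x * normal_pdf m s x)%:E).
Proof.
move=> [mg [M gM]].
have i1 := integrable_normal_pdf m s.
apply: (@le_integrable _ _ _ mu setT measurableT _ (fun x => (M * normal_pdf m s x)%:E)) => //.
- apply/measurable_EFinP; apply: measurable_funM => //.
  exact: measurable_normal_pdf.
- move=> x _ /=; rewrite lee_fin !normrM (ger0_norm (normal_pdf_ge0 _ _ _)).
  by rewrite ler_wpM2r ?normal_pdf_ge0// (le_trans (gM x))// ler_norm.
- by under eq_fun do rewrite EFinM; exact: integrableZl.
Qed.

Lemma Ex_normal m s (g : R -> R) : bmeas g ->
  \int[normal_prob m s]_x g x = \int[mu]_x (g x * normal_pdf m s x).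
Proof.
move: g; apply: bmeas_induction.
- move=> g h bg bh Eg Eh; rewrite ExD// Eg Eh -RintegralD//.
  + by apply: eq_Rintegral => x _; rewrite mulrDl.
  + exact: bmeas_normal_integrable.
  + exact: bmeas_normal_integrable.
- move=> r g bg Eg; rewrite ExZl// Eg -RintegralZl//.
    by apply: eq_Rintegral => x _; rewrite mulrA.
  exact: bmeas_normal_integrable.
- move=> g_ g M bg_ g_M bg g_g E.
  have c1 : \int[normal_prob m s]_x g_ n x @[n --> \oo] --> \int[normal_prob m s]_x g x.
    by apply: (Ex_cvg (M := M)) => //; [move=> n; exact: (bg_ n).1|exact: bg.1].
  have [|||||_ _ c2] := @dominated_convergence _ _ R mu setT measurableT
    (fun n x => (g_ n x * normal_pdf m s x)%:E)
    (fun x => (g x * normal_pdf m s x)%:E) (fun x => (M * normal_pdf m s x)%:E).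
  + move=> n; apply: (measurable_int mu); exact: bmeas_normal_integrable.
  + by apply: (measurable_int mu); exact: bmeas_normal_integrable.
  + apply: aeW => x _; apply: cvg_EFin; first exact: nearW.
    by apply: cvgM; [exact: g_g|exact: cvg_cst].
  + under eq_fun do rewrite EFinM; apply: integrableZl => //.
    exact: integrable_normal_pdf.
  + apply: aeW => x n _ /=; rewrite lee_fin normrM (ger0_norm (normal_pdf_ge0 _ _ _)).
    by rewrite ler_wpM2r ?normal_pdf_ge0.
  have c3 : \int[mu]_x (g_ n x * normal_pdf m s x) @[n --> \oo] -->
      \int[mu]_x (g x * normal_pdf m s x).
    apply: fine_cvg; rewrite /Rintegral fineK; first exact: c2.
    by apply: integrable_fin_num => //; exact: bmeas_normal_integrable.
  rewrite -(cvg_lim (@Rhausdorff R) c1) -(cvg_lim (@Rhausdorff R) c3).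
  by congr (lim (_ @ \oo)); apply/funext.
- move=> A mA; rewrite Ex_indic// /Rintegral; congr fine.
  rewrite /normal_prob [LHS]integral_mkcond; apply: eq_integral => x _.
  by rewrite patchE indicE; case: (x \in A); rewrite ?mul1r ?mul0r.
Qed.

End normal_expectation.

(** Differentiation under the integral sign: a pointwise quadratic error bound can be integrated,
    and yields the derivative of the integral. *)
Lemma is_derive_quadratic (R : realType) (f : R -> R) (x l K : R) :
  (forall h, `|f (x + h) - f x - h * l| <= K * h ^+ 2) -> is_derive x 1 f l.
Proof.
move=> fK.
have K0 : 0 <= K by have := fK 1; rewrite expr1n mulr1; exact: le_trans.
have c : h^-1 *: (f (h *: 1 + x) - f x) @[h --> 0^'] --> l.
  apply/cvgrPdist_le => e e0.
  have K1 : 0 < K + 1 by lra.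
  near=> h.
  have h0 : h != 0 by near: h; exact: nbhs_dnbhs_neq.
  have he : `|h| <= e / (K + 1).
    near: h; apply: dnbhs0_le; exact: divr_gt0.
  rewrite distrC (_ : _ *: 1 = h); last by rewrite -[RHS]mulr1.
  rewrite (_ : _ - l = h^-1 * (f (x + h) - f x - h * l)); last first.
    by rewrite /GRing.scale/= [h + x]addrC; field.
  rewrite normrM normfV mulrC ler_pdivrMr ?normr_gt0//.
  apply: (le_trans (fK h)); rewrite -(real_normK (num_real h)) expr2 mulrA.
  rewrite ler_wpM2r//; move: he; rewrite ler_pdivlMr// mulrC => he.
  by apply: le_trans he; rewrite mulrDl mul1r lerDl.
apply: DeriveDef; first by apply/cvg_ex; exists l.
exact: (cvg_lim (@Rhausdorff R) c).
Unshelve. all: end_near.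
Qed.

(** Unlike [cos_taylor2], this asks no smallness of [h]: it is used at [h * x] with [x] ranging over
    the whole line. *)
Lemma cos_taylor1 (R : realType) (u h : R) :
  `|cos (u + h) - cos u + h * sin u| <= 2 * h ^+ 2.
Proof.
rewrite cosD [X in `|X|](_ : _ = - (cos u * (1 - cos h)) - sin u * (sin h - h)); last by ring.
apply: (le_trans (ler_normB _ _)); rewrite normrN !normrM.
have c1 := cos_max u; have s1 := sin_max u.
have a2 := onem_cos_le h.
have a1 : `|sin h - h| <= h ^+ 2.
  have [h2|h2] := leP `|h| 2.
    apply: (le_trans (sin_sub_id_le h)).
    rewrite -(real_normK (num_real h)); have := sqr_ge0 `|h|.
    rewrite (_ : `|h| ^+ 3 = `|h| * `|h| ^+ 2); last by rewrite -exprS.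
    by move=> /(ler_wpM2r)/(_ _ _ h2); lra.
  apply: (le_trans (ler_normB _ _)); have := norm_sin_le h.
  rewrite -(real_normK (num_real h)) expr2.
  have : 0 <= `|h| * (`|h| - 2) by rewrite mulr_ge0//; lra.
  lra.
have b1 : `|cos u| * `|1 - cos h| <= 1 * (h ^+ 2 / 2) by exact: ler_pM.
have b2 : `|sin u| * `|sin h - h| <= 1 * h ^+ 2 by exact: ler_pM.
have := sqr_ge0 h; lra.
Qed.

(** * The Fourier transform of the normal density by integration by parts *)

Section gaussian_fourier.
Context (R : realType) (s : R).
Hypothesis s0 : 0 < s.
Notation mu := (@lebesgue_measure R).
Local Notation p := (normal_pdf 0 s).

Lemma integrable_poly_normal (h : R -> R) K : measurable_fun setT h ->
  (forall x, `|h x| <= K * (1 + x ^+ 2)) ->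
  mu.-integrable setT (fun x => (h x * p x)%:E).
Proof.
move=> mh hK.
apply: (@le_integrable _ _ _ mu setT measurableT _
  (fun x => (K * p x + K * (6 * s ^+ 2) * normal_pdf 0 (2 * s) x)%:E)) => //.
- apply/measurable_EFinP; apply: measurable_funM => //.
  exact: measurable_normal_pdf.
- move=> x _ /=; rewrite lee_fin normrM (ger0_norm (normal_pdf_ge0 _ _ _)).
  apply: le_trans (ler_norm _).
  apply: (le_trans (ler_wpM2r (normal_pdf_ge0 _ _ _) (hK x))).
  have K0 : 0 <= K.
    have := le_trans (normr_ge0 _) (hK 0).
    by rewrite expr0n/= addr0 mulr1.
  have := sqr_normal_pdf_le s0 0 x; rewrite subr0 => h1.
  have := ler_wpM2l K0 h1; move: (p x) (normal_pdf _ _ x) => y z; lra.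
- rewrite (_ : (fun x => _) = (fun x => (K%:E * (p x)%:E) +
      ((K * (6 * s ^+ 2))%:E * (normal_pdf 0 (2 * s) x)%:E))%E); last first.
    by apply/funext => x; rewrite EFinD !EFinM.
  apply: integrableD => //.
  + by apply: integrableZl => //; exact: integrable_normal_pdf.
  + by apply: integrableZl => //; exact: integrable_normal_pdf.
Qed.

Variable alpha : R.
Let G t := \int[mu]_x (cos (t * x + alpha) * p x).

Let mlin (t : R) : measurable_fun setT (fun x : R => t * x + alpha).
Proof. by apply: measurable_funD => //; exact: measurable_funM. Qed.

Let sqr_ge (x : R) : `|x| <= 1 + x ^+ 2.
Proof.
rewrite -(real_normK (num_real x)); have := sqr_ge0 (`|x| - 1).
have := normr_ge0 x; rewrite sqrrB; lra.
Qed.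

Let icos t : mu.-integrable setT (fun x => (cos (t * x + alpha) * p x)%:E).
Proof. by apply: bmeas_normal_integrable; exact: bmeas_cos. Qed.

Let ixsin t : mu.-integrable setT (fun x => (x * sin (t * x + alpha) * p x)%:E).
Proof.
apply: (@integrable_poly_normal _ 1) => [|x].
  by apply: measurable_funM => //; exact: (bmeas_sin (mlin t)).1.
rewrite mul1r normrM; apply: le_trans (sqr_ge x).
by rewrite ler_piMr// sin_max.
Qed.

Let ixx : mu.-integrable setT (fun x => (x ^+ 2 * p x)%:E).
Proof.
apply: (@integrable_poly_normal _ 1) => [|x]; first exact: measurable_funX.
by rewrite ger0_norm ?sqr_ge0// mul1r lerDr.
Qed.

(** The antiderivative behind Stein's identity: since [p' = - x p / s^2], the derivative of [U t] is
    [u t], and both integrals to be compared appear in it. *)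
Let U t x := sin (t * x + alpha) * p x.
Let u t x := t * (cos (t * x + alpha) * p x) -
  (s ^+ 2)^-1 * (x * sin (t * x + alpha) * p x).

Let is_derive_U t x : is_derive x (1 : R) (U t) (u t x).
Proof.
have h1 := is_deriveM (is_derive_cst t x (1 : R)) (is_derive_id x (1 : R)).
have h2 := is_deriveD h1 (is_derive_cst alpha x (1 : R)).
have h3 := is_derive1_comp (is_derive_sin _) h2.
have h4 := is_deriveM h3 (is_derive_normal_pdf s0 x).
apply: (is_derive_eq h4).
rewrite !scaler0 !addr0 /GRing.scale/= /cst /u !fctE/=.
by field; exact: lt0r_neq0.
Qed.

Let U_le t (x : R) : x != 0 -> `|U t x| <= 6 * s ^+ 2 * normal_peak (2 * s) / x ^+ 2.
Proof.
move=> x0; have x20 : 0 < x ^+ 2 by rewrite exprn_even_gt0.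
rewrite ler_pdivlMr// /U normrM (ger0_norm (normal_pdf_ge0 _ _ _)).
have := sqr_normal_pdf_le s0 0 x; rewrite subr0 => h1.
have h2 : normal_pdf 0 (2 * s) x <= normal_peak (2 * s).
  by apply: normal_pdf_ub; rewrite mulf_neq0// lt0r_neq0.
apply: (@le_trans _ _ (1 * (x ^+ 2 * p x))).
  rewrite -mulrA [p x * _]mulrC ler_wpM2r ?sin_max// mulr_ge0 ?normal_pdf_ge0//.
  exact: ltW.
by rewrite mul1r; apply: (le_trans h1); rewrite ler_wpM2l// mulr_ge0 ?sqr_ge0.
Qed.

Let U_cvg0 t : U t n.+1%:R - U t (- n.+1%:R) @[n --> \oo] --> (0 : R).
Proof.
set C := 6 * s ^+ 2 * normal_peak (2 * s).
have C0 : 0 <= C by rewrite mulr_ge0 ?normal_peak_ge0// mulr_ge0 ?sqr_ge0.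
have h : 2 * C * n.+1%:R^-1 @[n --> \oo] --> (0 : R).
  rewrite -[X in _ --> X](mulr0 (2 * C)); apply: cvgMr; exact: cvg_harmonic.
apply/cvgr0Pnorm_le => e e0.
move/cvgr0Pnorm_le : h => /(_ e e0); apply: filterS => n hn.
apply: le_trans hn; apply: le_trans (ler_norm _).
apply: (le_trans (ler_normB _ _)).
have n0 : n.+1%:R != 0 :> R by rewrite pnatr_eq0.
have b x : x ^+ 2 = n.+1%:R ^+ 2 -> x != 0 -> `|U t x| <= C * n.+1%:R^-1.
  move=> xE x0; apply: (le_trans (U_le t x0)); rewrite xE ler_wpM2l//.
  rewrite lef_pV2 ?posrE ?exprn_gt0// expr2 ler_peMl//.
  by rewrite ler1n.
rewrite -mulrA (_ : 2 * _ = C * n.+1%:R^-1 + C * n.+1%:R^-1); last by ring.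
by apply: lerD; apply: b; rewrite ?sqrrN// oppr_eq0.
Qed.

Let continuous_u t : continuous (u t).
Proof.
have cl : continuous (fun x : R => t * x + alpha).
  move=> x; apply: cvgD; last exact: cvg_cst.
  by apply: cvgM; [exact: cvg_cst|exact: cvg_id].
have cp : continuous p by apply: continuous_normal_pdf; exact: lt0r_neq0.
move=> x; apply: cvgB; (apply: cvgM; first exact: cvg_cst); apply: cvgM.
- by apply: continuous_comp; [exact: cl|exact: continuous_cos].
- exact: cp.
- apply: cvgM; first exact: cvg_id.
  by apply: continuous_comp; [exact: cl|exact: continuous_sin].
- exact: cp.
Qed.

Let iu t : mu.-integrable setT (EFin \o u t).
Proof.
rewrite (_ : _ \o _ = fun x => (t%:E * (cos (t * x + alpha) * p x)%:E -
  (s ^+ 2)^-1%:E * (x * sin (t * x + alpha) * p x)%:E)%E); last first.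
  by apply/funext => x; rewrite /= /u EFinB !EFinM.
by apply: integrableB => //; exact: integrableZl.
Qed.

Let integral_u (t : R) (n : nat) :
  \int[mu]_(x in `[- n.+1%:R, n.+1%:R]) u t x = U t n.+1%:R - U t (- n.+1%:R).
Proof.
rewrite /Rintegral (continuous_FTC2 (F := U t)) //.
- by rewrite -subr_gt0 opprK addr_gt0.
- exact: continuous_subspaceT.
- have cU : continuous (U t).
    by move=> x; apply: differentiable_continuous; apply/derivable1_diffP;
      case: (is_derive_U t x).
  split=> [x _||]; first by case: (is_derive_U t x).
  + exact/cvg_at_right_filter/cU.
  + exact/cvg_at_left_filter/cU.
- by move=> x _; rewrite derive1E; case: (is_derive_U t x).
Qed.

(** The integral of [u t] over a symmetric interval is a boundary term of [U t], which tends to 0;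
    hence its integral over the line is 0. *)
Let stein t : \int[mu]_x (x * sin (t * x + alpha) * p x) = s ^+ 2 * t * G t.
Proof.
pose D n : set R := [set` `[- (n.+1%:R : R), n.+1%:R]].
have [|||||_ _ c2] := @dominated_convergence _ _ R mu setT measurableT
  (fun n x => (u t x * \1_(D n) x)%:E) (fun x => (u t x)%:E) (fun x => `|u t x|%:E).
- move=> n; apply/measurable_EFinP; apply: measurable_funM.
    by apply/measurable_EFinP; exact: (measurable_int mu (iu t)).
  by apply: measurable_indic; exact: measurable_itv.
- exact: (measurable_int mu (iu t)).
- apply: aeW => x _; apply: cvg_EFin; first exact: nearW.
  rewrite -[X in _ --> X]mulr1; apply: cvgM; first exact: cvg_cst.
  apply: cvg_near_cst; near=> n; rewrite indicE mem_set// /D/= in_itv/= -ler_norml.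
  apply: (@le_trans _ _ n%:R); last by rewrite ler_nat.
  near: n; exact: nbhs_infty_ger.
- by apply: integrable_norm => //; exact: iu.
- apply: aeW => x n _ /=; rewrite lee_fin normrM ler_piMr//.
  by rewrite indicE normr_nat lern1 leq_b1.
have c3 : \int[mu]_(x in D n) u t x @[n --> \oo] --> \int[mu]_x u t x.
  apply: fine_cvg; rewrite /Rintegral fineK; last first.
    by apply: integrable_fin_num => //; exact: iu.
  apply: cvg_trans c2; apply: near_eq_cvg; apply: nearW => n /=.
  rewrite [RHS]integral_mkcond; apply: eq_integral => x _.
  by rewrite patchE indicE; case: (x \in D n); rewrite ?mulr1 ?mulr0.
have : \int[mu]_x u t x = 0.
  rewrite -(cvg_lim (@Rhausdorff R) c3) -(cvg_lim (@Rhausdorff R) (U_cvg0 t)).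
  by congr (lim (_ @ \oo)); apply/funext => n; rewrite /D integral_u.
rewrite /u RintegralB//; last 2 first.
- exact: (integrableZl measurableT t (icos t)).
- exact: (integrableZl measurableT (s ^+ 2)^-1 (ixsin t)).
rewrite (@RintegralZl _ _ _ mu setT (fun x => cos (t * x + alpha) * p x) t
  measurableT (icos t)).
rewrite (@RintegralZl _ _ _ mu setT (fun x => x * sin (t * x + alpha) * p x) _
  measurableT (ixsin t)).
rewrite -/(G t) => /eqP; rewrite subr_eq0 => /eqP E.
apply: (mulfI (x := (s ^+ 2)^-1)).
  by rewrite invr_eq0 expf_neq0// lt0r_neq0.
by rewrite -E; field; exact: lt0r_neq0.
Unshelve. all: end_near.
Qed.

(** The Taylor error is at most [2 h^2 x^2], integrable against [p]; the first-order term is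
    rewritten by Stein's identity, which closes a differential equation for [G]. *)
Let is_derive_G t : is_derive t (1 : R) G (- (s ^+ 2 * t * G t)).
Proof.
apply: (@is_derive_quadratic _ _ _ _ (2 * \int[mu]_x (x ^+ 2 * p x))) => h.
rewrite -stein mulrN opprK.
have i1 := icos (t + h); have i2 := icos t; have i3 := ixsin t.
have i4 : mu.-integrable setT
    (fun x => (cos ((t + h) * x + alpha) * p x - cos (t * x + alpha) * p x)%:E).
  by under eq_fun do rewrite EFinB; exact: integrableB.
have i5 : mu.-integrable setT (fun x => (h * (x * sin (t * x + alpha) * p x))%:E).
  by under eq_fun do rewrite EFinM; exact: integrableZl.
pose F x := cos ((t + h) * x + alpha) * p x - cos (t * x + alpha) * p x +
  h * (x * sin (t * x + alpha) * p x).
have i6 : mu.-integrable setT (EFin \o F).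
  rewrite (_ : _ \o _ = fun x => ((cos ((t + h) * x + alpha) * p x -
    cos (t * x + alpha) * p x)%:E + (h * (x * sin (t * x + alpha) * p x))%:E)%E)//.
  exact: integrableD.
have i7 : mu.-integrable setT (EFin \o (fun x => 2 * h ^+ 2 * (x ^+ 2 * p x))).
  exact: (integrableZl measurableT (2 * h ^+ 2) ixx).
rewrite (_ : _ + _ = \int[mu]_x F x); last first.
  by rewrite /F RintegralD// RintegralB// RintegralZl.
apply: (le_trans (le_normr_Rintegral _ i6)) => //.
rewrite mulrAC -RintegralZl//; apply: le_Rintegral => //.
  exact: (integrable_norm i6).
rewrite /F.
move=> x _; rewrite [X in `|X|](_ : _ = (cos ((t + h) * x + alpha) -
  cos (t * x + alpha) + h * x * sin (t * x + alpha)) * p x); last by ring.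
rewrite normrM (ger0_norm (normal_pdf_ge0 _ _ _)) [leRHS]mulrA.
rewrite ler_wpM2r ?normal_pdf_ge0//.
have := cos_taylor1 (t * x + alpha) (h * x).
rewrite (_ : t * x + alpha + h * x = (t + h) * x + alpha); last by ring.
by rewrite exprMn !mulrA.
Qed.

(** [G' = - s^2 t G], so [G] times [expR (s^2 t^2 / 2)] is constant, with value [cos alpha] at 0. *)
Lemma normal_pdf_fourier t : G t = expR (- (t ^+ 2 * s ^+ 2 / 2)) * cos alpha.
Proof.
pose H t := expR (s ^+ 2 / 2 * (t * t)) * G t.
have dH x : is_derive x (1 : R) H 0.
  have h1 := is_deriveM (is_derive_id x (1 : R)) (is_derive_id x (1 : R)).
  have h2 := is_deriveM (is_derive_cst (s ^+ 2 / 2) x (1 : R)) h1.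
  have h3 := is_derive1_comp (is_derive_expR _) h2.
  have h4 := is_deriveM h3 (is_derive_G x).
  apply: (is_derive_eq h4).
  rewrite !scaler0 !addr0 /GRing.scale/= /cst !fctE/=.
  by field.
have := is_derive_0_is_cst t 0 dH.
rewrite /H !mulr0 expR0 mul1r => E.
have G0 : G 0 = cos alpha.
  rewrite /G; under eq_Rintegral do rewrite mul0r add0r.
  rewrite RintegralZl//; last exact: integrable_normal_pdf.
  by rewrite /Rintegral integral_normal_pdf mulr1.
rewrite -G0 -E mulrA -expRD (_ : _ + _ = 0) ?expR0 ?mul1r//.
by ring.
Qed.

End gaussian_fourier.

(** * Convergence in distribution from cosine transforms *)

Lemma compact_support_unif_continuous (R : realType) (g : R -> R) (K e : R) :
  continuous g -> (forall x, K <= `|x| -> g x = 0) -> 0 < e ->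
  exists2 r, 0 < r & forall x y, `|y - x| < r -> `|g y - g x| <= e.
Proof.
move=> cg gK e0.
have [r r0 rP] : exists2 r, 0 < r &
    forall x y, `|x| <= K + 1 -> `|y - x| < r -> `|g y - g x| <= e.
  have cK : compact [set` `[- (K + 1), K + 1]] by exact: segment_compact.
  have /compact_near_coveringP nK := cK.
  have nr : \forall r \near 0^'+, [set` `[- (K + 1), K + 1]] `<=`
      (fun x => forall y, `|y - x| < r -> `|g y - g x| <= e).
    apply: (nK R 0^'+ (fun r x => forall y, `|y - x| < r -> `|g y - g x| <= e)) => x _.
    have /cvgrPdist_lt/(_ (e / 2)) gx : g z @[z --> x] --> g x by exact: cg.
    have e20 : 0 < e / 2 by rewrite divr_gt0.
    have /nbhs_ballP[r /= r0 xr] := gx e20.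
    exists ([set z | `|z - x| < r / 2], [set h | h < r / 2]) => /=.
      split.
        apply/nbhs_ballP; exists (r / 2); first exact: divr_gt0.
        by move=> z; rewrite /ball/= distrC.
      by apply: nbhs_right_lt; exact: divr_gt0.
    move=> [z h] /= [zx hr] y yz.
    have d1 : `|g x - g y| < e / 2.
      apply: xr; rewrite /ball/= distrC (_ : y - x = (y - z) + (z - x)); last by ring.
      apply: (le_lt_trans (ler_normD _ _)); rewrite (splitr r).
      by apply: ltrD => //; exact: lt_trans hr.
    have d2 : `|g x - g z| < e / 2.
      apply: xr; rewrite /ball/= distrC; apply: (lt_trans zx).
      by rewrite ltr_pdivrMr// ltr_pMr// ltr1n.
    rewrite (_ : g y - g z = (g x - g z) - (g x - g y)); last by ring.
    by rewrite ltW// (splitr e); apply: (le_lt_trans (ler_normB _ _)); exact: ltrD.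
  have [r [rK r0]] := filter_ex (filterI nr (nbhs_right_gt 0)).
  by exists r => // x y xK; apply: rK; rewrite /= in_itv/= -ler_norml.
(* The bound 1 keeps [y] outside the support when [|x|] exceeds [K + 1]. *)
exists (Num.min r 1); first by rewrite lt_min r0/=.
move=> x y; rewrite lt_min => /andP[yr y1].
have [xK|Kx] := leP `|x| (K + 1); first exact: rP.
rewrite !gK ?subrr ?normr0 ?ltW//; first lra.
have := ler_normD y (x - y); rewrite (_ : y + (x - y) = x); last by ring.
by rewrite (distrC x y) => /(lt_le_trans Kx); lra.
Qed.

Section levy.
Context d (T : measurableType d) (R : realType) (P : probability T R).
Variables (Z : nat -> T -> R) (mu : probability (measurableTypeR R) R).
Hypothesis mZ : forall n, measurable_fun setT (Z n).
Hypothesis Zcos : forall t alpha,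
  \int[P]_w cos (t * Z n w + alpha) @[n --> \oo] -->
  \int[mu]_x cos (t * x + alpha).

Lemma normal_kernel (b x : R) : 0 < b ->
  \int[normal_prob 0 b]_t cos (t * x) = expR (- (x ^+ 2 * b ^+ 2 / 2)).
Proof.
move=> b0; have bc : bmeas (fun t : R => cos (t * x)).
  by apply: bmeas_cos; exact: measurable_funM.
rewrite Ex_normal//.
have := normal_pdf_fourier b0 0 x; rewrite cos0 mulr1 => <-.
by apply: eq_Rintegral => t _; rewrite addr0 mulrC [t * x]mulrC mulrC.
Qed.

(** A normal density is a mixture of cosines whose frequencies are normal with deviation [s^-1];
    this is how cosine transforms determine smoothed expectations. *)
Lemma normal_pdf_kernel (s x a : R) : 0 < s ->
  normal_pdf x s a = normal_peak s * \int[normal_prob 0 s^-1]_t cos (t * (x - a)).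
Proof.
move=> s0; rewrite normal_kernel ?invr_gt0// normal_pdfE'//.
congr (_ * expR (- _)); rewrite -sqrrN opprB.
by field; exact: lt0r_neq0.
Qed.

(** After Fubini, the hypothesis [Zcos] gives convergence at each frequency [t], and dominated
    convergence integrates it over [nu]. *)
Lemma cvg_Ex_normal_pdf (s a : R) : 0 < s ->
  \int[P]_w normal_pdf (Z n w) s a @[n --> \oo] --> \int[mu]_x normal_pdf x s a.
Proof.
move=> s0; pose nu : probability (measurableTypeR R) R := normal_prob 0 s^-1.
have E d' (T' : measurableType d') (Q : probability T' R) (Y : T' -> R) :
    measurable_fun setT Y -> \int[Q]_w normal_pdf (Y w) s a =
    normal_peak s * \int[nu]_t \int[Q]_w cos (t * Y w + (- (t * a))).
  move=> mY.
  have bK : bmeas (fun z : T' * measurableTypeR R => cos (z.2 * (Y z.1 - a))).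
    apply: bmeas_cos; apply: measurable_funM => //.
    by apply: measurable_funB => //; exact: measurableT_comp.
  under eq_Rintegral do rewrite normal_pdf_kernel//.
  rewrite ExZl; last exact: (bmeas_Ex2 nu bK).
  rewrite (Ex_fubini Q nu bK); congr (_ * _); apply: eq_Rintegral => t _.
  by apply: eq_Rintegral => w _ /=; rewrite mulrBr.
under eq_fun do rewrite E//; rewrite (E _ _ mu id)//.
apply: cvgM; first exact: cvg_cst.
have bK d' (T' : measurableType d') (Y : T' -> R) : measurable_fun setT Y ->
    bmeas (fun z : T' * measurableTypeR R => cos (z.2 * Y z.1 - z.2 * a)).
  move=> mY; apply: bmeas_cos; apply: measurable_funB.
    by apply: measurable_funM => //; exact: measurableT_comp.
  by apply: measurable_funM.
apply: (Ex_cvg (M := 1)).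
- by move=> n; have [] := bmeas_Ex1 P (bK _ _ _ (mZ n)).
- by have [] := bmeas_Ex1 mu (bK _ (measurableTypeR R) id (@measurable_id _ _ _)).
- move=> n t; apply: Ex_bound => [|w]; last exact: cos_max.
  by have [] := bmeas_pair2 t (bK _ _ _ (mZ n)).
- by move=> t; exact: Zcos.
Qed.

Lemma bmeas_normal_pdf (s : R) d' (T' : measurableType d') (Y V : T' -> R) :
  0 < s -> measurable_fun setT Y -> measurable_fun setT V ->
  bmeas (fun w => normal_pdf (Y w) s (V w)).
Proof.
move=> s0 mY mV; apply: (bmeas_le (M := normal_peak s)) => [|z]; last first.
  by rewrite ger0_norm ?normal_pdf_ge0// normal_pdf_ub// lt0r_neq0.
under eq_fun do rewrite normal_pdfE'//.
apply: measurable_funM => //; apply: measurableT_comp => //.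
apply: measurableT_comp => //; apply: measurable_funM => //.
by apply: measurable_funX; apply: measurable_funB.
Qed.

(** * Gaussian smoothing of compactly supported functions *)

Section smoothing.
Variables (g : R -> R) (K : R).
Hypothesis bg : bmeas g.
Hypothesis gK : forall x, K <= `|x| -> g x = 0.
Let N01 : probability (measurableTypeR R) R := normal_prob 0 1.
(** Dividing by the standard normal density turns Lebesgue integrals of [g] into integrals for the
    probability [N01], where Fubini and dominated convergence for bounded functions apply. [psi] is
    bounded because [g] vanishes when [|a| >= K]. *)
Let psi (a : measurableTypeR R) := g a / normal_pdf 0 1 a.

Let pdf01_gt0 (a : R) : 0 < normal_pdf 0 1 a.
Proof. by rewrite normal_pdfE'// mulr_gt0 ?expR_gt0 ?normal_peak_gt0. Qed.

Let bpsi : bmeas psi.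
Proof.
have [mg [M gM]] := bg; have M0 : 0 <= M by exact: le_trans (gM 0).
have c0 := pdf01_gt0 K; set c := normal_pdf 0 1 K in c0.
apply: (bmeas_le (M := M / c)) => [|a].
  apply: measurable_funM => //.
  apply: (@measurable_comp _ _ _ _ _ _ [set r : R | r != 0]).
  + exact: open_measurable.
  + by move=> /= _ [x _ <-] /=; rewrite lt0r_neq0.
  + apply: open_continuous_measurable_fun => //; apply/in_setP => x /= x0.
    exact: inv_continuous.
  + exact: measurable_normal_pdf.
have [Ka|aK] := leP K `|a|; first by rewrite /psi gK// mul0r normr0 divr_ge0// ltW.
rewrite normrM ler_pM// normfV (ger0_norm (ltW (pdf01_gt0 a))).
rewrite lef_pV2 ?posrE//= /c !normal_pdfE'// ler_wpM2l ?normal_peak_ge0//.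
rewrite ler_expR lerN2 ler_pM2r// !subr0 -(real_normK (num_real a)).
by rewrite lerXn2r ?nnegrE// ltW// (le_lt_trans _ aK).
Qed.

Let bpdf (s : R) d' (T' : measurableType d') (Y : T' -> R) : 0 < s ->
  measurable_fun setT Y ->
  bmeas (fun z : T' * measurableTypeR R => psi z.2 * normal_pdf (Y z.1) s z.2).
Proof.
move=> s0 mY; apply: bmeasM; first exact: (bmeas_comp measurable_snd bpsi).
apply: bmeas_normal_pdf => //; exact: measurableT_comp.
Qed.

Let smoothE (s x : R) : 0 < s ->
  \int[normal_prob x s]_a g a = \int[N01]_a (psi a * normal_pdf x s a).
Proof.
move=> s0; rewrite !Ex_normal//; last first.
  exact: (bmeas_pair1 (0 : R) (bpdf s0 (measurable_cst x : measurable_fun setT (fun _ : R => x)))).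
apply: eq_Rintegral => a _; rewrite mulrAC divfK//.
exact: lt0r_neq0.
Qed.

Let bsmooth (s : R) d' (T' : measurableType d') (Y : T' -> R) : 0 < s ->
  measurable_fun setT Y -> bmeas (fun w => \int[normal_prob (Y w) s]_a g a).
Proof.
move=> s0 mY; under eq_fun do rewrite smoothE//.
exact: (bmeas_Ex2 N01 (bpdf s0 mY)).
Qed.

Let cvg_smooth (s : R) : 0 < s ->
  \int[P]_w \int[normal_prob (Z n w) s]_a g a @[n --> \oo] -->
  \int[mu]_x \int[normal_prob x s]_a g a.
Proof.
move=> s0.
have E d' (T' : measurableType d') (Q : probability T' R) (Y : T' -> R) :
    measurable_fun setT Y -> \int[Q]_w \int[normal_prob (Y w) s]_a g a =
    \int[N01]_a (psi a * \int[Q]_w normal_pdf (Y w) s a).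
  move=> mY; under eq_Rintegral do rewrite smoothE//.
  rewrite (Ex_fubini Q N01 (bpdf s0 mY)); apply: eq_Rintegral => a _.
  have bY : bmeas (fun w => normal_pdf (Y w) s a).
    by apply: bmeas_normal_pdf => //; exact: measurable_cst.
  by rewrite /= ExZl.
have bE d' (T' : measurableType d') (Q : probability T' R) (Y : T' -> R) :
    measurable_fun setT Y -> measurable_fun setT
      (fun a : measurableTypeR R => psi a * \int[Q]_w normal_pdf (Y w) s a).
  move=> mY; rewrite (_ : (fun a => _) =
      fun a => \int[Q]_w (psi a * normal_pdf (Y w) s a)).
    by have [] := bmeas_Ex1 Q (bpdf s0 mY).
  apply/funext => a; rewrite ExZl//.
  by apply: bmeas_normal_pdf => //; exact: measurable_cst.
under eq_fun do rewrite E//; rewrite (E _ _ mu id)//.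
have [_ [M psiM]] := bpsi.
apply: (Ex_cvg (M := M * normal_peak s)).
- by move=> n; exact: bE.
- exact: (bE _ (measurableTypeR R) mu id).
- move=> n a; rewrite normrM ler_pM//; apply: Ex_bound => [|w].
    by apply: (bmeas_normal_pdf _ _ _).1 => //; exact: measurable_cst.
  by rewrite ger0_norm ?normal_pdf_ge0// normal_pdf_ub// lt0r_neq0.
- by move=> a; apply: cvgM; [exact: cvg_cst|exact: cvg_Ex_normal_pdf].
Qed.

(** Within [r] of [x] the oscillation is at most [e]. Outside, [2 M <= 2 M (a - x)^2 / r^2] as in
    Chebyshev's inequality, and [sqr_normal_pdf_le] turns this into [2 M * 6 s^2 / r^2] times a
    density. *)
Lemma smoothing_error (s x e r M : R) : 0 < s -> 0 < r ->
  (forall a, `|g a| <= M) ->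
  (forall a, `|a - x| < r -> `|g a - g x| <= e) ->
  `|\int[normal_prob x s]_a g a - g x| <= e + 12 * M * s ^+ 2 / r ^+ 2.
Proof.
move=> s0 r0 gM ge.
have M0 : 0 <= M by exact: le_trans (gM 0).
have e0 : 0 <= e by apply: le_trans (ge x _); rewrite ?subrr ?normr0.
have bgx : bmeas (fun a => g a - g x) by apply: bmeasB => //; exact: bmeas_cst.
have -> : \int[normal_prob x s]_a g a - g x =
    \int[@lebesgue_measure R]_a ((g a - g x) * normal_pdf x s a).
  by rewrite -Ex_normal// ExB ?Ex_cst//; exact: bmeas_cst.
pose C := 12 * M * s ^+ 2 / r ^+ 2.
have -> : e + C = \int[@lebesgue_measure R]_a
    (e * normal_pdf x s a + C * normal_pdf x (2 * s) a).
  have i1 := integrable_normal_pdf x s.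
  have i2 := integrable_normal_pdf x (2 * s).
  rewrite RintegralD//; last 2 first.
  - exact: (integrableZl measurableT e i1).
  - exact: (integrableZl measurableT C i2).
  by rewrite !RintegralZl// /Rintegral !integral_normal_pdf !mulr1.
have i3 := bmeas_normal_integrable x s bgx.
apply: (le_trans (le_normr_Rintegral _ i3)) => //.
apply: le_Rintegral => //.
- exact: (integrable_norm i3).
- apply: (@integrableD _ _ R (@lebesgue_measure R) setT measurableT
    (fun a => (e * normal_pdf x s a)%:E)
    (fun a => (C * normal_pdf x (2 * s) a)%:E)).
  + exact: (integrableZl measurableT e (integrable_normal_pdf x s)).
  + exact: (integrableZl measurableT C (integrable_normal_pdf x (2 * s))).
- move=> a _; rewrite normrM (ger0_norm (normal_pdf_ge0 _ _ _)).
  have p0 := normal_pdf_ge0 x s a; have q0 := normal_pdf_ge0 x (2 * s) a.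
  have C0 : 0 <= C by rewrite divr_ge0 ?sqr_ge0// mulr_ge0 ?sqr_ge0// mulr_ge0.
  have [ar|ra] := ltP `|a - x| r.
    apply: (le_trans (ler_wpM2r p0 (ge a ar))); rewrite lerDl; exact: mulr_ge0.
  have d2 : `|g a - g x| <= 2 * M.
    by apply: (le_trans (ler_normB _ _)); have := gM a; have := gM x; lra.
  have r2 : 1 <= (a - x) ^+ 2 / r ^+ 2.
    rewrite ler_pdivlMr ?exprn_gt0// mul1r -(real_normK (num_real (a - x))).
    by rewrite lerXn2r ?nnegrE// ltW.
  have h := sqr_normal_pdf_le s0 x a.
  apply: (@le_trans _ _ (C * normal_pdf x (2 * s) a)); last first.
    by rewrite lerDr mulr_ge0.
  apply: (le_trans (ler_wpM2r p0 d2)).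
  rewrite /C (_ : 12 * M * s ^+ 2 / r ^+ 2 * normal_pdf x (2 * s) a =
    2 * M / r ^+ 2 * (6 * s ^+ 2 * normal_pdf x (2 * s) a)); last by field; exact: lt0r_neq0.
  apply: le_trans (ler_wpM2l _ h); last by rewrite divr_ge0 ?sqr_ge0// mulr_ge0.
  rewrite (_ : 2 * M / r ^+ 2 * ((a - x) ^+ 2 * normal_pdf x s a) =
    (2 * M * normal_pdf x s a) * ((a - x) ^+ 2 / r ^+ 2)); last by field; exact: lt0r_neq0.
  by rewrite ler_peMr// mulr_ge0// mulr_ge0.
Qed.

Lemma cvg_Ex_compact_support : continuous g ->
  \int[P]_w g (Z n w) @[n --> \oo] --> \int[mu]_x g x.
Proof.
move=> cg; apply/cvgrPdist_le => e e0.
have e4 : 0 < e / 6 by rewrite divr_gt0.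
have [r r0 gr] := compact_support_unif_continuous cg gK e4.
have [mg [M gM]] := bg.
have M0 : 0 <= M by exact: le_trans (gM 0).
(* This makes the second error term at most [e / 6]; the [+ 1] covers [M = 0]. *)
pose s := Num.sqrt (e / 6 * r ^+ 2 / (12 * M + 1)).
have s2 : s ^+ 2 = e / 6 * r ^+ 2 / (12 * M + 1).
  by rewrite sqr_sqrtr// ltW// divr_gt0 ?mulr_gt0 ?exprn_gt0//; lra.
have s0 : 0 < s by rewrite sqrtr_gt0 divr_gt0 ?mulr_gt0 ?exprn_gt0//; lra.
have err x : `|\int[normal_prob x s]_a g a - g x| <= e / 3.
  apply: (le_trans (smoothing_error s0 r0 gM (gr x))); rewrite s2.
  rewrite (_ : 12 * M * _ / r ^+ 2 = e / 6 * (12 * M / (12 * M + 1))); last first.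
    by field; rewrite lt0r_neq0//=; lra.
  have : 12 * M / (12 * M + 1) <= 1 by rewrite ler_pdivrMr; lra.
  move=> /(ler_wpM2l (ltW e4)); lra.
have gap d' (T' : measurableType d') (Q : probability T' R) (Y : T' -> R) :
    measurable_fun setT Y ->
    `|\int[Q]_w g (Y w) - \int[Q]_w \int[normal_prob (Y w) s]_a g a| <= e / 3.
  move=> mY; have bgY := bmeas_comp mY bg; have bsY := bsmooth s0 mY.
  rewrite -ExB//; apply: Ex_bound; first exact: (bmeasB bgY bsY).1.
  by move=> w; rewrite distrC.
have e3 : 0 < e / 3 by rewrite divr_gt0.
have /cvgrPdist_le/(_ _ e3) := cvg_smooth s0.
apply: filterS => n hn.
have h1 := gap _ _ P (Z n) (mZ n).
have h2 := gap _ (measurableTypeR R) mu id (@measurable_id _ _ _).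
move: h1 h2 hn => /=.
move: (\int[P]_w g (Z n w)) (\int[mu]_x g x) => u v.
move: (\int[P]_w _) (\int[mu]_x _) => u' v'.
rewrite !ler_norml => /andP[? ?] /andP[? ?] /andP[? ?]; apply/andP; split; lra.
Qed.

End smoothing.

(** Tightness comes from the compactly supported case: for large [K] the cut-off [chi K] has mean
    close to 1 under [mu], hence under the law of [Z n] for large [n]. Replacing [g] by [g * chi K]
    costs at most [M] times the missing mass. *)
Lemma levy_continuity (g : R -> R) : continuous g -> bounded_fun g ->
  \int[P]_w g (Z n w) @[n --> \oo] --> \int[mu]_x g x.
Proof.
move=> cg [M0 [_ M0g]].
pose M := `|M0| + 1.
have gM x : `|g x| <= M.
  by apply: M0g => //; rewrite /M ltr_pwDr// ler_norm.
have mg : measurable_fun setT g by exact: continuous_measurable_fun.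
have M_gt0 : 0 < M by rewrite /M ltr_pwDr.
(* The trapezoid equal to 1 on [[-K, K]] and 0 beyond [K + 1]; written with absolute values it is
   visibly continuous. *)
pose chi (K : R) (x : R) := (1 + `|K + 1 - `|x| | - `|K - `|x| |) / 2.
have chi01 K x : 0 <= chi K x <= 1.
  rewrite /chi (_ : K + 1 - `|x| = (K - `|x|) + 1); last by ring.
  have := ler_normD (K - `|x|) 1; have := ler_normB ((K - `|x|) + 1) 1.
  rewrite addrK normr1; move: `|_ + 1| `|K - _| => u v ? ?; apply/andP; split; lra.
have chi1 K x : `|x| <= K -> chi K x = 1.
  by rewrite /chi => xK; rewrite (@ger0_norm _ (K + 1 - _)) ?(@ger0_norm _ (K - _)); [field|lra|lra].
have chi0 K x : K + 1 <= `|x| -> chi K x = 0.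
  by rewrite /chi => Kx; rewrite (@ler0_norm _ (K + 1 - _)) ?(@ler0_norm _ (K - _)); [field|lra|lra].
have cchi K : continuous (chi K).
  have c1 (a : R) : continuous (fun x : R => `|a - `|x| |).
    move=> x; apply: cvg_norm; apply: cvgB; first exact: cvg_cst.
    exact: norm_continuous.
  move=> x; apply: cvgM; last exact: cvg_cst.
  by apply: cvgB; [apply: cvgD; [exact: cvg_cst|exact: c1]|exact: c1].
have mchi K : measurable_fun setT (chi K) by exact: continuous_measurable_fun.
have bchi K : bmeas (chi K).
  by apply: (bmeas_le (M := 1)) => // x; rewrite ger0_norm; case/andP: (chi01 K x).
have bg : bmeas g by exact: bmeas_le gM.
have cvg_chi K : \int[P]_w chi K (Z n w) @[n --> \oo] --> \int[mu]_x chi K x.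
  by apply: (cvg_Ex_compact_support (K := K + 1)) => //; exact: chi0.
have cvg_gchi K : \int[P]_w (g (Z n w) * chi K (Z n w)) @[n --> \oo] -->
    \int[mu]_x (g x * chi K x).
  apply: (cvg_Ex_compact_support (g := fun x => g x * chi K x) (K := K + 1)).
  - exact: bmeasM.
  - by move=> x Kx; rewrite chi0// mulr0.
  - by move=> x; apply: cvgM; [exact: cg|exact: cchi].
have chi_lim : \int[mu]_x chi n%:R x @[n --> \oo] --> (1 : R).
  rewrite -[X in _ --> X](Ex_cst mu 1); apply: (Ex_cvg (M := 1)).
  - by move=> n; exact: mchi.
  - exact: measurable_cst.
  - by move=> n x; rewrite ger0_norm; case/andP: (chi01 n%:R x).
  - move=> x; apply: cvg_near_cst; near=> n; apply: chi1.
    by near: n; exact: nbhs_infty_ger.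
apply/cvgrPdist_le => e e0.
have eM : 0 < e / (4 * M) by rewrite divr_gt0// mulr_gt0.
have [K hK] : exists K, 1 - \int[mu]_x chi K x <= e / (4 * M).
  have /cvgrPdist_le/(_ _ eM)[N _ /(_ N (leqnn N))/=] := chi_lim.
  by exists N%:R; exact: le_trans (ler_norm _) _.
have gap d' (T' : measurableType d') (Q : probability T' R) (Y : T' -> R) :
    measurable_fun setT Y ->
    `|\int[Q]_w g (Y w) - \int[Q]_w (g (Y w) * chi K (Y w))| <=
    M * (1 - \int[Q]_w chi K (Y w)).
  move=> mY; have bgY := bmeas_comp mY bg; have bcY := bmeas_comp mY (bchi K).
  have b1 := bmeasB (bmeas_cst T' (1 : R)) bcY.
  rewrite -ExB//; last exact: bmeasM.
  rewrite -[X in M * (X - _)](Ex_cst Q) -ExB//; last exact: bmeas_cst.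
  rewrite -ExZl//; apply: Ex_norm_le.
  - by apply: bmeasB => //; exact: bmeasM.
  - by apply: bmeasM => //; exact: bmeas_cst.
  - move=> w; rewrite -{1}(mulr1 (g (Y w))) -mulrBr normrM.
    have /andP[c0 c1] := chi01 K (Y w).
    by rewrite (ger0_norm (_ : 0 <= 1 - _)) ?subr_ge0// ler_wpM2r// subr_ge0.
have /cvgrPdist_le/(_ _ eM) h1 := cvg_chi K.
have e4 : 0 < e / 4 by rewrite divr_gt0.
have /cvgrPdist_le/(_ _ e4) h2 := cvg_gchi K.
near=> n.
have g1 := gap _ _ P (Z n) (mZ n).
have g2 := gap _ (measurableTypeR R) mu id (@measurable_id _ _ _).
have k1 : `|\int[mu]_x chi K x - \int[P]_w chi K (Z n w)| <= e / (4 * M).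
  by near: n.
have k2 : `|\int[mu]_x (g x * chi K x) - \int[P]_w (g (Z n w) * chi K (Z n w))|
    <= e / 4 by near: n.
move: g1 g2 k1 k2 hK => /=.
move: (\int[P]_w g (Z n w)) (\int[mu]_x g x) => u v.
move: (\int[P]_w (_ * _)) (\int[mu]_x (_ * _)) => u' v'.
move: (\int[P]_w _) (\int[mu]_x _) => a b.
have -> : e / (4 * M) = e / 4 / M by field; rewrite lt0r_neq0.
move=> g1 g2; rewrite ler_norml => /andP[_ k1] k2 hK.
have l1 : M * (1 - b) <= e / 4.
  by rewrite mulrC -ler_pdivlMr.
have l2 : M * (1 - a) <= e / 4 + e / 4.
  by rewrite mulrC -ler_pdivlMr// mulrDl; lra.
move: g1 g2 k2; rewrite !ler_norml => /andP[? ?] /andP[? ?] /andP[? ?].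
apply/andP; split; lra.
Unshelve. all: end_near.
Qed.

End levy.

(** * Linear statistics of two consecutive blocks *)

Lemma sum_range_minn (lo p N : nat) :
  (\sum_(k < N) (lo <= k < lo + p))%N = minn p (N - lo).
Proof.
elim: N => [|M IH]; first by rewrite big_ord0; lia.
by rewrite big_ord_recr/= IH; case: (leqP lo M); case: (ltnP M (lo + p)) => /=; lia.
Qed.

Section two_block_clt.
Context d (T : measurableType d) (R : realType) (P : probability T R).
Variable X : int -> {RV P >-> R}.
Local Notation TG := (g_sigma_algebraType (past_events X)).
Variable Q1 : int -> R.-pker TG ~> R.
Variable Q2 : int -> int -> R.-pker TG ~> (R * R)%type.
Hypothesis X_stationary : strictly_stationary X.
Hypothesis Q1X : forall k : int, is_cond_distribution (P := P) (X k) (Q1 k).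
Hypothesis Q2X : forall i j : int,
  is_cond_distribution (P := P) (pairRV (X i) (X j)) (Q2 i j).
Hypothesis beta2_summable : (\sum_(1 <= k <oo) beta2 Q1 Q2 k < +oo)%E.
Local Notation beta := (betaR Q1 Q2).
Local Notation mixing1 := (mixing_time1 X_stationary Q1X beta2_summable).
Local Notation mixing2 := (mixing_time2 X_stationary Q1X Q2X beta2_summable).

(** The autocovariance at lag [l], when [chi] is centred. *)
Definition gam (chi : R -> R) (l : nat) : R := \int[P]_w (chi (X 0 w) * chi (X l%:Z w)).

Lemma stationary_Ex2 (k l h : int) (Phi : R * R -> R) : bmeas Phi ->
  \int[P]_w Phi (X (k + h) w, X (l + h) w) = \int[P]_w Phi (X k w, X l w).
Proof.
move=> bPhi.
have bPhi' : bmeas (fun z : 0.-tuple R * (R * R) => Phi z.2).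
  exact: bmeas_comp.
exact: (stationary_Ex_pair X_stationary [tuple] k l h bPhi').
Qed.

Lemma gam_shift (chi : R -> R) (k i : nat) : bmeas chi -> (i <= k)%N ->
  \int[P]_w (chi (X k.+1%:Z w) * chi (X i.+1%:Z w)) = gam chi (k - i).
Proof.
move=> bchi ik.
have bPhi : bmeas (fun z : R * R => chi z.2 * chi z.1).
  by apply: bmeasM; exact: bmeas_comp.
rewrite /gam -(stationary_Ex2 0 (k - i)%N%:Z i.+1%:Z
  (Phi := fun z => chi z.1 * chi z.2)); last first.
  by apply: bmeasM; exact: bmeas_comp.
rewrite add0r -PoszD addnS subnK//=.
by apply: eq_Rintegral => w _; rewrite mulrC.
Qed.

Lemma Ex_ray_average_X (chi : R -> R) M (k : int) : ray_average X M chi ->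
  \int[P]_w chi (X k w) = 0.
Proof.
move=> rchi; have bchi := ray_average_bmeas rchi.
by rewrite (stationary_law X_stationary)// -Ex_distribution// (Ex_ray_average rchi).
Qed.

Lemma gam_le (chi : R -> R) l : ray_average X 1 chi -> (0 < l)%N -> `|gam chi l| <= beta l.
Proof.
move=> rchi l0; have bchi := ray_average_bmeas rchi.
pose Phi (z : 1.-tuple R * R) := chi (tnth z.1 ord0) * chi z.2.
have bPhi : bmeas Phi.
  apply: bmeasM; last exact: bmeas_comp.
  apply: (bmeas_comp (p := fun z : 1.-tuple R * R => tnth z.1 ord0)) => //.
  by apply: (measurableT_comp (measurable_tnth ord0)).
have t0 (i : 'I_1) : tnth [tuple (0 : int)] i <= 0 by rewrite (tnth_nth 0) ord1.
have PhiE x : exists c g, [/\ `|c| <= 1, ray_average X 1 g &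
    forall y, Phi (x, y) = c * g y].
  exists (chi (tnth x ord0)), chi; split => //.
  exact: ray_average_le rchi _.
have := mixing1 t0 l0 bPhi PhiE ltr01 ltr01.
rewrite !mul1r add0r; apply: le_trans.
rewrite le_eqVlt; apply/orP; left; apply/eqP; congr `|_|.
by apply: eq_Rintegral => w _; rewrite /Phi/= tnth_mktuple.
Qed.

Variables (xi eta : R -> R).
Hypothesis (rxi : ray_average X 1 xi) (reta : ray_average X 1 eta).

Section fixed.
Variables (n m p q : nat) (t alpha tau s1 s2 Cs : R).
Hypothesis (n0 : (0 < n)%N) (m0 : (0 < m)%N) (t0 : 0 <= t).
Let delta := t * ((Num.sqrt n%:R)^-1 + Num.sqrt n%:R / m%:R).
Hypothesis delta1 : delta <= 1.
Hypothesis tail : forall M, \sum_(p.+1 <= k < M) beta k <= tau.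
Hypothesis s1E : `|gam xi 0 + 2 * \sum_(1 <= l < p.+1) gam xi l - s1| <= 2 * tau.
Hypothesis s2E : `|gam eta 0 + 2 * \sum_(1 <= l < p.+1) gam eta l - s2| <= 2 * tau.
Hypothesis (s1C : `|s1| <= Cs) (s2C : `|s2| <= Cs) (Csd : Cs * delta ^+ 2 <= 1).

Let chi k := if (k < n)%N then xi else eta.
(** The weights of [t * sqrt n * (n^-1 \sum xi + m^-1 \sum eta)], with both samples in one sequence;
    index [k] carries time [k.+1]. *)
Let a k : R := if (k < n)%N then t / Num.sqrt n%:R else t * (Num.sqrt n%:R / m%:R).
Let sg k := if (k < n)%N then s1 else s2.
Let zeta k w := a k * chi k (X k.+1%:Z w).
Let W k w := \sum_(i < k) zeta i w.
Let N := (n + m)%N.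
Let A := t ^+ 2 * (1 + n%:R / m%:R).
Let V := t ^+ 2 * (s1 + n%:R / m%:R * s2).
Let D := (p + q + q).+1%:R * delta + 3 * beta q.+1.

Let rchi k : ray_average X 1 (chi k).
Proof. by rewrite /chi; case: ifP. Qed.

Let bchi k : bmeas (chi k).
Proof. exact: ray_average_bmeas (rchi k). Qed.

Let sn0 : 0 < Num.sqrt n%:R :> R.
Proof. by rewrite sqrtr_gt0 ltr0n. Qed.

Let a_ge0 k : 0 <= a k.
Proof. by rewrite /a; case: ifP => _; rewrite ?mulr_ge0 ?divr_ge0// ltW. Qed.

Let a_le k : a k <= delta.
Proof.
rewrite /a /delta mulrDr; case: ifP => _.
  by rewrite lerDl mulr_ge0// divr_ge0// ltW.
by rewrite lerDr divr_ge0// ltW.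
Qed.

Let mzeta k : measurable_fun setT (zeta k).
Proof. by apply: measurable_funM => //; exact: (bmeas_comp (p := X k.+1%:Z) _ (bchi k)).1. Qed.

Let zeta_le k w : `|zeta k w| <= a k.
Proof.
rewrite normrM ger0_norm ?a_ge0// ler_piMr ?a_ge0//.
exact: ray_average_le (rchi k) _.
Qed.

Let bXchi k (l : int) : bmeas (fun w => chi k (X l w)).
Proof. exact: bmeas_comp. Qed.

Let past_times j : j.-tuple int := [tuple i.+1%:Z | i < j].

Let past_times_le j i : tnth (past_times j) i <= j%:Z.
Proof. by rewrite tnth_mktuple lez_nat. Qed.

Let Wtuple j (x : j.-tuple R) := \sum_(i < j) a i * chi i (tnth x i).

Let WtupleE j w : Wtuple [tuple X (tnth (past_times j) i) w | i < j] = W j w.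
Proof. by apply: eq_bigr => i _; rewrite !tnth_mktuple. Qed.

Let mWtuple j : measurable_fun setT (@Wtuple j).
Proof.
apply: (bmeas_sum _ _).1 => i; apply: bmeasM; first exact: bmeas_cst.
by apply: bmeas_comp => //; exact: measurable_tnth.
Qed.

Let zeta_mean0 k : \int[P]_w zeta k w = 0.
Proof. by rewrite ExZl// (Ex_ray_average_X _ (rchi k)) mulr0. Qed.

Let zeta_mixing1 k i (g : R * R -> R) K : (i < k)%N ->
  0 < K -> bmeas g -> (forall u z, `|z| <= a i -> `|g (u, z)| <= K) ->
  `|\int[P]_w (zeta k w * g (W i w, zeta i w))| <= a k * K * beta (k - i).
Proof.
move=> ik K0 bg gK.
(* [W i] and [zeta i] are functions of the observations at times 1 to [i.+1], the last of which
   gives [zeta i]. *)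
pose u (x : i.+1.-tuple R) := \sum_(l < i) a l * chi l (tnth x (widen_ord (leqnSn i) l)).
pose z (x : i.+1.-tuple R) := a i * chi i (tnth x ord_max).
pose Phi (v : i.+1.-tuple R * R) := g (u v.1, z v.1) * chi k v.2.
have bPhi : bmeas Phi.
  apply: bmeasM; last exact: bmeas_comp.
  apply: (bmeas_comp (p := fun v : i.+1.-tuple R * R => (u v.1, z v.1))) => //.
  apply: measurable_fun_pair.
    apply: (measurableT_comp (f := u)) => //.
    apply: (bmeas_sum _ _).1 => l; apply: bmeasM; first exact: bmeas_cst.
    by apply: bmeas_comp => //; exact: measurable_tnth.
  apply: (measurableT_comp (f := z)) => //.
  apply: measurable_funM => //.
  by apply: (bmeas_comp _ (bchi i)).1; exact: measurable_tnth.
have PhiE x : exists c g0, [/\ `|c| <= K, ray_average X 1 g0 &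
    forall y, Phi (x, y) = c * g0 y].
  exists (g (u x, z x)), (chi k); split => //.
  apply: gK; rewrite normrM ger0_norm// ler_piMr//.
  exact: ray_average_le (rchi i) _.
have ki0 : (0 < k - i)%N by rewrite subn_gt0.
have := mixing1 (past_times_le (j := i.+1)) ki0 bPhi PhiE K0 ltr01.
rewrite mulr1 => h.
rewrite -mulrA.
have -> : \int[P]_w (zeta k w * g (W i w, zeta i w)) = a k * \int[P]_w
    Phi ([tuple X (tnth (past_times i.+1) j) w | j < i.+1], X (i.+1%:Z + (k - i)%N%:Z) w).
  rewrite -ExZl; last first.
    apply: (bmeas_comp (p := fun w => ([tuple X (tnth (past_times i.+1) j) w | j < i.+1],
       X (i.+1%:Z + (k - i)%N%:Z) w))) => //.
    apply: measurable_fun_pair => //; exact: measurable_process_tuple.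
  apply: eq_Rintegral => w _; rewrite /Phi /zeta/= -mulrA; congr (_ * _).
  rewrite mulrC -PoszD addSn subnKC//; last exact: ltnW.
  congr (g (_, _) * _).
    by apply: eq_bigr => l _; rewrite !tnth_mktuple.
  by rewrite /z !tnth_mktuple.
by rewrite normrM (ger0_norm (a_ge0 _)) ler_wpM2l.
Qed.

Let zeta_mixing2 k i j (g : R -> R) : (j <= i <= k)%N ->
  bmeas g -> (forall u, `|g u| <= 1) ->
  `|\int[P]_w (zeta k w * zeta i w * g (W j w)) -
    (\int[P]_w (zeta k w * zeta i w)) * \int[P]_w g (W j w)| <=
  3 * a k * a i * beta (i - j).+1.
Proof.
move=> /andP[ji ik] bg g1.
pose Phi (v : j.-tuple R * (R * R)) := g (Wtuple v.1) * (chi k v.2.1 * chi i v.2.2).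
have bPhi : bmeas Phi.
  apply: bmeasM.
    apply: (bmeas_comp (p := fun v : j.-tuple R * (R * R) => Wtuple v.1)) => //.
    exact: (measurableT_comp (@mWtuple j)).
  apply: bmeasM; apply: bmeas_comp => //; exact: measurableT_comp.
have PhiE x : exists c g0 h, [/\ `|c| <= 1, ray_average X 1 g0,
    ray_average X 1 h & forall y, Phi (x, y) = c * (g0 y.1 * h y.2)].
  by exists (g (Wtuple x)), (chi k), (chi i); split.
have ikj : (0 < (i - j).+1 <= (k - j).+1)%N by rewrite ltnS; exact: leq_sub2r.
have := mixing2 (past_times_le (j := j)) ikj bPhi PhiE ltr01 ltr01 ltr01.
rewrite !mulr1 => h.
have Xk l : (j <= l)%N -> j%:Z + (l - j).+1%:Z = l.+1%:Z.
  by move=> jl; rewrite -PoszD addnS subnKC.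
have bW : bmeas (fun w => g (W j w)).
  by apply: bmeas_comp => //; apply: (bmeas_sum _ _).1 => l; exact: bmeas_le (zeta_le l).
have bcc : bmeas (fun w => chi k (X k.+1%:Z w) * chi i (X i.+1%:Z w)).
  exact: bmeasM.
have aa : 0 <= a k * a i by exact: mulr_ge0.
have E1 : \int[P]_w (zeta k w * zeta i w * g (W j w)) = a k * a i * \int[P]_w
    Phi ([tuple X (tnth (past_times j) l) w | l < j],
      (X (j%:Z + (k - j).+1%:Z) w, X (j%:Z + (i - j).+1%:Z) w)).
  rewrite !Xk//; last exact: leq_trans ik.
  rewrite -ExZl; last by rewrite /Phi/=; under eq_fun do rewrite WtupleE; exact: bmeasM.
  by apply: eq_Rintegral => w _; rewrite /Phi /zeta/= WtupleE; ring.
have E2 : (\int[P]_w (zeta k w * zeta i w)) * \int[P]_w g (W j w) =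
    a k * a i * \int[P]_w \int[P]_w' Phi ([tuple X (tnth (past_times j) l) w | l < j],
      (X (j%:Z + (k - j).+1%:Z) w', X (j%:Z + (i - j).+1%:Z) w')).
  rewrite !Xk//; last exact: leq_trans ik.
  rewrite /Phi/=; under [X in _ = _ * X]eq_Rintegral do rewrite WtupleE ExZl//.
  rewrite ExZr// (_ : \int[P]_w (zeta k w * zeta i w) = a k * a i *
    \int[P]_w (chi k (X k.+1%:Z w) * chi i (X i.+1%:Z w))); first by ring.
  by rewrite -ExZl//; apply: eq_Rintegral => w _; rewrite /zeta; ring.
rewrite E1 E2 -mulrBr normrM (ger0_norm aa).
rewrite (_ : 3 * a k * a i * _ = a k * a i * (3 * beta (i - j).+1)); last by ring.
by rewrite ler_wpM2l.
Qed.

(** The [p] indices before such a [k] lie in its own sample, so the truncated covariances are those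
    of a single stationary sequence. At most [2 p] indices are excluded. *)
Let interior k := ((p <= k < n) || (n + p <= k))%N.

Let zeta2E k i : (i <= k)%N -> (k < n)%N = (i < n)%N ->
  \int[P]_w (zeta k w * zeta i w) = a k ^+ 2 * gam (chi k) (k - i).
Proof.
move=> ik kin; rewrite -gam_shift// -ExZl; last exact: bmeasM.
apply: eq_Rintegral => w _; rewrite /zeta (_ : chi i = chi k); last by rewrite /chi kin.
by rewrite (_ : a i = a k); [ring|rewrite /a kin].
Qed.

Let zeta2_le k i : `|\int[P]_w (zeta k w * zeta i w)| <= delta ^+ 2.
Proof.
apply: Ex_bound => [|w]; first exact: measurable_funM.
by rewrite normrM expr2 ler_pM// (le_trans (zeta_le _ _)).
Qed.

Let c k := \int[P]_w (zeta k w * zeta k w) +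
  2 * \sum_(i < k | (k - i <= p)%N) \int[P]_w (zeta k w * zeta i w).

Let Delta k := a k ^+ 2 * sg k.

Let Cs_ge0 : 0 <= Cs. Proof. exact: le_trans s1C. Qed.

Let delta_ge0 : 0 <= delta. Proof. exact: le_trans (a_le 0). Qed.

Let Delta_le k : `|Delta k| <= a k ^+ 2 * Cs.
Proof.
rewrite normrM ger0_norm ?sqr_ge0// ler_wpM2l ?sqr_ge0// /sg.
by case: ifP.
Qed.

Let a2_le k : a k ^+ 2 <= delta ^+ 2.
Proof. by rewrite lerXn2r ?nnegrE. Qed.

Let tau_ge0 : 0 <= tau.
Proof. by have := tail 0; rewrite big_geq. Qed.

Let c_interior k : interior k -> `|c k - Delta k| <= a k ^+ 2 * (2 * tau).
Proof.
move=> intk.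
have same i : (i < k)%N -> (k - i <= p)%N -> (k < n)%N = (i < n)%N.
  move=> ik kip; case/orP: intk => [/andP[_ kn]|npk].
    by rewrite kn (ltn_trans ik kn).
  have ni : (n <= i)%N by clear -npk kip; lia.
  by rewrite !ltnNge ni (leq_trans ni (ltnW ik)).
have pk : (p <= k)%N.
  by case/orP: intk => [/andP[]//|]; exact: leq_trans (leq_addl _ _).
have -> : c k = a k ^+ 2 * (gam (chi k) 0 + 2 * \sum_(1 <= l < p.+1) gam (chi k) l).
  rewrite /c zeta2E// subnn mulrDr; congr (_ + _).
  rewrite [RHS]mulrCA; congr (_ * _); rewrite mulr_sumr.
  transitivity (\sum_(i < k | (k - i <= p)%N) (a k ^+ 2 * gam (chi k) (k - i))).
    apply: eq_bigr => i kip.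
    by rewrite (zeta2E (ltnW (ltn_ord i)) (same i (ltn_ord i) kip)).
  rewrite (reindex_inj rev_ord_inj)/= big_add1/=.
  rewrite (eq_bigl (fun i : 'I_k => (i < p)%N)); last first.
    by move=> i /=; rewrite (subKn (ltn_ord i)).
  rewrite (big_ord_narrow_cond (P := xpredT) pk)/= big_mkord.
  by apply: eq_bigr => i _; rewrite /= subKn// (leq_trans _ pk).
rewrite /Delta -mulrBr normrM ger0_norm ?sqr_ge0// ler_wpM2l ?sqr_ge0//.
by rewrite /chi /sg; case: ifP.
Qed.

(** A crude bound for the excluded indices: at most [p] covariances, counted twice, and a variance,
    each of order [delta ^+ 2]. *)
Let c_all k : `|c k - Delta k| <= (2 * p%:R + 1 + Cs) * delta ^+ 2.
Proof.
apply: (le_trans (ler_normB _ _)); rewrite mulrDl; apply: lerD; last first.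
  by apply: (le_trans (Delta_le k)); rewrite mulrC ler_wpM2l.
have h1 := zeta2_le k k.
have h2 : `|2 * \sum_(i < k | (k - i <= p)%N) \int[P]_w (zeta k w * zeta i w)|
    <= 2 * p%:R * delta ^+ 2.
  rewrite normrM ger0_norm// -mulrA ler_pM2l//.
  apply: (le_trans (ler_norm_sum _ _ _)).
  apply: (@le_trans _ _ (\sum_(i < k | (k - i <= p)%N) delta ^+ 2)).
    by apply: ler_sum => i _; exact: zeta2_le.
  rewrite (reindex_inj rev_ord_inj)/=.
  rewrite (eq_bigl (fun i : 'I_k => (i < p)%N)); last by move=> i /=; rewrite (subKn (ltn_ord i)).
  rewrite big_mkcond/= -(big_mkord xpredT (fun i => if (i < p)%N then delta ^+ 2 else 0)).
  (* Enlarging the range to [maxn k p] lets it be cut at [p] whatever the order of [k] and [p]. *)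
  apply: (@le_trans _ _ (\sum_(0 <= i < maxn k p) if (i < p)%N then delta ^+ 2 else 0)).
    rewrite (big_cat_nat (leq0n k) (leq_maxl k p))/= lerDl sumr_ge0// => i _.
    by case: ifP; rewrite ?sqr_ge0.
  rewrite (big_cat_nat (leq0n p) (leq_maxr k p))/= [X in _ + X]big_nat_cond.
  rewrite [X in _ + X]big1 ?addr0; last first.
    by move=> i /andP[/andP[pi _] _]; rewrite ltnNge pi.
  rewrite (eq_big_nat _ _ (F2 := fun=> delta ^+ 2)); last by move=> i /andP[_ ->].
  by rewrite sumr_const_nat subn0 mulr_natl.
apply: (le_trans (ler_normD _ _)); apply: (le_trans (lerD h1 h2)).
by rewrite [in leRHS]mulrDl mul1r [leLHS]addrC.
Qed.

Let sum_c : \sum_(k < N) `|c k - Delta k| <=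
  2 * tau * \sum_(k < N) a k ^+ 2 +
  2 * p%:R * ((2 * p%:R + 1 + Cs) * delta ^+ 2).
Proof.
set B := (_ + Cs) * _.
have B0 : 0 <= B by exact: le_trans (c_all 0).
apply: (@le_trans _ _ (\sum_(k < N) (2 * tau * a k ^+ 2 +
   ((0 <= k < 0 + p)%N%:R + (n <= k < n + p)%N%:R) * B))).
  apply: ler_sum => k _.
  have [intk|] := boolP (interior k).
    apply: (le_trans (c_interior intk)); rewrite mulrC lerDl.
    by rewrite mulr_ge0// addr_ge0.
  rewrite /interior negb_or negb_and -ltnNge -leqNgt -ltnNge => /andP[kpn knp].
  apply: (le_trans (c_all k)); rewrite -/B.
  have : (1 <= (0 <= k < 0 + p) + (n <= k < n + p))%N.
    by rewrite add0n leq0n knp andbT/=; case/orP: kpn => ->; rewrite // addn1.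
  rewrite -(ler_nat R) natrD => h.
  have := ler_wpM2r B0 h; rewrite mul1r => /le_trans; apply.
  by rewrite lerDr !mulr_ge0// sqr_ge0.
rewrite big_split/= -mulr_sumr lerD2l -mulr_suml ler_wpM2r//.
rewrite big_split/= -!natr_sum !sum_range_minn -natrD -natrM ler_nat.
rewrite mul2n -addnn; apply: leq_add; last exact: geq_minl.
by have /= -> := sum_range_minn 0 p N; exact: geq_minl.
Qed.

Let sum_split (F : nat -> R) (x y : R) :
  (forall k, (k < n)%N -> F k = x) -> (forall k, (n <= k)%N -> F k = y) ->
  \sum_(k < N) F k = n%:R * x + m%:R * y.
Proof.
move=> Fx Fy; rewrite -(big_mkord xpredT F) (@big_cat_nat _ _ _ n)//= ?leq_addr//.
congr (_ + _).
  rewrite (eq_big_nat _ _ (F2 := fun=> x)); last by move=> i /andP[_]; exact: Fx.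
  by rewrite sumr_const_nat subn0 mulr_natl.
rewrite (eq_big_nat _ _ (F2 := fun=> y)); last by move=> i /andP[ni _]; exact: Fy.
by rewrite sumr_const_nat /N addKn mulr_natl.
Qed.

Let nR : n%:R != 0 :> R. Proof. by rewrite pnatr_eq0 -lt0n. Qed.
Let mR : m%:R != 0 :> R. Proof. by rewrite pnatr_eq0 -lt0n. Qed.

Let sqn : Num.sqrt n%:R ^+ 2 = n%:R :> R.
Proof. by rewrite sqr_sqrtr. Qed.

Let a1E k : (k < n)%N -> a k ^+ 2 = t ^+ 2 / n%:R.
Proof. by move=> kn; rewrite /a kn expr_div_n sqn. Qed.

Let a2E k : (n <= k)%N -> a k ^+ 2 = t ^+ 2 * (n%:R / m%:R ^+ 2).
Proof. by move=> nk; rewrite /a ltnNge nk/= exprMn expr_div_n sqn. Qed.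

Let sum_a2 : \sum_(k < N) a k ^+ 2 = A.
Proof.
rewrite (sum_split (F := fun k => a k ^+ 2) a1E a2E) /A.
by field; rewrite nR mR.
Qed.

Let sum_Delta : \sum_(k < N) Delta k = V.
Proof.
rewrite (sum_split (F := Delta) (x := t ^+ 2 / n%:R * s1)
  (y := t ^+ 2 * (n%:R / m%:R ^+ 2) * s2)).
- by rewrite /V; field; rewrite nR mR.
- by move=> k kn; rewrite /Delta /sg a1E// kn.
- by move=> k nk; rewrite /Delta /sg a2E// ltnNge nk.
Qed.

(** For fixed [p] and [q], letting [delta] tend to 0 leaves only the terms in [tau] and in
    [p.+1%:R * beta q.+1]. *)
Lemma two_block_clt_bound :
  `|expR (V / 2) * \int[P]_w cos (W N w + alpha) - cos alpha| <=
  expR (Cs * A / 2) * (A * (delta + (p.+1%:R * D + tau)) +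
    (2 * tau * A + 2 * p%:R * ((2 * p%:R + 1 + Cs) * delta ^+ 2)) +
    Cs ^+ 2 * delta ^+ 2 * A).
Proof.
have Delta1 k : (k < N)%N -> `|Delta k| <= 1.
  move=> _; apply: (le_trans (Delta_le k)); apply: le_trans Csd.
  by rewrite mulrC ler_wpM2l.
have Vub k : (k <= N)%N -> \sum_(i < k) Delta i <= Cs * A.
  move=> kN; apply: (@le_trans _ _ (\sum_(i < k) a i ^+ 2 * Cs)).
    by apply: ler_sum => i _; exact: le_trans (ler_norm _) (Delta_le i).
  rewrite -mulr_suml mulrC ler_wpM2l// -sum_a2.
  rewrite -!(big_mkord xpredT (fun i => a i ^+ 2)) (big_cat_nat (leq0n k) kN)/=.
  by rewrite lerDl sumr_ge0// => i _; exact: sqr_ge0.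
have := clt_bound p q alpha mzeta zeta_le a_le delta1 (betaR_ge0 Q1 Q2) zeta_mean0
  zeta_mixing1 zeta_mixing2 Delta1 Vub.
rewrite sum_Delta sum_a2 => /le_trans; apply.
rewrite ler_wpM2l ?expR_ge0//; apply: lerD; last first.
  rewrite -sum_a2 mulr_sumr; apply: ler_sum => k _.
  rewrite -(real_normK (num_real (Delta k))).
  apply: (@le_trans _ _ ((a k ^+ 2 * Cs) ^+ 2)).
    by rewrite lerXn2r ?nnegrE ?mulr_ge0 ?sqr_ge0.
  rewrite exprMn mulrC -mulrA ler_wpM2l ?sqr_ge0// [_ ^+ 2 ^+ 2]expr2.
  by rewrite ler_wpM2r ?sqr_ge0.
apply: lerD; last by rewrite -sum_a2; exact: sum_c.
have A0 : 0 <= A by rewrite /A mulr_ge0 ?sqr_ge0// addr_ge0// divr_ge0.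
apply: (ler_wpM2l A0); rewrite lerD2l.
have D0 : 0 <= D by rewrite addr_ge0// mulr_ge0// betaR_ge0.
have b0 l : 0 <= (if (l <= p)%N then D else beta l).
  by case: ifP => // _; exact: betaR_ge0.
rewrite -(big_mkord xpredT (fun l => if (l <= p)%N then D else beta l)).
apply: (@le_trans _ _ (\sum_(0 <= l < maxn N p.+1) if (l <= p)%N then D else beta l)).
  by rewrite (big_cat_nat (leq0n N) (leq_maxl N p.+1))/= lerDl sumr_ge0.
rewrite (big_cat_nat (leq0n p.+1) (leq_maxr N p.+1))/=; apply: lerD.
  rewrite (eq_big_nat _ _ (F2 := fun=> D)); last first.
    by move=> i /andP[_]; rewrite ltnS => ->.
  by rewrite sumr_const_nat subn0 mulr_natl.
rewrite (eq_big_nat _ _ (F2 := beta)); first exact: tail.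
by move=> i /andP[pi _]; rewrite leqNgt pi.
Qed.

End fixed.
End two_block_clt.

(** * Limit of the cosine transform of the linear part *)

Section two_block_limit.
Context d (T : measurableType d) (R : realType) (P : probability T R).
Variable X : int -> {RV P >-> R}.
Local Notation TG := (g_sigma_algebraType (past_events X)).
Variable Q1 : int -> R.-pker TG ~> R.
Variable Q2 : int -> int -> R.-pker TG ~> (R * R)%type.
Hypothesis X_stationary : strictly_stationary X.
Hypothesis Q1X : forall k : int, is_cond_distribution (P := P) (X k) (Q1 k).
Hypothesis Q2X : forall i j : int,
  is_cond_distribution (P := P) (pairRV (X i) (X j)) (Q2 i j).
Hypothesis beta2_summable : (\sum_(1 <= k <oo) beta2 Q1 Q2 k < +oo)%E.
Local Notation beta := (betaR Q1 Q2).

Let gam_beta (chi : R -> R) l : ray_average X 1 chi -> (0 < l)%N ->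
  `|gam X chi l| <= beta l.
Proof. exact: gam_le. Qed.

Lemma cvg_gam_sums (chi : R -> R) : ray_average X 1 chi ->
  cvgn (fun M => \sum_(1 <= l < M) gam X chi l).
Proof.
move=> rchi; apply: cauchy_cvg; apply/cauchy_exP => e e0.
have e2 : 0 < e / 2 by rewrite divr_gt0.
have [L L0 tailL] := sum_betaR_tail beta2_summable e2.
exists (\sum_(1 <= l < L) gam X chi l); exists L => // M /= LM.
rewrite /ball/= (@big_cat_nat _ _ _ L 1 M)//= opprD addNKr normrN.
apply: (le_lt_trans (ler_norm_sum _ _ _)).
apply: (@le_lt_trans _ _ (e / 2)); last by rewrite ltr_pdivrMr// ltr_pMr// ltr1n.
apply: le_trans (tailL M).
rewrite big_nat_cond [leRHS]big_nat_cond; apply: ler_sum => l /andP[/andP[Ll _] _].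
by apply: gam_beta => //; exact: leq_trans Ll.
Qed.

Definition lrv (chi : R -> R) : R :=
  gam X chi 0 + 2 * limn (fun M => \sum_(1 <= l < M) gam X chi l).

Lemma lrv_tail (chi : R -> R) p tau : ray_average X 1 chi ->
  (forall M, \sum_(p.+1 <= k < M) beta k <= tau) ->
  `|gam X chi 0 + 2 * \sum_(1 <= l < p.+1) gam X chi l - lrv chi| <= 2 * tau.
Proof.
move=> rchi tail.
have c := cvg_gam_sums rchi.
set u := (fun M => _) in c.
have h : u M - u p.+1 @[M --> \oo] --> limn u - u p.+1.
  by apply: cvgB => //; exact: cvg_cst.
have h' : `|limn u - u p.+1| <= tau.
  have hn : `|u M - u p.+1| @[M --> \oo] --> `|limn u - u p.+1| by exact: cvg_norm.
  rewrite -(cvg_lim (@Rhausdorff R) hn); apply: limr_le.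
    by apply/cvg_ex; eexists; exact: hn.
  near=> M; have pM : (p.+1 <= M)%N by near: M; exact: nbhs_infty_ge.
  rewrite /u (@big_cat_nat _ _ _ p.+1 1 M)//= addrAC subrr add0r.
  apply: (le_trans (ler_norm_sum _ _ _)); apply: le_trans (tail M).
  rewrite big_nat_cond [leRHS]big_nat_cond; apply: ler_sum => l /andP[/andP[Ll _] _].
  by apply: gam_beta => //; exact: leq_trans Ll.
rewrite /lrv (_ : _ - _ = - (2 * (limn u - u p.+1))); last by rewrite /u; ring.
by rewrite normrN normrM ger0_norm// ler_pM2l.
Unshelve. all: end_near.
Qed.

Lemma cvg_inv_sqrt : (Num.sqrt n%:R : R)^-1 @[n --> \oo] --> (0 : R).
Proof.
have h : Num.sqrt (harmonic n) @[n --> \oo] --> Num.sqrt (0 : R).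
  exact: (cvg_comp _ _ (@cvg_harmonic R) (@sqrt_continuous R 0)).
rewrite sqrtr0 in h; rewrite -cvg_shiftS; apply: cvg_trans h.
by apply: near_eq_cvg; apply: nearW => n; rewrite /harmonic/= sqrtrV.
Qed.

Variables (xi eta : R -> R) (m : nat -> nat) (c : R).
Hypothesis (rxi : ray_average X 1 xi) (reta : ray_average X 1 eta).
Hypothesis m_gt0 : forall n, (0 < m n)%N.
Hypothesis m_cvg : (n%:R / (m n)%:R : R) @[n --> \oo] --> c.
Hypothesis c0 : 0 <= c.

Definition linear_part n w : R := Num.sqrt n%:R *
  (n%:R^-1 * (\sum_(0 <= k < n) xi (X k.+1%:Z w)) +
   (m n)%:R^-1 * (\sum_(n <= k < n + m n) eta (X k.+1%:Z w))).

(** This ratio is [(n / m) / sqrt n]: each weight of the second sample is negligible, also when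
    [c = 0]. *)
Lemma cvg_sqrt_div : (Num.sqrt n%:R / (m n)%:R : R) @[n --> \oo] --> (0 : R).
Proof.
have h : (n%:R / (m n)%:R) * (Num.sqrt n%:R)^-1 @[n --> \oo] --> (0 : R).
  by rewrite -[X in _ --> X](mulr0 c); apply: cvgM; [exact: m_cvg|exact: cvg_inv_sqrt].
apply: cvg_trans h; apply: near_eq_cvg; near=> n.
have n0 : (0 < n)%N by near: n; exact: nbhs_infty_gt.
have s0 : 0 < Num.sqrt n%:R :> R by rewrite sqrtr_gt0 ltr0n.
rewrite -{1}(@sqr_sqrtr R n%:R)// expr2.
by field; rewrite (lt0r_neq0 s0)/= pnatr_eq0 -lt0n m_gt0.
Unshelve. all: end_near.
Qed.

Let V (r : R) : R := lrv xi + r * lrv eta.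

Lemma cvg_cos_linear_part_ge0 (t alpha : R) : 0 <= t ->
  \int[P]_w cos (t * linear_part n w + alpha) @[n --> \oo] -->
  expR (- (t ^+ 2 * V c / 2)) * cos alpha.
Proof.
move=> t0.
pose r n : R := n%:R / (m n)%:R.
pose delta n := t * ((Num.sqrt n%:R : R)^-1 + Num.sqrt n%:R / (m n)%:R).
pose x n := \int[P]_w cos (t * linear_part n w + alpha).
pose z n := expR (t ^+ 2 * V (r n) / 2) * x n - cos alpha.
have cvg_delta : delta n @[n --> \oo] --> (0 : R).
  have h := cvgM (cvg_cst t) (cvgD cvg_inv_sqrt cvg_sqrt_div).
  by rewrite addr0 mulr0 in h; exact: h.
have cvg_V : t ^+ 2 * V (r n) / 2 @[n --> \oo] --> t ^+ 2 * V c / 2.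
  apply: cvgM; last exact: cvg_cst.
  apply: cvgM; first exact: cvg_cst.
  apply: cvgD; first exact: cvg_cst.
  by apply: cvgM; [exact: m_cvg|exact: cvg_cst].
suff cvg_z : z n @[n --> \oo] --> (0 : R).
  have h : expR (- (t ^+ 2 * V (r n) / 2)) * (z n + cos alpha) @[n --> \oo] -->
      expR (- (t ^+ 2 * V c / 2)) * (0 + cos alpha).
    apply: cvgM; last by apply: cvgD => //; exact: cvg_cst.
    exact: (cvg_comp _ _ (cvgN cvg_V) (@continuous_expR R _)).
  rewrite add0r in h; apply: cvg_trans h; apply: near_eq_cvg; apply: nearW => n.
  by rewrite /z subrK mulrA -expRD addNr expR0 mul1r.
pose Cs := Num.max `|lrv xi| `|lrv eta|.
have Cs0 : 0 <= Cs by rewrite le_max normr_ge0.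
pose A0 := t ^+ 2 * (2 + c).
have A00 : 0 <= A0 by rewrite mulr_ge0 ?sqr_ge0// addr_ge0.
pose K0 := expR (Cs * A0 / 2).
have K00 : 0 < K0 by exact: expR_gt0.
apply/cvgr0Pnorm_le => e e0.
(* Makes [3 * K0 * A0 * tau] at most [e / 3]. The choice of [tau] fixes [p]; [tau'] depends on [p]
   and then fixes [q]. *)
pose tau := e / (3 * (3 * K0 * A0 + 1)).
have KA0 : 0 <= K0 * A0 by rewrite mulr_ge0// ltW.
have tau0 : 0 < tau by rewrite divr_gt0// mulr_gt0// ltr_wpDl// -mulrA mulr_ge0.
have [L L0 tailL] := sum_betaR_tail beta2_summable tau0.
pose p := L.-1.
have tail M : \sum_(p.+1 <= k < M) beta k <= tau by rewrite /p prednK.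
pose tau' := e / (3 * (K0 * A0 * p.+1%:R * 3 + 1)).
have tau'0 : 0 < tau'.
  by rewrite divr_gt0// mulr_gt0// ltr_wpDl// mulr_ge0// mulr_ge0.
have [L' L'0 tailL'] := sum_betaR_tail beta2_summable tau'0.
pose q := L'.-1.
have betaq : beta q.+1 <= tau'.
  by have := tailL' L'.+1; rewrite big_nat1 /q prednK.
pose B (dl : R) := K0 *
  (A0 * (dl + (p.+1%:R * ((p + q + q).+1%:R * dl + 3 * beta q.+1) + tau)) +
  (2 * tau * A0 + 2 * p%:R * ((2 * p%:R + 1 + Cs) * dl ^+ 2)) + Cs ^+ 2 * dl ^+ 2 * A0).
(* At [delta = 0] two terms of at most [e / 3] remain; the strict inequality leaves room to replace
   0 by [delta n]. *)
have B0 : B 0 < e.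
  have e3 : 0 < e / 3 by rewrite divr_gt0.
  have yy (y : R) : 0 <= y -> y / (y + 1) <= 1.
    by move=> y0; rewrite ler_pdivrMr; lra.
  have h1 : K0 * A0 * p.+1%:R * 3 * beta q.+1 <= e / 3.
    have h0 : 0 <= K0 * A0 * p.+1%:R * 3 by rewrite mulr_ge0// mulr_ge0.
    apply: (le_trans (ler_wpM2l h0 betaq)); rewrite /tau'.
    move: h0; move: (K0 * A0 * p.+1%:R * 3) => y y0.
    rewrite (_ : y * _ = e / 3 * (y / (y + 1))); last by field; lra.
    exact: (ler_piMr (ltW e3) (yy _ y0)).
  have h2 : 3 * K0 * A0 * tau <= e / 3.
    rewrite /tau; have : 0 <= 3 * K0 * A0 by rewrite -mulrA mulr_ge0.
    move: (3 * K0 * A0) => y y0.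
    rewrite (_ : y * _ = e / 3 * (y / (y + 1))); last by field; lra.
    exact: (ler_piMr (ltW e3) (yy _ y0)).
  have -> : B 0 = K0 * A0 * p.+1%:R * 3 * beta q.+1 + 3 * K0 * A0 * tau.
    by rewrite /B; ring.
  lra.
have cvg_B : B (delta n) @[n --> \oo] --> B 0.
  rewrite /B.
  have d2 : delta n ^+ 2 @[n --> \oo] --> (0 ^+ 2 : R).
    by under eq_fun do rewrite expr2; rewrite expr2; exact: cvgM.
  have cM (a : R) (u : nat -> R) (l : R) : u n @[n --> \oo] --> l ->
      a * u n @[n --> \oo] --> a * l.
    by move=> ul; apply: cvgM => //; exact: cvg_cst.
  have cDr (a : R) (u : nat -> R) (l : R) : u n @[n --> \oo] --> l ->
      u n + a @[n --> \oo] --> l + a.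
    by move=> ul; apply: cvgD => //; exact: cvg_cst.
  have cDl (a : R) (u : nat -> R) (l : R) : u n @[n --> \oo] --> l ->
      a + u n @[n --> \oo] --> a + l.
    by move=> ul; apply: cvgD => //; exact: cvg_cst.
  have cMr (a : R) (u : nat -> R) (l : R) : u n @[n --> \oo] --> l ->
      u n * a @[n --> \oo] --> l * a.
    by move=> ul; apply: cvgM => //; exact: cvg_cst.
  apply: (cM); apply: cvgD; last by apply: cMr; apply: (cM).
  apply: cvgD; last by apply: cDl; apply: (cM); apply: (cM).
  apply: (cM); apply: cvgD => //.
  by apply: (cDr); apply: (cM); apply: (cDr); apply: (cM).
have cvg_r : r n @[n --> \oo] --> c by exact: m_cvg.
near=> n.
have n0 : (0 < n)%N by near: n; exact: nbhs_infty_gt.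
have rn : r n <= 1 + c.
  by near: n; apply: (cvgr_le c) => //; rewrite ltrDr.
have delta1 : delta n <= 1.
  by near: n; apply: (cvgr_le 0).
have Csd : Cs * delta n ^+ 2 <= 1.
  near: n; apply: (cvgr_le (Cs * (0 * 0))); last by rewrite !mulr0.
  apply: cvgM; first exact: cvg_cst.
  by under eq_fun do rewrite expr2; exact: cvgM.
have Bn : B (delta n) <= e.
  by near: n; exact: (cvgr_le (B 0)).
have delta0 : 0 <= delta n.
  by rewrite mulr_ge0// addr_ge0// ?divr_ge0// invr_ge0.
have s1C : `|lrv xi| <= Cs by rewrite le_max lexx.
have s2C : `|lrv eta| <= Cs by rewrite le_max lexx orbT.
have := two_block_clt_bound X_stationary Q1X Q2X beta2_summable rxi reta
  q alpha n0 (m_gt0 n) t0 delta1 tail (lrv_tail rxi tail) (lrv_tail reta tail)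
  s1C s2C Csd.
rewrite -/(r n) -/(delta n).
set A := t ^+ 2 * (1 + r n).
have A_le : A <= A0.
  by rewrite /A /A0 ler_wpM2l ?sqr_ge0//; lra.
have A_ge : 0 <= A by rewrite mulr_ge0 ?sqr_ge0// addr_ge0// divr_ge0.
move=> h; apply: le_trans Bn.
have zE : z n = expR (t ^+ 2 * (lrv xi + r n * lrv eta) / 2) *
    (\int[P]_w cos (\sum_(i < n + m n)
      (if (i < n)%N then t / Num.sqrt n%:R else t * (Num.sqrt n%:R / (m n)%:R)) *
      (if (i < n)%N then xi else eta) (X i.+1%:Z w) + alpha)) - cos alpha.
  rewrite /z; congr (_ * _ - _); apply: eq_Rintegral => w _; congr (cos (_ + _)).
  rewrite -(big_mkord xpredT (fun i : nat =>
    (if (i < n)%N then t / Num.sqrt n%:R else t * (Num.sqrt n%:R / (m n)%:R)) *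
    (if (i < n)%N then xi else eta) (X i.+1%:Z w))).
  rewrite (@big_cat_nat _ _ _ n)//= ?leq_addr//.
  rewrite /linear_part mulrDr mulrDr; congr (_ + _).
    rewrite !mulr_sumr; apply: eq_big_nat => i /andP[_ ->].
    rewrite !mulrA; congr (_ * _).
    have sn0 : Num.sqrt n%:R != 0 :> R by rewrite gt_eqF// sqrtr_gt0 ltr0n.
    rewrite -[X in _ * X^-1](@sqr_sqrtr R n%:R)//.
    by field.
  rewrite !mulr_sumr; apply: eq_big_nat => i /andP[ni _].
  by rewrite ltnNge ni/= !mulrA.
rewrite zE; apply: (le_trans h).
have D0 : 0 <= p.+1%:R * ((p + q + q).+1%:R * delta n + 3 * beta q.+1) + tau.
  by rewrite addr_ge0 ?(ltW tau0)// mulr_ge0// addr_ge0// mulr_ge0// betaR_ge0.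
have Q0 : 0 <= 2 * p%:R * ((2 * p%:R + 1 + Cs) * delta n ^+ 2).
  by rewrite mulr_ge0// mulr_ge0 ?sqr_ge0// addr_ge0// addr_ge0.
have S0 : 0 <= Cs ^+ 2 * delta n ^+ 2 by rewrite mulr_ge0 ?sqr_ge0.
apply: ler_pM; rewrite ?expR_ge0//.
- apply: addr_ge0; last exact: mulr_ge0.
  apply: addr_ge0; first by rewrite mulr_ge0// addr_ge0.
  by apply: addr_ge0 => //; rewrite mulr_ge0// mulr_ge0// ltW.
- by rewrite ler_expR ler_pM2r// ler_wpM2l.
- apply: lerD; last by rewrite ler_wpM2l// mulr_ge0 ?sqr_ge0.
  apply: lerD; last by rewrite lerD2r ler_wpM2l// mulr_ge0// ltW.
  by rewrite ler_wpM2r// addr_ge0.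
Unshelve. all: end_near.
Qed.

Lemma cvg_cos_linear_part (t alpha : R) :
  \int[P]_w cos (t * linear_part n w + alpha) @[n --> \oo] -->
  expR (- (t ^+ 2 * V c / 2)) * cos alpha.
Proof.
have [t0|t0] := leP 0 t; first exact: cvg_cos_linear_part_ge0.
have := @cvg_cos_linear_part_ge0 (- t) (- alpha).
rewrite oppr_ge0 sqrrN cosN => /(_ (ltW t0)); apply: cvg_trans.
apply: near_eq_cvg; apply: nearW => n; apply: eq_Rintegral => w _.
by rewrite mulNr -opprD cosN.
Qed.

End two_block_limit.

(** * The Hoeffding decomposition of the Mann-Whitney statistic *)

Section hoeffding.
Context d (T : measurableType d) (R : realType) (P : probability T R).
Variable X : int -> {RV P >-> R}.
Hypothesis X_stationary : strictly_stationary X.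
Variable f : R -> R.
Hypothesis f_mono : {homo f : x y / x <= y} \/ {homo f : x y /~ x <= y}.
Local Notation mu0 := (distribution P (X 0)).

Definition mw_kernel (z : R * R) : R := (z.1 < f z.2)%R%:R.
Definition mw_mean1 y := \int[mu0]_x mw_kernel (x, y).
Definition mw_mean2 x := \int[mu0]_y mw_kernel (x, y).
Definition mw_mean := \int[mu0]_x mw_mean2 x.
Definition mw_proj1 x := mw_mean2 x - mw_mean.
Definition mw_proj2 y := mw_mean1 y - mw_mean.
Definition mw_rem (z : R * R) :=
  mw_kernel z - mw_mean2 z.1 - mw_mean1 z.2 + mw_mean.

Lemma bmeas_mw_kernel : bmeas mw_kernel.
Proof.
apply: bmeas_bool; apply: measurable_fun_ltr; first exact: measurable_fst.
exact: measurableT_comp (measurable_monotonic f_mono) measurable_snd.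
Qed.

Lemma bmeas_mw_mean1 : bmeas mw_mean1.
Proof. exact: bmeas_Ex1 bmeas_mw_kernel. Qed.

Lemma bmeas_mw_mean2 : bmeas mw_mean2.
Proof. exact: bmeas_Ex2 bmeas_mw_kernel. Qed.

Lemma bmeas_mw_rem : bmeas mw_rem.
Proof.
apply: bmeasD; last exact: bmeas_cst.
apply: bmeasB; last exact: bmeas_comp measurable_snd bmeas_mw_mean1.
apply: bmeasB; first exact: bmeas_mw_kernel.
exact: bmeas_comp measurable_fst bmeas_mw_mean2.
Qed.

Lemma ray_average_mw_kernel1 y :
  ray_average X 1 (fun x => mw_kernel (x, y) - mw_mean1 y).
Proof. exact: (ray_average_lt X (f y)). Qed.

Lemma ray_average_mw_kernel2 x :
  ray_average X 1 (fun y => mw_kernel (x, y) - mw_mean2 x).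
Proof. exact: (ray_average_lt_f X f_mono x). Qed.

(** The projection is the average over [y] of the centred sections [x |-> 1_{x < f(y)}]; Fubini
    identifies the mean. *)
Lemma ray_average_mw_proj1 : ray_average X 1 mw_proj1.
Proof.
have bG : bmeas (fun z : R * R => mw_kernel (z.2, z.1) - mw_mean1 z.1).
  apply: bmeasB; last exact: bmeas_comp measurable_fst bmeas_mw_mean1.
  apply: (bmeas_comp (p := fun z : R * R => (z.2, z.1))) bmeas_mw_kernel.
  by apply: measurable_fun_pair.
have := ray_average_Ex mu0 bG ray_average_mw_kernel1.
congr ray_average; apply/funext => x /=.
rewrite ExB; last 2 first.
- exact: bmeas_pair1 bmeas_mw_kernel.
- exact: bmeas_mw_mean1.
by rewrite /mw_proj1 /mw_mean (Ex_fubini _ _ bmeas_mw_kernel).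
Qed.

Lemma ray_average_mw_proj2 : ray_average X 1 mw_proj2.
Proof.
have bG : bmeas (fun z : R * R => mw_kernel z - mw_mean2 z.1).
  apply: bmeasB; first exact: bmeas_mw_kernel.
  exact: bmeas_comp measurable_fst bmeas_mw_mean2.
have := ray_average_Ex mu0 bG ray_average_mw_kernel2.
congr ray_average; apply/funext => y /=.
rewrite ExB//; last 2 first.
- exact: bmeas_pair2 bmeas_mw_kernel.
- exact: bmeas_mw_mean2.
Qed.

(** A centred section minus the projection: two ray averages of weight 1, hence weight 2. *)
Lemma ray_average_mw_rem1 y : ray_average X 2 (fun x => mw_rem (x, y)).
Proof.
have := ray_averageB (ray_average_mw_kernel1 y) ray_average_mw_proj1.
congr ray_average; apply/funext => x.
by rewrite /mw_rem /mw_proj1/=; ring.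
Qed.

Lemma ray_average_mw_rem2 x : ray_average X 2 (fun y => mw_rem (x, y)).
Proof.
have := ray_averageB (ray_average_mw_kernel2 x) ray_average_mw_proj2.
congr ray_average; apply/funext => y.
by rewrite /mw_rem /mw_proj2/=; ring.
Qed.

(** [H_Y] is defined with [X 1] and the projections with the law of [X 0]; stationarity identifies
    the two. *)
Lemma H_Y_mw_mean2 : H_Y X f = mw_mean2.
Proof.
apply/funext => x.
have bk := bmeas_pair1 x bmeas_mw_kernel.
rewrite /mw_mean2 Ex_distribution// -(stationary_law X_stationary 1 bk).
rewrite /H_Y -Ex_indic; last first.
  rewrite -[X in measurable X]setTI.
  apply: (measurable_fun_ltr (f := cst x) (g := f \o X 1)) => //.
  exact: measurableT_comp (measurable_monotonic f_mono) _.
by apply: eq_Rintegral => w _; rewrite indicE mem_setE.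
Qed.

Lemma G_X_mw_mean1 : G_X X \o f = mw_mean1.
Proof.
apply/funext => y /=.
have bk := bmeas_pair2 y bmeas_mw_kernel.
rewrite /mw_mean1 Ex_distribution// -(stationary_law X_stationary 1 bk).
rewrite /G_X -Ex_indic; last first.
  rewrite -[X in measurable X]setTI.
  exact: (measurable_fun_ltr (f := X 1) (g := cst (f y))).
by apply: eq_Rintegral => w _; rewrite indicE mem_setE.
Qed.

Lemma MW_pi_mw_mean : MW_pi X f = mw_mean.
Proof.
have bk : bmeas (fun w : T * T => mw_kernel (X 1 w.1, X 1 w.2)).
  apply: (bmeas_comp (p := fun w : T * T => (X 1 w.1, X 1 w.2))) bmeas_mw_kernel.
  by apply: measurable_fun_pair; exact: measurableT_comp.
rewrite /MW_pi -Ex_indic; last first.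
  rewrite -[X in measurable X]setTI.
  apply: (measurable_fun_ltr (f := X 1 \o fst) (g := f \o X 1 \o snd)) => //.
  - exact: measurableT_comp.
  - apply: measurableT_comp (measurable_snd).
    exact: measurableT_comp (measurable_monotonic f_mono) _.
transitivity (\int[(P \x P)%E]_w mw_kernel (X 1 w.1, X 1 w.2)).
  by apply: eq_Rintegral => w _; rewrite indicE mem_setE.
rewrite Ex_prod//= /mw_mean Ex_distribution//; last exact: bmeas_mw_mean2.
rewrite -(stationary_law X_stationary 1 bmeas_mw_mean2).
apply: eq_Rintegral => w _; have bkw := bmeas_pair1 (X 1 w) bmeas_mw_kernel.
by rewrite /mw_mean2 Ex_distribution// -(stationary_law X_stationary 1 bkw).
Qed.

Lemma MW_U_decomposition n m w : (0 < n)%N -> (0 < m)%N ->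
  MW_U X f n m w - MW_pi X f =
  n%:R^-1 * (\sum_(0 <= k < n) mw_proj1 (X k.+1%:Z w)) +
  m%:R^-1 * (\sum_(n <= k < n + m) mw_proj2 (X k.+1%:Z w)) +
  (n%:R * m%:R)^-1 * \sum_(0 <= i < n) \sum_(n <= j < n + m)
    mw_rem (X i.+1%:Z w, X j.+1%:Z w).
Proof.
move=> n0 m0; rewrite MW_pi_mw_mean /MW_U big_add1/=.
have E i j : (X i%:Z w < f (X j%:Z w))%R%:R =
    mw_proj1 (X i%:Z w) + mw_proj2 (X j%:Z w) + mw_rem (X i%:Z w, X j%:Z w) +
    mw_mean.
  rewrite /mw_proj1 /mw_proj2 /mw_rem /mw_kernel/=.
  move: (_%:R) (mw_mean1 _) (mw_mean2 _) mw_mean => a b1 b2 c.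
  by ring.
have -> : \sum_(0 <= i < n) \sum_(n.+1 <= j < (n + m).+1)
    (X i.+1%:Z w < f (X j%:Z w))%R%:R =
    m%:R * (\sum_(0 <= k < n) mw_proj1 (X k.+1%:Z w)) +
    n%:R * (\sum_(n <= k < n + m) mw_proj2 (X k.+1%:Z w)) +
    \sum_(0 <= i < n) \sum_(n <= j < n + m)
      mw_rem (X i.+1%:Z w, X j.+1%:Z w) + n%:R * (m%:R * mw_mean).
  transitivity (\sum_(0 <= i < n) (m%:R * mw_proj1 (X i.+1%:Z w) +
      (\sum_(n <= k < n + m) mw_proj2 (X k.+1%:Z w)) +
      (\sum_(n <= j < n + m) mw_rem (X i.+1%:Z w, X j.+1%:Z w)) + m%:R * mw_mean)).
    apply: eq_bigr => i _; rewrite big_add1/=.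
    rewrite (eq_bigr _ (fun j _ => E i.+1 j.+1)) 3!big_split/=.
    by rewrite !sumr_const_nat addKn !mulr_natl.
  by rewrite 3!big_split/= !sumr_const_nat subn0 -mulr_sumr !mulr_natl.
have nR : n%:R != 0 :> R by rewrite pnatr_eq0 -lt0n.
have mR : m%:R != 0 :> R by rewrite pnatr_eq0 -lt0n.
move: (\sum_(_ <= _ < _) _) (\sum_(_ <= _ < _) _) (\sum_(_ <= _ < _) _) mw_mean.
move=> a b1 b2 c'; field.
by rewrite nR mR.
Qed.

End hoeffding.

(** * The degenerate remainder *)

Local Notation distn i j := `|i%:Z - j%:Z|%N.

Lemma sum_sub_le (R : realDomainType) (phi : nat -> R) S n i :
  (forall l, 0 <= phi l) -> (forall N, \sum_(0 <= l < N) phi l <= S) ->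
  \sum_(0 <= j < n) (if (j <= i)%N then phi (i - j)%N else 0) <= S.
Proof.
move=> phi0 phiS; apply: le_trans (phiS i.+1).
apply: (@le_trans _ _ (\sum_(0 <= j < maxn n i.+1)
    (if (j <= i)%N then phi (i - j)%N else 0))).
  rewrite (big_cat_nat (leq0n n) (leq_maxl n i.+1))/= lerDl.
  by apply: sumr_ge0 => j _; case: ifP.
rewrite (big_cat_nat (leq0n i.+1) (leq_maxr n i.+1))/=.
rewrite [X in _ + X]big_nat_cond [X in _ + X]big1 ?addr0; last first.
  by move=> j /andP[/andP[ij _] _]; rewrite leqNgt ij.
rewrite big_nat_rev/= add0n le_eqVlt; apply/orP; left; apply/eqP.
apply: eq_big_nat => j /andP[_ ji].
by rewrite subSS leq_subr subKn.
Qed.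

(** The double sum is split along the diagonal into [F i j + F j i]; every row of each half is a
    partial sum of [phi]. *)
Lemma sum_distn_le (R : realDomainType) (phi : nat -> R) S n :
  (forall l, 0 <= phi l) -> (forall N, \sum_(0 <= l < N) phi l <= S) ->
  \sum_(0 <= i < n) \sum_(0 <= j < n) phi (distn i j) <= n%:R * (2 * S).
Proof.
move=> phi0 phiS; pose F i j := if (j <= i)%N then phi (i - j)%N else 0.
apply: (@le_trans _ _ (\sum_(0 <= i < n) \sum_(0 <= j < n) (F i j + F j i))).
  apply: ler_sum => i _; apply: ler_sum => j _; rewrite /F.
  case: (ltngtP i j) => [ij|ji|->].
  - by rewrite (IntDist.distnEr (ltnW ij)) add0r.
  - by rewrite (IntDist.distnEl (ltnW ji)) addr0.
  - by rewrite IntDist.distnn subnn lerDl.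
under eq_bigr do rewrite big_split/=.
rewrite big_split/= [X in _ + X]exchange_big/=.
rewrite (_ : n%:R * (2 * S) = n%:R * S + n%:R * S); last by ring.
have le_nS : \sum_(0 <= i < n) \sum_(0 <= j < n) F i j <= n%:R * S.
  apply: (@le_trans _ _ (\sum_(0 <= i < n) S)).
    by apply: ler_sum => i _; exact: sum_sub_le.
  by rewrite sumr_const_nat subn0 mulr_natl.
exact: lerD.
Qed.

Section remainder.
Context d (T : measurableType d) (R : realType) (P : probability T R).
Variable X : int -> {RV P >-> R}.
Local Notation TG := (g_sigma_algebraType (past_events X)).
Variable Q1 : int -> R.-pker TG ~> R.
Variable Q2 : int -> int -> R.-pker TG ~> (R * R)%type.
Hypothesis X_stationary : strictly_stationary X.
Hypothesis Q1X : forall k : int, is_cond_distribution (P := P) (X k) (Q1 k).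
Hypothesis Q2X : forall i j : int,
  is_cond_distribution (P := P) (pairRV (X i) (X j)) (Q2 i j).
Hypothesis beta2_summable : (\sum_(1 <= k <oo) beta2 Q1 Q2 k < +oo)%E.
Local Notation beta := (betaR Q1 Q2).
Local Notation mixing1 := (mixing_time1 X_stationary Q1X beta2_summable).
Local Notation mixing2 := (mixing_time2 X_stationary Q1X Q2X beta2_summable).

Lemma cov_ray_average (g h : R -> R) M (i : int) (k : nat) : (0 < k)%N -> 0 < M ->
  ray_average X M g -> ray_average X M h ->
  `|\int[P]_w (g (X i w) * h (X (i + k%:Z) w))| <= M * M * beta k.
Proof.
move=> k0 M0 rg rh; have bg := ray_average_bmeas rg; have bh := ray_average_bmeas rh.
pose Phi (z : 1.-tuple R * R) := g (tnth z.1 ord0) * h z.2.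
have bPhi : bmeas Phi.
  apply: bmeasM; last exact: bmeas_comp.
  apply: (bmeas_comp (p := fun z : 1.-tuple R * R => tnth z.1 ord0)) => //.
  by apply: (measurableT_comp (measurable_tnth ord0)).
have ti (j : 'I_1) : tnth [tuple i] j <= i by rewrite (tnth_nth 0) ord1.
have PhiE x : exists c g', [/\ `|c| <= M, ray_average X M g' &
    forall y, Phi (x, y) = c * g' y].
  exists (g (tnth x ord0)), h; split => //.
  exact: ray_average_le rg _.
have := mixing1 ti k0 bPhi PhiE M0 M0; apply: le_trans.
rewrite le_eqVlt; apply/orP; left; apply/eqP; congr `|_|.
by apply: eq_Rintegral => w _; rewrite /Phi/= tnth_mktuple.
Qed.

Lemma cov_ray_average_distn (g h : R -> R) M (i j : nat) : 0 < M ->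
  ray_average X M g -> ray_average X M h ->
  `|\int[P]_w (g (X i%:Z w) * h (X j%:Z w))| <=
  M * M * (if distn i j == 0 then 1 else beta (distn i j)).
Proof.
move=> M0 rg rh; case: (ltngtP i j) => [ij|ji|<-].
- rewrite (IntDist.distnEr (ltnW ij)) subn_eq0 leqNgt ij/=.
  have ji0 : (0 < j - i)%N by rewrite subn_gt0.
  have := cov_ray_average i%:Z ji0 M0 rg rh.
  by rewrite -PoszD subnKC// ltnW.
- rewrite (IntDist.distnEl (ltnW ji)) subn_eq0 leqNgt ji/=.
  have ij0 : (0 < i - j)%N by rewrite subn_gt0.
  have := cov_ray_average j%:Z ij0 M0 rh rg.
  rewrite -PoszD subnKC 1?ltnW//.
  by under eq_Rintegral do rewrite mulrC.
- rewrite IntDist.distnn eqxx mulr1; apply: Ex_bound => [|w].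
    apply: measurable_funM.
    + exact: measurableT_comp (ray_average_measurable rg) _.
    + exact: measurableT_comp (ray_average_measurable rh) _.
  rewrite normrM; apply: ler_pM => //.
  + exact: ray_average_le rg _.
  + exact: ray_average_le rh _.
Qed.

Variable r : R * R -> R.
Hypothesis br : bmeas r.
Hypothesis r1 : forall y, ray_average X 2 (fun x => r (x, y)).
Hypothesis r2 : forall x, ray_average X 2 (fun y => r (x, y)).

Let r_le z : `|r z| <= 2.
Proof. by case: z => x y; exact: ray_average_le (r1 y) x. Qed.

Lemma remainder_mixing (i i' s : int) (k l : nat) : (0 < k)%N -> (0 < l)%N ->
  i <= s -> i' <= s ->
  `|\int[P]_w (r (X i w, X (s + k%:Z) w) * r (X i' w, X (s + l%:Z) w)) -
    \int[P]_w \int[P]_w' (r (X i w, X (s + k%:Z) w') * r (X i' w, X (s + l%:Z) w'))|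
  <= 12 * (beta k + beta l).
Proof.
(* [mixing_time2] orders its lags and its bound is [3 * 2 * 2] times [beta] of the smaller one;
   adding [beta] of the other makes the bound symmetric. *)
wlog lk : i i' k l / (l <= k)%N => [h k0 l0 si si'|].
  have [lk|/ltnW kl] := leqP l k; first exact: h.
  rewrite [beta k + _]addrC; apply: le_trans (h i' i l k kl l0 k0 si' si).
  rewrite le_eqVlt; apply/orP; left; apply/eqP; congr (`|_ - _|).
    by apply: eq_Rintegral => w _; rewrite mulrC.
  by apply: eq_Rintegral => w _; apply: eq_Rintegral => w' _; rewrite mulrC.
move=> k0 l0 si si'.
pose Phi (z : 2.-tuple R * (R * R)) :=
  r (tnth z.1 ord0, z.2.1) * r (tnth z.1 (lift ord0 ord0), z.2.2).
have mt (a : 'I_2) : measurable_fun setT (fun z : 2.-tuple R * (R * R) => tnth z.1 a).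
  exact: (measurableT_comp (measurable_tnth a)).
have bPhi : bmeas Phi.
  apply: bmeasM.
  - apply: (bmeas_comp (p := fun z : 2.-tuple R * (R * R) => (tnth z.1 ord0, z.2.1))) => //.
    by apply: measurable_fun_pair => //; exact: measurableT_comp.
  - apply: (bmeas_comp (p := fun z : 2.-tuple R * (R * R) =>
      (tnth z.1 (lift ord0 ord0), z.2.2))) => //.
    by apply: measurable_fun_pair => //; exact: measurableT_comp.
have ts (a : 'I_2) : tnth [tuple i; i'] a <= s.
  by rewrite (tnth_nth 0); case: a => [[|[|]]].
have PhiE x : exists c g h, [/\ `|c| <= 1, ray_average X 2 g, ray_average X 2 h
    & forall y, Phi (x, y) = c * (g y.1 * h y.2)].
  exists 1, (fun y => r (tnth x ord0, y)), (fun y => r (tnth x (lift ord0 ord0), y)).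
  by split => [|||y]; rewrite ?normr1// mul1r.
have lk' : (0 < l <= k)%N by rewrite l0.
have := mixing2 ts lk' bPhi PhiE ltr01 (ltr0Sn R 1) (ltr0Sn R 1).
rewrite /Phi/=.
have E w : [tuple X (tnth [tuple i; i'] a) w | a < 2] = [tuple X i w; X i' w].
  by apply: eq_from_tnth => a; rewrite tnth_mktuple !(tnth_nth 0); case: a => [[|[|]]].
under eq_Rintegral do rewrite E !(tnth_nth 0)/=.
under [X in _ - X]eq_Rintegral do under eq_Rintegral do rewrite E !(tnth_nth 0)/=.
move=> /le_trans; apply.
have := betaR_ge0 Q1 Q2 k; have := betaR_ge0 Q1 Q2 l; move: (beta k) (beta l) => a b.
lra.
Qed.

(** Bounds the covariance at distance [l] of two ray averages of weight 2; at distance 0 only their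
    sizes help. *)
Let h l : R := if l == 0%N then 4 else 4 * beta l.

(** For independent samples either one can be frozen; the other then contributes a covariance of two
    sections of [r], both centred. *)
Lemma remainder_decoupled (i i' j j' : nat) :
  `|\int[P]_w \int[P]_w' (r (X i%:Z w, X j%:Z w') * r (X i'%:Z w, X j'%:Z w'))|
  <= Num.min (h (distn i i')) (h (distn j j')).
Proof.
have bF : bmeas (fun z : T * T =>
    r (X i%:Z z.1, X j%:Z z.2) * r (X i'%:Z z.1, X j'%:Z z.2)).
  have mX (k : int) : measurable_fun setT (X k) by [].
  apply: bmeasM.
  - apply: (bmeas_comp (p := fun z : T * T => (X i%:Z z.1, X j%:Z z.2))) => //.
    by apply: measurable_fun_pair; exact: measurableT_comp.
  - apply: (bmeas_comp (p := fun z : T * T => (X i'%:Z z.1, X j'%:Z z.2))) => //.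
    by apply: measurable_fun_pair; exact: measurableT_comp.
have hE l : 2 * 2 * (if l == 0 then 1 else beta l) = h l :> R.
  by rewrite /h; case: eqP => _; ring.
rewrite le_min; apply/andP; split.
- rewrite (Ex_fubini P P bF)/=; apply: Ex_bound => [|w'].
    by case: (bmeas_Ex1 P bF).
  have := cov_ray_average_distn i i' (ltr0Sn R 1) (r1 (X j%:Z w')) (r1 (X j'%:Z w')).
  by rewrite -hE.
- apply: Ex_bound => [|w]; first by case: (bmeas_Ex2 P bF).
  have := cov_ray_average_distn j j' (ltr0Sn R 1) (r2 (X i%:Z w)) (r2 (X i'%:Z w)).
  by rewrite -hE.
Qed.

Let h_ge0 l : 0 <= h l.
Proof. by rewrite /h; case: eqP => // _; rewrite mulr_ge0// betaR_ge0. Qed.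

Let sum_h_le B N : (forall N, \sum_(1 <= l < N) beta l <= B) ->
  \sum_(0 <= l < N) h l <= 4 * (1 + B).
Proof.
move=> sumB; case: N => [|N].
  rewrite big_geq// mulr_ge0// addr_ge0//.
  by have := sumB 1%N; rewrite big_geq.
rewrite big_ltn//= {1}/h eqxx mulrDr mulr1 lerD2l.
apply: le_trans (ler_wpM2l _ (sumB N.+1)) => //.
rewrite mulr_sumr big_nat_cond [leRHS]big_nat_cond.
by apply: ler_sum => l /andP[/andP[l0 _] _]; rewrite /h gtn_eqF.
Qed.

Let sum_h_tail L tau N : (0 < L)%N -> (forall N, \sum_(L <= l < N) beta l <= tau) ->
  \sum_(0 <= l < N) (if (L <= l)%N then h l else 0) <= 4 * tau.
Proof.
move=> L0 tail; apply: (@le_trans _ _ (4 * \sum_(L <= l < maxn L N) beta l)); last first.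
  by rewrite ler_wpM2l.
apply: (@le_trans _ _ (\sum_(0 <= l < maxn L N) (if (L <= l)%N then h l else 0))).
  rewrite (big_cat_nat (leq0n N) (leq_maxr L N))/= lerDl sumr_ge0// => l _.
  by case: ifP.
rewrite (big_cat_nat (leq0n L) (leq_maxl L N))/= big_nat_cond big1 ?add0r; last first.
  by move=> l /andP[/andP[_ lL] _]; rewrite leqNgt lL.
rewrite mulr_sumr big_nat_cond [leRHS]big_nat_cond.
apply: ler_sum => l /andP[/andP[Ll _] _]; rewrite Ll /h gtn_eqF//.
exact: leq_trans Ll.
Qed.

Let E (n i i' a b : nat) := \int[P]_w
  (r (X i.+1%:Z w, X (n + a).+1%:Z w) * r (X i'.+1%:Z w, X (n + b).+1%:Z w)).

(** The minimum is spent according to the distance in the first sample. Pairs closer than [L] are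
    few, about [n * L], and use the decay in the second sample; the others use a tail of [h] in the
    first. *)
Let E_le n i i' a b L : (i < n)%N -> (i' < n)%N ->
  E n i i' a b <= 12 * (beta a.+1 + beta b.+1) +
    ((distn i i' < L)%N%:R * h (distn a b) +
     (if (L <= distn i i')%N then h (distn i i') else 0)).
Proof.
move=> lt_in lt_i'n.
have := @remainder_mixing i.+1%:Z i'.+1%:Z n%:Z a.+1 b.+1 isT isT.
rewrite !lez_nat => /(_ lt_in lt_i'n); rewrite -!PoszD !addnS -/(E n i i' a b).
have := remainder_decoupled i.+1 i'.+1 (n + a).+1 (n + b).+1.
have -> : distn i.+1 i'.+1 = distn i i' := IntDist.distnDl 1 i i'.
have -> : distn (n + a).+1 (n + b).+1 = distn a b := IntDist.distnDl n.+1 a b.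
move: (Rintegral _ _ _) (E _ _ _ _ _) => I J.
rewrite le_min => /andP[h1 h2] h3.
have [J1 I1 I2] : [/\ J - I <= 12 * (beta a.+1 + beta b.+1),
    I <= h (distn i i') & I <= h (distn a b)].
  split; [exact: le_trans (ler_norm _) h3|exact: le_trans (ler_norm _) h1|].
  exact: le_trans (ler_norm _) h2.
move: J1 I1 I2; move: (12 * _) (h (distn i i')) (h (distn a b)) => x y z.
rewrite ltnNge lerBlDr; case: (L <= distn i i')%N => /= J1 I1 I2.
  by rewrite mul0r add0r; apply: (le_trans J1); rewrite lerD2l.
by rewrite mul1r addr0; apply: (le_trans J1); rewrite lerD2l.
Qed.

Let sum_widen (F : nat -> R) g m : (forall a, 0 <= F a) ->
  \sum_(g <= a < m) F a <= \sum_(0 <= a < m) F a.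
Proof.
move=> F0; have [gm|/ltnW mg] := leqP g m.
  by rewrite (big_cat_nat (leq0n g) gm)/= lerDr sumr_ge0.
by rewrite big_geq// sumr_ge0.
Qed.

(** Multiplied by [n / (n m)^2], the three terms become [24 tau n / m], a constant over [m], and
    [8 tau']: small once [g] and [L] are large, then [n]. *)
Lemma Ex_remainder_sqr (n m g L : nat) B tau tau' : (0 < L)%N ->
  (forall N, \sum_(1 <= l < N) beta l <= B) ->
  (forall N, \sum_(g.+1 <= l < N) beta l <= tau) ->
  (forall N, \sum_(L <= l < N) beta l <= tau') ->
  \int[P]_w ((\sum_(0 <= i < n) \sum_(g <= a < m)
    r (X i.+1%:Z w, X (n + a).+1%:Z w)) ^+ 2) <=
  n%:R ^+ 2 * (24 * m%:R * tau) + n%:R * m%:R * (16 * L%:R * (1 + B)) +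
  n%:R * m%:R ^+ 2 * (8 * tau').
Proof.
move=> L0 sumB tail tail'.
have brX (k l : int) : bmeas (fun w => r (X k w, X l w)).
  by apply: (bmeas_comp (p := fun w => (X k w, X l w))) => //; exact: measurable_fun_pair.
have -> : \int[P]_w ((\sum_(0 <= i < n) \sum_(g <= a < m)
    r (X i.+1%:Z w, X (n + a).+1%:Z w)) ^+ 2) =
    \sum_(0 <= i < n) \sum_(0 <= i' < n) \sum_(g <= a < m) \sum_(g <= b < m)
    E n i i' a b.
  under eq_Rintegral do rewrite expr2 big_distrlr/=.
  under eq_Rintegral do under eq_bigr do under eq_bigr do rewrite big_distrlr/=.
  rewrite Ex_sum => [|i]; last first.
    by do 3!(apply: bmeas_sum => ?); exact: bmeasM.
  apply: eq_bigr => i _; rewrite Ex_sum => [|i']; last first.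
    by do 2!(apply: bmeas_sum => ?); exact: bmeasM.
  apply: eq_bigr => i' _; rewrite Ex_sum => [|a]; last first.
    by apply: bmeas_sum => ?; exact: bmeasM.
  apply: eq_bigr => a _; rewrite Ex_sum// => b; exact: bmeasM.
have B0 : 0 <= B by have := sumB 1%N; rewrite big_geq.
have tau0 : 0 <= tau by have := tail g.+1; rewrite big_geq.
have tau'0 : 0 <= tau' by have := tail' L; rewrite big_geq.
pose F i i' := 24 * m%:R * tau + (distn i i' < L)%N%:R * (m%:R * (2 * (4 * (1 + B)))) +
   m%:R ^+ 2 * (if (L <= distn i i')%N then h (distn i i') else 0).
have FE i i' : (i < n)%N -> (i' < n)%N ->
    \sum_(g <= a < m) \sum_(g <= b < m) E n i i' a b <= F i i'.
  move=> lt_in lt_i'n.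
  pose u : R := if (L <= distn i i')%N then h (distn i i') else 0.
  have u0 : 0 <= u by rewrite /u; case: ifP.
  apply: (@le_trans _ _ (\sum_(g <= a < m) \sum_(g <= b < m)
    (12 * (beta a.+1 + beta b.+1) + ((distn i i' < L)%N%:R * h (distn a b) + u)))).
    by apply: ler_sum => a _; apply: ler_sum => b _; exact: E_le.
  have tailm : \sum_(g <= a < m) beta a.+1 <= tau by have := tail m.+1; rewrite big_add1.
  have cnt x : 0 <= x -> \sum_(g <= a < m) x <= m%:R * x :> R.
    by move=> x0; rewrite sumr_const_nat -[leLHS]mulr_natl ler_wpM2r// ler_nat leq_subr.
  have S1 : \sum_(g <= a < m) \sum_(g <= b < m) (beta a.+1 + beta b.+1) <=
      m%:R * tau + m%:R * tau.
    under eq_bigr do rewrite big_split/=.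
    have le1 : \sum_(g <= a < m) \sum_(g <= b < m) beta b.+1 <= m%:R * tau.
      apply: le_trans (cnt _ _) _ => //; first by rewrite sumr_ge0// => ? _; exact: betaR_ge0.
      by rewrite ler_wpM2l.
    rewrite big_split/=; apply: lerD; last exact: le1.
    by rewrite exchange_big/=; exact: le1.
  have S2 : \sum_(g <= a < m) \sum_(g <= b < m) h (distn a b) <=
      m%:R * (2 * (4 * (1 + B))).
    apply: le_trans (sum_distn_le m h_ge0 (fun N => sum_h_le N sumB)).
    apply: le_trans (sum_widen _ _ _) _; first by move=> a; rewrite sumr_ge0.
    apply: ler_sum => a _.
    by apply: (sum_widen (F := fun b => h (distn a b))) => b; exact: h_ge0.
  have S3 : \sum_(g <= a < m) \sum_(g <= b < m) u <= m%:R ^+ 2 * u.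
    apply: le_trans (cnt _ _) _; first by rewrite sumr_ge0.
    by rewrite expr2 -mulrA ler_wpM2l// cnt.
  under eq_bigr do rewrite !big_split/= -!mulr_sumr.
  rewrite !big_split/= -!mulr_sumr /F -/u -addrA; apply: lerD.
    move: S1; move: (\sum_(_ <= _ < _) _) => x.
    by move: (m%:R * tau) (mulrA 24 m%:R tau) => y <-; lra.
  by apply: lerD => //; rewrite ler_wpM2l.
apply: (@le_trans _ _ (\sum_(0 <= i < n) \sum_(0 <= i' < n) F i i')).
  rewrite big_nat_cond [leRHS]big_nat_cond; apply: ler_sum => i /andP[/andP[_ lt_in] _].
  rewrite big_nat_cond [leRHS]big_nat_cond; apply: ler_sum => i' /andP[/andP[_ lt_i'n] _].
  exact: FE.
rewrite /F; under eq_bigr do rewrite !big_split/=.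
rewrite !big_split/= !sumr_const_nat subn0 -mulrnA.
apply: lerD; first apply: lerD.
- by rewrite -[leLHS]mulr_natl natrM expr2.
- have := @sum_distn_le R (fun l => (l < L)%N%:R) L%:R n (fun=> ler0n _ _).
  move=> /(_ _)/le_trans h'.
  rewrite [leRHS](_ : _ = n%:R * (2 * L%:R) * (m%:R * (2 * (4 * (1 + B)))));
    last by ring.
  under eq_bigr do rewrite -mulr_suml.
  rewrite -mulr_suml ler_wpM2r//; first by rewrite !mulr_ge0// addr_ge0.
  apply: h' => // N; rewrite -natr_sum ler_nat big_mkord.
  by have /= -> := sum_range_minn 0 L N; exact: geq_minl.
- under eq_bigr do rewrite -mulr_sumr.
  rewrite -mulr_sumr.
  have := sum_distn_le n (phi := fun l => if (L <= l)%N then h l else 0)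
    (S := 4 * tau').
  move=> /(_ _ (fun N => sum_h_tail N L0 tail')) h'.
  rewrite [leRHS](_ : _ = m%:R ^+ 2 * (n%:R * (2 * (4 * tau')))); last by ring.
  by rewrite ler_wpM2l ?sqr_ge0//; apply: h' => l; case: ifP.
Qed.

End remainder.

(** * Convergence of the remainder to 0 in mean *)

Section remainder_limit.
Context d (T : measurableType d) (R : realType) (P : probability T R).
Variable X : int -> {RV P >-> R}.
Local Notation TG := (g_sigma_algebraType (past_events X)).
Variable Q1 : int -> R.-pker TG ~> R.
Variable Q2 : int -> int -> R.-pker TG ~> (R * R)%type.
Hypothesis X_stationary : strictly_stationary X.
Hypothesis Q1X : forall k : int, is_cond_distribution (P := P) (X k) (Q1 k).
Hypothesis Q2X : forall i j : int,
  is_cond_distribution (P := P) (pairRV (X i) (X j)) (Q2 i j).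
Hypothesis beta2_summable : (\sum_(1 <= k <oo) beta2 Q1 Q2 k < +oo)%E.
Variable r : R * R -> R.
Hypothesis br : bmeas r.
Hypothesis r1 : forall y, ray_average X 2 (fun x => r (x, y)).
Hypothesis r2 : forall x, ray_average X 2 (fun y => r (x, y)).
Variables (m : nat -> nat) (c : R).
Hypothesis m_gt0 : forall n, (0 < m n)%N.
Hypothesis m_cvg : (n%:R / (m n)%:R : R) @[n --> \oo] --> c.
Hypothesis c0 : 0 <= c.

Definition remainder_part n w : R := Num.sqrt n%:R *
  ((n%:R * (m n)%:R)^-1 * \sum_(0 <= i < n) \sum_(n <= j < n + m n)
    r (X i.+1%:Z w, X j.+1%:Z w)).

Let r_le z : `|r z| <= 2.
Proof. by case: z => x y; exact: ray_average_le (r1 y) x. Qed.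

Let brX (k l : int) : bmeas (fun w => r (X k w, X l w)).
Proof.
by apply: (bmeas_comp (p := fun w => (X k w, X l w))) => //; exact: measurable_fun_pair.
Qed.

Lemma bmeas_remainder_part n : bmeas (remainder_part n).
Proof.
apply: bmeasM; first exact: bmeas_cst.
apply: bmeasM; first exact: bmeas_cst.
by do 2!(apply: bmeas_sum => ?).
Qed.

Let bulk g n w : R := Num.sqrt n%:R *
  ((n%:R * (m n)%:R)^-1 * \sum_(0 <= i < n) \sum_(g <= a < m n)
    r (X i.+1%:Z w, X (n + a).+1%:Z w)).

Let bbulk g n : bmeas (bulk g n).
Proof.
apply: bmeasM; first exact: bmeas_cst.
apply: bmeasM; first exact: bmeas_cst.
by do 2!(apply: bmeas_sum => ?).
Qed.

(** The first [g] members of the second sample follow the first sample too closely to be decoupled.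
    They give at most [n * g] terms bounded by 2, negligible after scaling. *)
Let remainder_le g n w : (0 < n)%N ->
  `|remainder_part n w| <= 2 * g%:R * (Num.sqrt n%:R / (m n)%:R) + `|bulk g n w|.
Proof.
move=> n0; have mn0 := m_gt0 n.
have nR : 0 < n%:R :> R by rewrite ltr0n.
have mR : 0 < (m n)%:R :> R by rewrite ltr0n.
pose S := \sum_(0 <= i < n) \sum_(0 <= a < minn g (m n))
    r (X i.+1%:Z w, X (n + a).+1%:Z w).
have -> : remainder_part n w =
    Num.sqrt n%:R * ((n%:R * (m n)%:R)^-1 * S) + bulk g n w.
  rewrite /remainder_part /bulk -mulrDr -mulrDr; congr (_ * (_ * _)).
  rewrite -big_split/=; apply: eq_bigr => i _.
  have -> : \sum_(n <= j < n + m n) r (X i.+1%:Z w, X j.+1%:Z w) =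
      \sum_(0 <= a < m n) r (X i.+1%:Z w, X (n + a).+1%:Z w).
    rewrite -[X in \sum_(X <= _ < _) _]add0n big_addn addKn.
    by apply: eq_bigr => a _; rewrite addnC.
  have [gm|mg] := leqP g (m n).
    by rewrite (big_cat_nat (leq0n g) gm).
  by rewrite [X in _ = _ + X]big_geq ?addr0// ltnW.
apply: (le_trans (ler_normD _ _)); rewrite lerD2r.
have S_le : `|S| <= n%:R * (g%:R * 2).
  apply: (le_trans (ler_norm_sum _ _ _)).
  apply: (@le_trans _ _ (\sum_(0 <= i < n) (g%:R * 2))); last first.
    by rewrite sumr_const_nat subn0 -[leLHS]mulr_natl.
  apply: ler_sum => i _; apply: (le_trans (ler_norm_sum _ _ _)).
  apply: (@le_trans _ _ (\sum_(0 <= a < minn g (m n)) 2)).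
    by apply: ler_sum => a _; exact: r_le.
  by rewrite sumr_const_nat subn0 -[leLHS]mulr_natl ler_wpM2r// ler_nat geq_minl.
rewrite !normrM ger0_norm// ger0_norm ?invr_ge0 ?mulr_ge0//.
have -> : 2 * g%:R * (Num.sqrt n%:R / (m n)%:R) =
    Num.sqrt n%:R * ((n%:R * (m n)%:R)^-1 * (n%:R * (g%:R * 2))) :> R.
  by field; rewrite !gt_eqF.
by rewrite ler_wpM2l// ler_wpM2l// invr_ge0 mulr_ge0.
Qed.

Lemma cvg_remainder : \int[P]_w `|remainder_part n w| @[n --> \oo] --> (0 : R).
Proof.
(* One [dl] pays for the gap, one comes from [x <= dl + x^2 / dl], and the second moment, at most
   [3 * dl ^+ 2], gives the other three. *)
apply/cvgr0Pnorm_le => e e0; pose dl := e / 5.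
have dl0 : 0 < dl by rewrite divr_gt0.
have dl2 : 0 < dl ^+ 2 by rewrite exprn_gt0.
have [B [B0 sumB]] := sum_betaR_bounded beta2_summable.
have tau0 : 0 < dl ^+ 2 / (24 * (1 + c)) by rewrite divr_gt0// mulr_gt0// ltr_pwDl.
have [G G0 tailG] := sum_betaR_tail beta2_summable tau0.
have tau'0 : 0 < dl ^+ 2 / 8 by rewrite divr_gt0.
have [L L0 tailL] := sum_betaR_tail beta2_summable tau'0.
pose g := G.-1; rewrite -(prednK G0) -/g in tailG.
have cvgq (K : R) : K * (Num.sqrt n%:R / (m n)%:R) @[n --> \oo] --> (0 : R).
  by have h := cvgM (cvg_cst K) (cvg_sqrt_div m_gt0 m_cvg); rewrite mulr0 in h; exact: h.
near=> n.
have n0 : (0 < n)%N by near: n; exact: nbhs_infty_gt.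
have near1 : 2 * g%:R * (Num.sqrt n%:R / (m n)%:R) <= dl.
  by near: n; apply: (cvgr_le 0).
have near2 : 16 * L%:R * (1 + B) * (Num.sqrt n%:R / (m n)%:R) <= dl ^+ 2.
  by near: n; apply: (cvgr_le 0).
have near3 : n%:R / (m n)%:R <= 1 + c.
  by near: n; apply: (cvgr_le c) => //; rewrite ltrDr.
have nR : 0 < n%:R :> R by rewrite ltr0n.
have mR : 0 < (m n)%:R :> R by rewrite ltr0n.
have Ebulk : \int[P]_w (bulk g n w ^+ 2) <= 3 * dl ^+ 2.
  have h := Ex_remainder_sqr X_stationary Q1X Q2X beta2_summable br r1 r2
    n (m n) L0 sumB tailG tailL.
  pose K : R := n%:R / (n%:R * (m n)%:R) ^+ 2.
  have K0 : 0 <= K by rewrite divr_ge0 ?sqr_ge0.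
  have -> : \int[P]_w (bulk g n w ^+ 2) =
      K * \int[P]_w ((\sum_(0 <= i < n) \sum_(g <= a < m n)
    r (X i.+1%:Z w, X (n + a).+1%:Z w)) ^+ 2).
    rewrite -ExZl; last first.
      under eq_fun do rewrite expr2.
      by apply: bmeasM; do 2!(apply: bmeas_sum => ?).
    apply: eq_Rintegral => w _; rewrite /bulk !exprMn sqr_sqrtr ?ler0n// mulrA.
    by rewrite /K exprVn.
  apply: (le_trans (ler_wpM2l K0 h)).
  move: near2 near3; rewrite /K.
  (* So [1 / m <= sqrt n / m], and [near2] covers the middle term. *)
  have s1 : 1 <= Num.sqrt n%:R :> R.
    by rewrite -[leLHS]sqrtr1; apply: ler_wsqrtr; rewrite ler1n.
  set q := 16 * L%:R * (1 + B); set tau := dl ^+ 2 / (24 * _) => near2 near3.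
  have q0 : 0 <= q by rewrite !mulr_ge0// addr_ge0.
  rewrite [leLHS](_ : _ = 24 * tau * (n%:R / (m n)%:R) + q * (1 / (m n)%:R) +
    8 * (dl ^+ 2 / 8)); last first.
    by field; rewrite !gt_eqF.
  have -> : 3 * dl ^+ 2 = dl ^+ 2 + dl ^+ 2 + 8 * (dl ^+ 2 / 8) by field.
  rewrite lerD2r; apply: lerD.
    have -> : dl ^+ 2 = 24 * tau * (1 + c).
      by rewrite /tau; field; rewrite gt_eqF// ltr_pwDl.
    by rewrite ler_wpM2l// mulr_ge0// ltW.
  apply: le_trans near2; rewrite ler_wpM2l// ler_wpM2r// invr_ge0 ltW//.
rewrite ger0_norm; last by apply: Ex_ge0.
apply: (@le_trans _ _ (\int[P]_w (dl + dl + dl^-1 * bulk g n w ^+ 2))).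
  have b2 : bmeas (fun w => bulk g n w ^+ 2).
    by under eq_fun do rewrite expr2; apply: bmeasM.
  apply: Ex_le => [||w].
  - exact: bmeas_norm (bmeas_remainder_part n).
  - apply: bmeasD; first exact: bmeas_cst.
    by apply: bmeasM => //; exact: bmeas_cst.
  - apply: (le_trans (remainder_le g w n0)); rewrite -addrA; apply: lerD => //.
    rewrite -(real_normK (num_real (bulk g n w))).
    move: `|_| (normr_ge0 (bulk g n w)) => x x0.
    rewrite -subr_ge0 (_ : _ - _ = dl^-1 * ((x - dl / 2) ^+ 2 + 3 / 4 * dl ^+ 2)).
      by rewrite mulr_ge0 ?invr_ge0 ?ltW// ltr_wpDl ?sqr_ge0// mulr_gt0.
    by field; rewrite gt_eqF.
rewrite ExD; last 2 first.
- exact: bmeas_cst.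
- apply: bmeasM; first exact: bmeas_cst.
  by under eq_fun do rewrite expr2; apply: bmeasM.
rewrite Ex_cst ExZl; last by under eq_fun do rewrite expr2; apply: bmeasM.
have -> : e = dl + dl + dl^-1 * (3 * dl ^+ 2) by rewrite /dl; field; rewrite gt_eqF.
by rewrite lerD2l ler_wpM2l// invr_ge0 ltW.
Unshelve. all: end_near.
Qed.

End remainder_limit.

(** * Asymptotic normality *)

Lemma bmeas_cos_affine d (T : measurableType d) (R : realType) (t alpha : R)
    (u : T -> R) : measurable_fun setT u -> bmeas (fun w => cos (t * u w + alpha)).
Proof. by move=> mu; apply: bmeas_cos; apply: measurable_funD => //; exact: measurable_funM. Qed.

Lemma Ex_normal_law_cos (R : realType) (V t alpha : R) : 0 <= V ->
  \int[normal_law V]_x cos (t * x + alpha) = expR (- (t ^+ 2 * V / 2)) * cos alpha.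
Proof.
rewrite le_eqVlt eq_sym /normal_law => /orP[/eqP ->|V0].
  rewrite eqxx /Rintegral integral_dirac//=; last first.
    by apply/measurable_EFinP; case: (bmeas_cos_affine t alpha (@measurable_id _ R setT)).
  by rewrite indicT mul1r !mulr0 mul0r oppr0 expR0 mul1r add0r.
rewrite gt_eqF// Ex_normal; last exact: bmeas_cos_affine.
by rewrite normal_pdf_fourier ?sqrtr_gt0// sqr_sqrtr// ltW.
Qed.

Section autocovariance.
Context d (T : measurableType d) (R : realType) (P : probability T R).
Variable X : int -> {RV P >-> R}.
Hypothesis X_stationary : strictly_stationary X.

Lemma covariance_Ex (g : R -> R) (mean : R) (k : int) : bmeas g ->
  \int[distribution P (X 0)]_x g x = mean ->
  fine (covariance P (g \o X 0) (g \o X k)) =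
  \int[P]_w ((g (X 0 w) - mean) * (g (X k w) - mean)).
Proof.
move=> bg gE; have Xmean (i : int) : fine 'E_P[g \o X i] = mean.
  rewrite unlock -gE Ex_distribution// -(stationary_law X_stationary i bg).
  by rewrite /Rintegral.
by rewrite unlock !Xmean unlock.
Qed.

End autocovariance.

Section limit_theorem.
Context d (T : measurableType d) (R : realType) (P : probability T R).
Variable X : int -> {RV P >-> R}.
Local Notation TG := (g_sigma_algebraType (past_events X)).
Variable Q1 : int -> R.-pker TG ~> R.
Variable Q2 : int -> int -> R.-pker TG ~> (R * R)%type.
Hypothesis X_stationary : strictly_stationary X.
Hypothesis Q1X : forall k : int, is_cond_distribution (P := P) (X k) (Q1 k).
Hypothesis Q2X : forall i j : int,
  is_cond_distribution (P := P) (pairRV (X i) (X j)) (Q2 i j).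
Hypothesis beta2_summable : (\sum_(1 <= k <oo) beta2 Q1 Q2 k < +oo)%E.
Variable f : R -> R.
Hypothesis f_mono : {homo f : x y / x <= y} \/ {homo f : x y /~ x <= y}.
Variables (m : nat -> nat) (c : R).
Hypothesis m_gt0 : forall n, (0 < m n)%N.
Hypothesis m_cvg : (n%:R / (m n)%:R : R) @[n --> \oo] --> c.
Hypothesis c0 : 0 <= c.

Let xi := mw_proj1 X f.
Let eta := mw_proj2 X f.
Let rxi : ray_average X 1 xi. Proof. exact: ray_average_mw_proj1. Qed.
Let reta : ray_average X 1 eta. Proof. exact: ray_average_mw_proj2. Qed.

Let H_mean : \int[distribution P (X 0)]_x H_Y X f x = mw_mean X f.
Proof. by rewrite (H_Y_mw_mean2 X_stationary f_mono). Qed.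

Let G_mean : \int[distribution P (X 0)]_x (G_X X \o f) x = mw_mean X f.
Proof.
rewrite (G_X_mw_mean1 X_stationary f_mono) /mw_mean.
by rewrite (Ex_fubini _ _ (bmeas_mw_kernel f_mono)).
Qed.

Let bH : bmeas (H_Y X f).
Proof. by rewrite (H_Y_mw_mean2 X_stationary f_mono); exact: bmeas_mw_mean2. Qed.

Let bG : bmeas (G_X X \o f).
Proof. by rewrite (G_X_mw_mean1 X_stationary f_mono); exact: bmeas_mw_mean1. Qed.

Let autocovH k : fine (covariance P (H_Y X f \o X 0) (H_Y X f \o X k%:Z)) = gam X xi k.
Proof.
by rewrite (covariance_Ex X_stationary _ bH H_mean) (H_Y_mw_mean2 X_stationary f_mono).
Qed.

Let autocovG k :
  fine (covariance P ((G_X X \o f) \o X 0) ((G_X X \o f) \o X k%:Z)) = gam X eta k.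
Proof.
by rewrite (covariance_Ex X_stationary _ bG G_mean) (G_X_mw_mean1 X_stationary f_mono).
Qed.

Let autocov_sumsH : autocov_sums X (H_Y X f) = fun n => \sum_(1 <= l < n) gam X xi l.
Proof. by apply/funext => n; apply: eq_bigr => k _; exact: autocovH. Qed.

Let autocov_sumsG : autocov_sums X (G_X X \o f) = fun n => \sum_(1 <= l < n) gam X eta l.
Proof. by apply/funext => n; apply: eq_bigr => k _; exact: autocovG. Qed.

Lemma cvg_autocov_sums_H_Y : cvgn (autocov_sums X (H_Y X f)).
Proof. by rewrite autocov_sumsH; exact: (cvg_gam_sums X_stationary Q1X beta2_summable). Qed.

Lemma cvg_autocov_sums_G_X : cvgn (autocov_sums X (G_X X \o f)).
Proof. by rewrite autocov_sumsG; exact: (cvg_gam_sums X_stationary Q1X beta2_summable). Qed.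

Lemma MW_varianceE : MW_variance X f c = lrv X xi + c * lrv X eta.
Proof.
rewrite /MW_variance /long_run_variance /variance autocov_sumsH autocov_sumsG.
by rewrite (autocovH 0) (autocovG 0).
Qed.

Let Z n w := Num.sqrt n%:R * (MW_U X f n (m n) w - MW_pi X f).

Lemma bmeas_MW_U n k : bmeas (MW_U X f n k).
Proof.
apply: bmeasM; first exact: bmeas_cst.
apply: bmeas_sum => i; apply: bmeas_sum => j.
apply: (bmeas_comp (p := fun w => (X i%:Z w, X j%:Z w))) (bmeas_mw_kernel f_mono).
exact: measurable_fun_pair.
Qed.

Let bZ n : bmeas (Z n).
Proof.
apply: bmeasM; first exact: bmeas_cst.
by apply: bmeasB; [exact: bmeas_MW_U|exact: bmeas_cst].
Qed.

(** Slutsky's argument: the cosine is 1-Lipschitz, so dropping the remainder changes the transform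
    by at most [|t|] times its mean absolute value. *)
Lemma cvg_cos_MW_U (t alpha : R) :
  \int[P]_w cos (t * Z n w + alpha) @[n --> \oo] -->
  expR (- (t ^+ 2 * MW_variance X f c / 2)) * cos alpha.
Proof.
have r1 := ray_average_mw_rem1 X f_mono.
have r2 := ray_average_mw_rem2 X f_mono.
have br := bmeas_mw_rem X f_mono.
have lin := @cvg_cos_linear_part _ _ _ _ _ _ _ X_stationary Q1X Q2X beta2_summable
  _ _ _ _ rxi reta m_gt0 m_cvg c0 t alpha.
have rem := cvg_remainder X_stationary Q1X Q2X beta2_summable br r1 r2 m_gt0 m_cvg c0.
rewrite MW_varianceE.
have blin n : bmeas (linear_part X xi eta m n).
  apply: bmeasM; first exact: bmeas_cst.
  apply: bmeasD; (apply: bmeasM; first exact: bmeas_cst); apply: bmeas_sum => k.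
  - exact: bmeas_comp (ray_average_bmeas rxi).
  - exact: bmeas_comp (ray_average_bmeas reta).
have bcos (u : T -> R) : bmeas u -> bmeas (fun w => cos (t * u w + alpha)).
  by case=> mu _; exact: bmeas_cos_affine.
pose u n := \int[P]_w cos (t * Z n w + alpha).
pose v n := \int[P]_w cos (t * linear_part X xi eta m n w + alpha).
suff uv : u n - v n @[n --> \oo] --> (0 : R).
  rewrite (_ : (fun n => _) = (fun n => u n - v n + v n)); last first.
    by apply/funext => n; rewrite subrK.
  by rewrite -[X in _ --> X]add0r; exact: cvgD uv lin.
rewrite /u /v {u v}.
apply/norm_cvg0P.
have up : `|t| * \int[P]_w `|remainder_part X (mw_rem X f) m n w| @[n --> \oo] --> (0 : R).
  by have h := cvgM (cvg_cst `|t|) rem; rewrite mulr0 in h; exact: h.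
apply: (squeeze_cvgr _ (cvg_cst 0) up); near=> n.
have n0 : (0 < n)%N by near: n; exact: nbhs_infty_gt.
rewrite normr_ge0/=.
have brn := bmeas_remainder_part X br m n.
rewrite -ExB; last 2 first.
- exact: bcos.
- exact: bcos.
rewrite -ExZl; last exact: bmeas_norm.
apply: Ex_norm_le => [||w].
- by apply: bmeasB; exact: bcos.
- by apply: bmeasM; [exact: bmeas_cst|exact: bmeas_norm].
have -> : Z n w = linear_part X xi eta m n w + remainder_part X (mw_rem X f) m n w.
  rewrite /Z (MW_U_decomposition X_stationary f_mono w n0 (m_gt0 n)).
  by rewrite mulrDr.
by rewrite mulrDr addrAC -normrM; exact: cos_lip.
Unshelve. all: end_near.
Qed.

(** The limit of means of cosines at [t = 1], [alpha = 0] is [expR (- V / 2)], and it cannot exceed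
    1. This precedes the convergence in law, since [normal_law] needs [0 <= V]. *)
Lemma MW_variance_ge0 : 0 <= MW_variance X f c.
Proof.
have := @cvg_cos_MW_U 1 0; rewrite cos0 mulr1 expr1n mul1r => h.
have : expR (- (MW_variance X f c / 2)) <= 1.
  rewrite -(cvg_lim (@Rhausdorff R) h); apply: limr_le.
    by apply/cvg_ex; eexists; exact: h.
  apply: nearW => n; apply: le_trans (ler_norm _) _.
  have [mu _] := bZ n.
  apply: Ex_bound => [|w]; last by rewrite ler_norml cos_geN1 cos_le1.
  by case: (bmeas_cos_affine 1 0 mu).
by rewrite -[leRHS]expR0 ler_expR oppr_le0 pmulr_lge0.
Qed.

Lemma cvg_in_distribution_MW_U :
  cvg_in_distribution P Z (normal_law (MW_variance X f c)).
Proof.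
have mZ n : measurable_fun setT (Z n) by case: (bZ n).
split=> // g cg bg.
have bmg : bmeas g.
  have mg : measurable_fun setT g by exact: continuous_measurable_fun.
  case: bg => M0 [_ gM0]; apply: (bmeas_le (M := `|M0| + 1)) => // x.
  by apply: gM0 => //; rewrite ltr_pwDr// ler_norm.
have := @levy_continuity _ _ _ P Z (normal_law (MW_variance X f c)) mZ _ g cg bg.
move=> /(_ _) h.
rewrite -(EFin_RintegralE (normal_law _) bmg).
under eq_fun do rewrite -(EFin_RintegralE P (bmeas_comp (mZ _) bmg)).
apply: cvg_EFin; first exact: nearW.
apply: h => t alpha; rewrite Ex_normal_law_cos; first exact: cvg_cos_MW_U.
exact: MW_variance_ge0.
Qed.

End limit_theorem.

Theorem theorem5p1 (d : measure_display) (T : measurableType d) (R : realType)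
    (P : probability T R) (X : int -> {RV P >-> R})
    (Q1 : int -> R.-pker (g_sigma_algebraType (past_events X)) ~> R)
    (Q2 : int -> int ->
       R.-pker (g_sigma_algebraType (past_events X)) ~> (R * R)%type)
    (f : R -> R) (m : nat -> nat) (c : R)
    (X_stationary : strictly_stationary X)
    (Q1_cond : forall k : int, is_cond_distribution (P := P) (X k) (Q1 k))
    (Q2_cond : forall i j : int,
       is_cond_distribution (P := P) (pairRV (X i) (X j)) (Q2 i j))
    (f_monotonic : {homo f : x y / x <= y} \/ {homo f : x y /~ x <= y})
    (beta2_summable : (\sum_(1 <= k <oo) beta2 Q1 Q2 k < +oo)%E)
    (m_gt0 : forall n, (0 < m n)%N)
    (c_ge0 : 0 <= c)
    (m_cvg : (n%:R / (m n)%:R : R) @[n --> \oo] --> c) :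
  [/\ cvgn (autocov_sums X (H_Y X f)),
      cvgn (autocov_sums X (G_X X \o f)),
      0 <= MW_variance X f c &
      cvg_in_distribution P
        (fun n w => Num.sqrt n%:R * (MW_U X f n (m n) w - MW_pi X f))
        (normal_law (MW_variance X f c))].
Proof.
split.
- exact: (cvg_autocov_sums_H_Y X_stationary Q1_cond beta2_summable f_monotonic).
- exact: (cvg_autocov_sums_G_X X_stationary Q1_cond beta2_summable f_monotonic).
- exact: (MW_variance_ge0 X_stationary Q1_cond Q2_cond beta2_summable f_monotonic
    m_gt0 m_cvg c_ge0).
- exact: (cvg_in_distribution_MW_U X_stationary Q1_cond Q2_cond beta2_summable
    f_monotonic m_gt0 m_cvg c_ge0).
Qed.
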